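(* Let $M\geq 12$ be an integer and let $G$ be a planar graph with maximum degree $\Delta\leq M$. Then $\lambda_2^T(G)\leq M+2$. In particular, $\lambda_2^T(G)\leq\Delta+2$ if $M=\Delta$.
   Context: All graphs are finite, simple and undirected. For a positive integer $k$, a $k$-(2,1)-total labelling of a graph $G$ is a function $c: V(G)\cup E(G)\to\{0,1,\dots,k\}$ such that $c(u)\neq c(v)$ whenever $uv\in E(G)$; $c(e)\neq c(e')$ whenever $e$ and $e'$ are two adjacent edges (distinct edges sharing an endpoint); and $|c(u)-c(e)|\geq 2$ whenever the vertex $u$ is incident with the edge $e$. The (2,1)-total labelling number $\lambda_2^T(G)$ is the minimum $k$ such that $G$ has a $k$-(2,1)-total labelling. *)

(* Defs.v *)
From HB Require Import structures.
From mathcomp Require Import all_boot all_order all_algebra.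

Set Implicit Arguments.
Unset Strict Implicit.
Unset Printing Implicit Defensive.

Import Order.TTheory GRing.Theory Num.Theory.

Local Open Scope nat_scope.

Record sgraph := SGraph {
  vertex :> finType;
  adj : rel vertex;
  adj_sym : symmetric adj;
  adj_irrefl : irreflexive adj
}.

Section Labelling.
Variable G : sgraph.

Definition edge_set : {set {set G}} :=
  [set f : {set G} | [exists x, exists y, adj x y && (f == [set x; y])]].

Definition edge : finType := {f : {set G} | f \in edge_set}.

Definition degree (x : G) : nat := #|[set y | adj x y]|.

Definition max_degree : nat := \max_(x : G) degree x.

(* The labels {0, ..., k} form the type 'I_k.+1; the domain V(G) \cup E(G) is
   the disjoint sum of the vertex and edge types. *)
Definition is_total_labelling k (c : {ffun G + edge -> 'I_k.+1}) : bool :=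
  [&& [forall x : G, forall y : G, adj x y ==> (c (inl x) != c (inl y))],
      [forall f : edge, forall g : edge,
         (f != g) && (val f :&: val g != set0) ==> (c (inr f) != c (inr g))]
    & [forall x : G, forall f : edge,
         (x \in val f) ==> (2 <= `|c (inl x) - c (inr f)|%N)]].

Definition has_total_labelling k : bool :=
  (0 < k) && [exists c : {ffun G + edge -> 'I_k.+1}, is_total_labelling c].

(* Giving pairwise distinct even labels to all vertices and edges. *)
Lemma total_labelling_exists : exists k, has_total_labelling k.
Proof.
pose r (z : (G + edge)%type) : nat := enum_rank z.
have rP z : (r z).*2 < (#|{: G + edge}|).*2.+1.+1.
  by rewrite ltnS (leq_trans _ (leqnSn _)) // leq_double ltnW // ltn_ord.
have rI z t : z != t -> r z != r t.
  by apply: contra_neq => /ord_inj /enum_rank_inj.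
exists (#|{: G + edge}|).*2.+1; rewrite /has_total_labelling /=.
apply/existsP; exists [ffun z => Ordinal (rP z)].
apply/and3P; split.
- apply/forallP=> x; apply/forallP=> y; apply/implyP=> xy.
  rewrite !ffunE -val_eqE /= (inj_eq double_inj) rI //.
  by apply: contraTneq xy => -[->]; rewrite adj_irrefl.
- apply/forallP=> f; apply/forallP=> g; apply/implyP=> /andP[fg _].
  rewrite !ffunE -val_eqE /= (inj_eq double_inj) rI //.
apply/forallP=> x; apply/forallP=> f; apply/implyP=> _.
rewrite !ffunE /=; have /rI : inl x != inr f :> G + edge by [].
rewrite neq_ltn => /orP[] lt_r.
  by rewrite distnEr ?(leq_double, ltnW lt_r) // -doubleB -[2]/(1.*2) leq_double subn_gt0.
by rewrite distnEl ?(leq_double, ltnW lt_r) // -doubleB -[2]/(1.*2) leq_double subn_gt0.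
Qed.

Definition total_labelling_number : nat := ex_minn total_labelling_exists.

End Labelling.

From mathcomp Require Import all_classical all_reals all_analysis.
Import numFieldNormedType.Exports.

Section Planarity.
Local Open Scope ring_scope.
Local Open Scope classical_set_scope.
Variables (R : realType) (G : sgraph).

(* The point pos x represents the vertex x, and the edge f is represented by
   the arc arc f restricted to [0, 1], which joins the two ends of f. *)
Record is_plane_drawing (pos : G -> R * R) (arc : edge G -> R -> R * R) : Prop :=
  IsPlaneDrawing {
    pos_inj : injective pos;
    arc_continuous : forall f, {within `[0, 1], continuous (arc f)};
    arc_inj : forall f, {in `[0, 1]%R &, injective (arc f)};
    arc_ends : forall f, [set arc f 0; arc f 1] = pos @` [set x | x \in val f];
    arc_avoids_vertices : forall f x (t : R), t \in `]0, 1[%R -> arc f t <> pos x;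
    arcs_disjoint : forall f g (s t : R), f != g ->
      s \in `]0, 1[%R -> t \in `[0, 1]%R -> arc f s <> arc g t
  }.

Definition planar : Prop := exists pos arc, is_plane_drawing pos arc.

End Planarity.

(* Main.v *)
Require Import Defs.
From HB Require Import structures.
From mathcomp Require Import all_boot all_order all_algebra.
From mathcomp Require Import zify ring lra.
From mathcomp Require boolp.

(** Why the theorem is true.

    Use the labels as M + 3 colours.  Work with pairs of graphs H <= A on one
    vertex set: the vertices must be coloured properly for A, while only the
    edges of H receive colours.  Separating the two roles matters: if the edge
    uv is simply deleted, the colouring of the rest may give u and v the same
    colour, and this cannot be repaired when both ends have large degree;
    taking uv out of H alone keeps the ends apart.  If a planar graph of
    maximum degree at most M had no labelling, there would be a minimal pair
    [critical] without one, and counting forbidden colours shows in it that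
    an edge uv of H satisfies d(u) + d(v) >= M - 1 ([edge_sum]), even >= M when
    d(u) = 4 ([four_edge]) and >= M + 2 when d(u) <= 3 ([low_edge]); that a
    triangle on an edge of degree sum M - 1 has a third corner of degree M
    ([triangle_edge]); and that an edge of A outside H joins vertices too
    constrained to be recoloured ([loose_edge_heavy]).  The vertices of degree
    2 and 3 are too many for such local arguments; they are controlled by
    [alternator], where all edges at a set of them are recoloured at once with
    Galvin's method (list colouring of a bipartite line graph by stable
    matchings, [kernel_colouring]).  It implies that these vertices can be
    assigned to neighbours, at most two to a vertex of degree M and at most
    one to a vertex of degree M - 1 ([masters]).

    Planarity is used through one consequence, the record [faces]: a family F
    of nonempty even subgraphs, at most two of them through each edge, with
    m + 1 <= n + |F|.  Give charge d - 4 to a vertex of degree d and charge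
    l - 4 to a member of F of length l: the total is negative.  Yet a member
    which is a triangle can be paid by its corners ([triangle_weight]), the assignment pays one unit
    to each vertex of degree 2 or 3, and the second unit needed at a vertex u
    of degree 2 comes from the corners at its two neighbours which are not in
    triangles ([two_supply]).  So the total is nonnegative ([discharging]).

    To obtain [faces] from a topological drawing, the plane is cut into small
    pixels.  By compactness the arcs stay apart outside small squares around
    the vertices, so the graph becomes a minor of the square grid, each vertex
    being a connected set of pixels ([planar_grid_model]).  An even subgraph z
    lifts to a cycle of the grid, which winds w_z(s) times modulo 2 around a
    unit square s; crossing an edge of the drawing changes w_z by the
    coefficient of z on this edge.  Call two squares equivalent when no z
    distinguishes them.  The boundaries of the classes are even subgraphs, an
    edge lies on the boundary of at most two classes, and the identity
    z = sum over the classes phi of w_z(phi) times the boundary of phi shows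
    that the boundaries span the cycle space, of dimension at least m - n + 1
    ([boundary_span]).  This gives the half of Euler's formula that is needed,
    without any appeal to the Jordan curve theorem. *)

Set Implicit Arguments.
Unset Strict Implicit.
Unset Printing Implicit Defensive.

Import GRing.Theory.
Local Open Scope nat_scope.

(** * Stable matchings and list colourings of bipartite line graphs *)

Section ListColouring.
Variables (I : finType) (X Y : eqType) (px : I -> X) (py : I -> Y).
Variables (rx ry : I -> nat).
Hypotheses (rx_inj : injective rx) (ry_inj : injective ry).

(** The line graph of a bipartite graph is oriented by preferences: [px] and [py]
    give the two ends of an edge, and each end ranks its edges by [rx], [ry]. *)
Definition beats (j i : I) : bool :=
  ((px j == px i) && (rx j < rx i)) || ((py j == py i) && (ry j < ry i)).

Definition touch (i j : I) : bool := (px i == px j) || (py i == py j).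

Definition matching (M : {set I}) : Prop :=
  {in M &, forall i j, i != j -> ~~ touch i j}.

(** Gale and Shapley's argument.  Let every x propose its best edge.  If two of
    the proposals meet at the same y, the worse one can be discarded: the better
    one stays the best edge of its own x, so in the rest y ends up with an edge
    at least as good. *)
Lemma stable_matching (S : {set I}) :
  exists M : {set I}, [/\ M \subset S, matching M &
    forall i, i \in S -> i \notin M -> exists2 j, j \in M & beats j i].
Proof.
have [n] := ubnP #|S|; elim: n S => // n IHn S; rewrite ltnS => leSn.
pose B := [set i in S | [forall j in S, (px j == px i) ==> (rx i <= rx j)]].
have Bmin i j : i \in B -> j \in S -> px j = px i -> rx i <= rx j.
  rewrite inE => /andP[_ /forall_inP Bi] jS /eqP pji.
  by have /implyP := Bi j jS; apply.
have BS i : i \in B -> i \in S by rewrite inE => /andP[].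
have [/existsP[i /existsP[j /and5P[iB jB ij pyij rij]]]|noij] :=
    boolP [exists i, exists j,
      [&& i \in B, j \in B, i != j, py i == py j & ry i < ry j]].
  have jS := BS _ jB.
  have [|M [MS Mm Mst]] := IHn (S :\ j).
    by have := cardsD1 j S; rewrite jS; lia.
  exists M; split=> //; first exact: subset_trans MS (subD1set _ _).
  move=> k kS kM; have [kj|kj] := eqVneq k j; last first.
    by apply: Mst => //; rewrite in_setD1 kj.
  subst k; have [iM|iM] := boolP (i \in M).
    by exists i => //; rewrite /beats pyij rij orbT.
  have [|k kM' bki] := Mst i _ iM; first by rewrite in_setD1 ij BS.
  exists k => //; case/orP: bki => /andP[/eqP pki rki].
    have kS' : k \in S by have := subsetP MS _ kM'; rewrite in_setD1 => /andP[].
    by have := Bmin i k iB kS' pki; rewrite leqNgt rki.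
  by rewrite /beats pki pyij (ltn_trans rki rij) /= orbT.
have Bm : matching B.
  move=> i j iB jB ij; apply/negP => /orP[/eqP pij|/eqP pij].
    have le1 := Bmin i j iB (BS _ jB) (esym pij).
    have le2 := Bmin j i jB (BS _ iB) pij.
    by case/eqP: ij; apply: rx_inj; lia.
  have nij k l : k \in B -> l \in B -> k != l -> py k = py l -> ~~ (ry k < ry l).
    move=> kB lB kl /eqP pkl; apply: contra noij => rkl.
    by apply/existsP; exists k; apply/existsP; exists l; apply/and5P.
  have h1 := nij _ _ iB jB ij pij.
  have h2 := nij j i jB iB _ (esym pij); rewrite eq_sym in h2.
  by case/eqP: (ij); apply: ry_inj; move: (h2 ij); lia.
exists B; split=> //; first by apply/subsetP => i /BS.
move=> i iS iB.
have [k /andP[kS /eqP pk] kmin] := @arg_minnP _ i [pred j | (j \in S) && (px j == px i)] rx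
  ltac:(by rewrite /= iS eqxx).
have kB : k \in B.
  rewrite inE kS; apply/forall_inP => j jS; apply/implyP => /eqP pj.
  by apply: kmin; rewrite /= jS pj pk eqxx.
exists k => //; rewrite /beats pk eqxx /=.
have := kmin i; rewrite /= iS eqxx => /(_ isT).
rewrite leq_eqVlt => /orP[/eqP/rx_inj ki|->//].
by rewrite -ki kB in iB.
Qed.

(** Galvin's argument: a stable matching of the edges whose list contains a
    colour a receives a; every other edge with a in its list loses one colour
    and at least one of the edges that beat it. *)
Lemma kernel_colouring (C : finType) (c0 : C) (S : {set I}) (L : I -> {set C}) :
  (forall i, i \in S -> #|[set j in S | beats j i]| < #|L i|) ->
  exists c : I -> C, {in S, forall i, c i \in L i} /\
    {in S &, forall i j, i != j -> touch i j -> c i != c j}.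
Proof.
have [n] := ubnP #|S|; elim: n S L => // n IHn S L; rewrite ltnS => leSn out.
have [->|[i0 i0S]] := set_0Vmem S.
  by exists (fun=> c0); split=> [i|i j]; rewrite inE.
have [a aL] : exists a, a \in L i0.
  by apply/set0Pn; rewrite -card_gt0; apply: leq_ltn_trans (out _ i0S).
have [M [MS Mm Mst]] := stable_matching [set i in S | a \in L i].
have MS' : M \subset S.
  by apply: subset_trans MS _; apply/subsetP => i; rewrite inE => /andP[].
have [m mM] : exists m, m \in M.
  have [i0M|i0M] := boolP (i0 \in M); first by exists i0.
  by have [|j jM _] := Mst i0 _ i0M; [rewrite inE i0S | exists j].
have [||c [cL cP]] := IHn (S :\: M) (fun i => L i :\ a).
- have := cardsID M S; have -> : S :&: M = M by apply/setIidPr.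
  have : 0 < #|M| by rewrite card_gt0; apply/set0Pn; exists m.
  lia.
- move=> i; rewrite in_setD => /andP[iM iS]; have lt := out _ iS.
  have sub : [set j in S :\: M | beats j i] \subset [set j in S | beats j i].
    by apply/subsetP => j; rewrite !inE => /andP[/andP[_ ->] ->].
  have cD := cardsD1 a (L i).
  have [aLi|aLi] := boolP (a \in L i); last first.
    rewrite (negPf aLi) add0n in cD; rewrite -cD.
    exact: leq_ltn_trans (subset_leq_card sub) lt.
  rewrite aLi add1n in cD; rewrite -ltnS -cD.
  have [|j jM bji] := Mst i _ iM; first by rewrite inE iS.
  suff /proper_card pr : [set k in S :\: M | beats k i] \proper [set k in S | beats k i].
    exact: leq_ltn_trans pr lt.
  rewrite properE sub; apply/subsetPn; exists j; rewrite !inE ?jM //.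
  by rewrite (subsetP MS').
exists (fun i => if i \in M then a else c i); split.
- move=> i iS; case: ifPn => iM.
    by have := subsetP MS _ iM; rewrite inE => /andP[].
  by have := cL i; rewrite !inE iM iS => /(_ isT) /andP[].
- move=> i j iS jS ij tij; case: ifPn => iM; case: ifPn => jM.
  + by have := Mm i j iM jM ij; rewrite tij.
  + by have := cL j; rewrite !inE jM jS => /(_ isT) /andP[]; rewrite eq_sym.
  + by have := cL i; rewrite !inE iM iS => /(_ isT) /andP[].
  + by apply: cP => //; rewrite inE ?iM ?jM.
Qed.

End ListColouring.

(** * Assigning vertices to neighbours of bounded capacity *)

Section Assignment.
Variables (T : finType) (e : rel T) (cap : T -> nat).
Implicit Types (X U : {set T}) (A : T -> T).

Definition load A U y : nat := #|[set x in U | A x == y]|.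

Definition assigns A U : Prop := {in U, forall x, e x (A x)}.

Let excess A X : nat := \sum_y (load A X y - cap y).

Let step A X : rel T := fun y z => [exists x in X, (A x == y) && e x z].

Let move A (x z : T) : T -> T := fun w => if w == x then z else A w.

Let load_move A X x z : x \in X -> A x != z -> forall y,
  load (move A x z) X y + (y == A x) = load A X y + (y == z).
Proof.
move=> xX Axz y; rewrite /load /move.
have h (B : T -> T) : #|[set w in X | B w == y]| =
    (B x == y) + #|[set w in X :\ x | B w == y]|.
  rewrite (cardsD1 x) inE xX /=; congr (_ + _).
  by apply: eq_card => w; rewrite !inE; case: (w == x); rewrite //= andbT.
rewrite (h (fun w => if w == x then z else A w)) (h A) /= eqxx.
have -> : [set w in X :\ x | (if w == x then z else A w) == y] =
          [set w in X :\ x | A w == y].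
  by apply/setP => w; rewrite !inE; case: (w == x).
by rewrite (eq_sym (A x)) (eq_sym z); lia.
Qed.

(** On a path without repetition the last vertex is not the origin of a step, so
    changing the assignment there does not break the path. *)
Let path_leave A A' X y0 p :
  path (step A X) y0 p -> uniq (y0 :: p) ->
  (forall u v, u != last y0 p -> step A X u v -> step A' X u v) ->
  path (step A' X) y0 p.
Proof.
elim: p y0 => //= y p IHp y0 /andP[st pth] /and3P[y0p yp up] sub.
rewrite sub // ?IHp //= ?yp //.
by apply: contraNneq y0p => ->; rewrite mem_last.
Qed.

(** Moving the last vertex along the path from an overloaded y0 to an underloaded
    end either lowers the excess at once or makes the previous vertex of the
    path underloaded, with a shorter path to it. *)
Let shift X p y0 A :
  assigns A X -> path (step A X) y0 p -> uniq (y0 :: p) ->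
  cap y0 < load A X y0 -> load A X (last y0 p) < cap (last y0 p) ->
  exists2 A', assigns A' X & excess A' X < excess A X.
Proof.
elim/last_ind: p A => [|p z IHp] A Aok; first by rewrite /=; lia.
rewrite rcons_path last_rcons -rcons_cons rcons_uniq.
set y := last y0 p => /andP[pth /existsP[x /and3P[xX /eqP Axy exz]]].
case/andP => zp up gt0 ltz.
have yz : y != z by apply: contraNneq zp => <-; rewrite mem_last.
have Axz : A x != z by rewrite Axy.
have lm := load_move xX Axz.
have A'ok : assigns (move A x z) X.
  by move=> w wX; rewrite /move; case: eqP => [->|_] //; apply: Aok.
have exle w : load (move A x z) X w - cap w <= load A X w - cap w.
  have := lm w; rewrite Axy; have [->|_] := eqVneq w z; first by lia.
  by case: (w == y); lia.
have [lty|ley] := ltnP (cap y) (load A X y).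
  exists (move A x z) => //; rewrite /excess (bigD1 y) //= [X in _ < X](bigD1 y) //=.
  have : \sum_(i | i != y) (load (move A x z) X i - cap i) <=
         \sum_(i | i != y) (load A X i - cap i) by apply: leq_sum.
  by have := lm y; rewrite Axy eqxx (negPf yz); lia.
have := IHp (move A x z) A'ok; case.
- apply: path_leave pth up _ => u v uy /existsP[w /and3P[wX /eqP Aw ewv]].
  apply/existsP; exists w; rewrite wX ewv /move andbT /=.
  by case: (w =P x) => [wx|_]; [rewrite -Aw wx Axy eqxx in uy | apply/eqP].
- exact: up.
- have := lm y0; rewrite Axy; have -> : (y0 == y) = false.
    by apply/eqP => h; rewrite -h in ley; lia.
  by case: (y0 == z); lia.
- by rewrite -/y; have := lm y; rewrite Axy eqxx (negPf yz); lia.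
move=> A' ? lt; exists A' => //; apply: leq_trans lt _.
by apply: leq_sum => i _.
Qed.

(** A form of Hall's theorem by alternating paths: if no reassignment lowers the
    excess, then everything reachable from an overloaded vertex is filled to
    capacity by the vertices assigned there. *)
Lemma assignment_dichotomy X :
  {in X, forall x, exists y, e x y} ->
  (exists2 A, assigns A X & forall y, load A X y <= cap y) \/
  (exists U A, [/\ U \subset X, U != set0, assigns A U &
    {in U, forall x y, e x y -> cap y <= load A U y}]).
Proof.
move=> nb; have [A Aok] : exists A, assigns A X.
  exists (fun x => odflt x [pick y | e x y]) => x /nb[y exy].
  by case: pickP => [//|/(_ y)]; rewrite exy.
have [n] := ubnP (excess A X); elim: n A Aok => // n IHn A Aok; rewrite ltnS => len.
have [/forallP full|] := boolP [forall y, load A X y <= cap y].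
  by left; exists A.
rewrite negb_forall => /existsP[y0]; rewrite -ltnNge => over.
pose U := [set x in X | connect (step A X) y0 (A x)].
have UX : U \subset X by apply/subsetP => x; rewrite inE => /andP[].
have step_closed x y : x \in U -> e x y -> connect (step A X) y0 y.
  rewrite inE => /andP[xX con] exy; apply: connect_trans con (connect1 _).
  by apply/existsP; exists x; rewrite xX exy eqxx.
have loadU y : connect (step A X) y0 y -> load A U y = load A X y.
  move=> con; apply: eq_card => x; rewrite !inE.
  by case: eqP => [->|_]; rewrite ?con ?andbT ?andbF.
have [/existsP[y /andP[con lty]]|nolow] :=
    boolP [exists y, connect (step A X) y0 y && (load A X y < cap y)].
  case/connectP: con lty => p0 p0p ->; case/shortenP: p0p => p pth up _ lty.
  have [A' A'ok lt] := shift Aok pth up over lty.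
  by apply: IHn A'ok _; apply: leq_trans lt len.
right; exists U, A; split=> //.
- have : 0 < load A X y0 by lia.
  rewrite card_gt0 => /set0Pn[x]; rewrite inE => /andP[xX /eqP Ax].
  by apply/set0Pn; exists x; rewrite inE xX Ax connect0.
- by move=> x /(subsetP UX); apply: Aok.
move=> x xU y exy; have con := step_closed _ _ xU exy.
rewrite loadU // leqNgt; apply: contra nolow => lt.
by apply/existsP; exists y; rewrite con.
Qed.

End Assignment.

(** * Labellings, forbidden labels and recolouring *)

Section Labellings.
Variables (T : finType) (M : nat).
Local Notation colour := 'I_(M + 3).
Implicit Types (A H : rel T) (U : {set T}).
Implicit Types (cv : T -> colour) (ce : T -> T -> colour).

Definition far (a b : nat) : bool := (a.+1 < b) || (b.+1 < a).

Definition deg H x : nat := #|[set y | H x y]|.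

(** A labelling of the pair (A, H) in which the labels of the vertices in [U] are
    disregarded: these vertices are to be relabelled afterwards. *)
Record labelling U A H cv ce : Prop := Labelling {
  lab_vertex : forall x y, A x y -> x \notin U -> y \notin U -> cv x != cv y;
  lab_sym : forall x y, ce x y = ce y x;
  lab_edge : forall x y z, H x y -> H x z -> y != z -> ce x y != ce x z;
  lab_far : forall x y, H x y -> x \notin U -> far (cv x) (ce x y)
}.

Definition labellable A H : Prop := exists cv ce, labelling set0 A H cv ce.

Definition near (c : colour) : {set colour} := [set a : colour | ~~ far c a].

Lemma far_sym a b : far a b = far b a. Proof. exact: orbC. Qed.

Lemma card_near c : #|near c| <= 3.
Proof.
rewrite cardE -(size_map val).
apply: (@uniq_leq_size _ _ [:: (val c).-1; val c; (val c).+1]).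
  by rewrite (map_inj_uniq val_inj) enum_uniq.
move=> _ /mapP[a + ->]; rewrite mem_enum !inE /far /=; lia.
Qed.

Definition edge_colours H ce u : {set colour} := [set ce u y | y in [set y | H u y]].

Definition forbidden U H cv ce u : {set colour} :=
  edge_colours H ce u :|: (if u \in U then set0 else near (cv u)).

Lemma card_edge_colours H ce u : #|edge_colours H ce u| <= deg H u.
Proof. exact: leq_imset_card. Qed.

Lemma card_forbidden U H cv ce u :
  #|forbidden U H cv ce u| <= deg H u + (if u \in U then 0 else 3).
Proof.
rewrite (leq_trans (leq_card_setU _ _)) // leq_add ?card_edge_colours //.
by case: ifP => _; rewrite ?cards0 ?card_near.
Qed.

Lemma unforbidden (S : {set colour}) : #|S| < M + 3 -> exists a, a \notin S.
Proof.
move=> lt; apply/existsP; rewrite -negb_forall; apply: contraL lt => /forallP h.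
by rewrite -leqNgt -[X in X <= _]card_ord; apply/subset_leq_card/subsetP => a _.
Qed.

Definition del_edge H u v : rel T :=
  fun x y => [&& H x y, (x, y) != (u, v) & (x, y) != (v, u)].

Definition upd_edge ce u v a : T -> T -> colour :=
  fun x y => if ((x, y) == (u, v)) || ((x, y) == (v, u)) then a else ce x y.

Lemma del_edge_sub H u v : subrel (del_edge H u v) H.
Proof. by move=> x y /and3P[]. Qed.

Lemma del_edgeC H u v x y : del_edge H u v x y = del_edge H v u x y.
Proof. by congr andb; apply: andbC. Qed.

Lemma del_edge_sym H u v : symmetric H -> symmetric (del_edge H u v).
Proof.
move=> Hs x y; rewrite /del_edge Hs !xpair_eqE.
by congr andb; rewrite andbC; congr (~~ _ && ~~ _); rewrite andbC.
Qed.

Lemma deg_del_edge H u v : H u v -> (deg (del_edge H u v) u).+1 <= deg H u.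
Proof.
move=> Huv; apply/proper_card; rewrite properE; apply/andP; split.
  by apply/subsetP => y; rewrite !inE => /del_edge_sub.
by apply/subsetPn; exists v; rewrite inE // /del_edge eqxx /= andbF.
Qed.

Lemma deg_del_edger H u v : symmetric H -> H u v ->
  (deg (del_edge H u v) v).+1 <= deg H v.
Proof.
move=> Hs Huv; have Hvu : H v u by rewrite Hs.
apply: leq_trans (deg_del_edge Hvu); rewrite ltnS; apply/eq_leq/eq_card => y.
by rewrite !inE del_edgeC.
Qed.

Lemma labelling_sub U A A' H H' cv ce : subrel A' A -> subrel H' H ->
  labelling U A H cv ce -> labelling U A' H' cv ce.
Proof.
move=> sA sH [h1 h2 h3 h4]; split=> // [x y /sA|x y z /sH h /sH|x y /sH]; first exact: h1.
  exact: h3 h.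
exact: h4.
Qed.

Lemma labelling_add_edge U A H u v cv ce a :
  symmetric H -> u != v -> labelling U A (del_edge H u v) cv ce ->
  a \notin forbidden U (del_edge H u v) cv ce u ->
  a \notin forbidden U (del_edge H u v) cv ce v ->
  labelling U A H cv (upd_edge ce u v a).
Proof.
move=> Hs uv [h1 h2 h3 h4] au av.
pose H' := del_edge H u v.
have fb w y : a \notin forbidden U H' cv ce w -> H' w y -> ce w y != a.
  rewrite inE negb_or => /andP[aE _] wy; apply: contraNneq aE => <-.
  by apply: imset_f; rewrite inE.
have ff w : a \notin forbidden U H' cv ce w -> w \notin U -> far (cv w) a.
  by rewrite inE negb_or => /andP[_ aN] wU; rewrite (negPf wU) inE negbK in aN.
have H'E x y : H x y -> ((x, y) == (u, v)) || ((x, y) == (v, u)) = false -> H' x y.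
  by move=> xy /norP[h h']; rewrite /H' /del_edge xy h h'.
split=> //.
- by move=> x y; rewrite /upd_edge !xpair_eqE ![(y == _) && _]andbC h2 orbC.
- have key x y z : H x z -> y != z ->
      ((x, y) == (u, v)) || ((x, y) == (v, u)) ->
      ((x, z) == (u, v)) || ((x, z) == (v, u)) = false /\ ce x z != a.
    move=> xz yz xy.
    have xzN : ((x, z) == (u, v)) || ((x, z) == (v, u)) = false.
      apply/negP => /orP xz'; case/orP: xy => /eqP[? ?]; case: xz' => /eqP[? ?];
        by move/eqP: uv; move/eqP: yz; congruence.
    split=> //; have := H'E _ _ xz xzN.
    by case/orP: xy => /eqP[-> _]; apply: fb.
  move=> x y z xy xz yz; rewrite /upd_edge.
  case: ifP => [|xyN]; first by case/(key _ _ _ xz yz) => -> ?; rewrite eq_sym.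
  case: ifP => [|xzN]; first by rewrite eq_sym in yz; case/(key _ _ _ xy yz).
  by apply: h3 => //; apply: H'E.
- move=> x y xy xU; rewrite /upd_edge; case: ifP => [/orP[]/eqP[xE _]|xyN].
  + by rewrite xE ff // -xE.
  + by rewrite xE ff // -xE.
  + by apply: h4 => //; apply: H'E.
Qed.

(** The vertices of [U] are pairwise nonadjacent, so they can be labelled one by
    one; a neighbour forbids one colour and an incident edge three. *)
Lemma labelling_recolour U A H cv ce :
  symmetric A -> subrel H A -> {in U &, forall x y, ~~ A x y} ->
  {in U, forall x, deg A x + 3 * deg H x < M + 3} ->
  labelling U A H cv ce -> labellable A H.
Proof.
move=> As HA ind low [h1 h2 h3 h4].
pose bad x := [set cv y | y in [set y | A x y]] :|:
  \bigcup_(y | H x y) near (ce x y).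
have card_bad x : x \in U -> #|bad x| < M + 3.
  move=> xU; apply: leq_ltn_trans (low x xU).
  rewrite (leq_trans (leq_card_setU _ _)) // leq_add ?leq_imset_card //.
  have : \sum_(y in [set y | H x y]) #|near (ce x y)| <= 3 * deg H x.
    rewrite mulnC -sum_nat_const; apply: leq_sum => y _; exact: card_near.
  apply: leq_trans; rewrite big_set /=.
  elim/big_rec2: _ => [|y S n _ IH]; first by rewrite cards0.
  by rewrite (leq_trans (leq_card_setU _ _)) // leq_add2l.
exists (fun x => if x \in U then odflt (cv x) [pick a | a \notin bad x] else cv x), ce.
have pickU x : x \in U -> odflt (cv x) [pick a | a \notin bad x] \notin bad x.
  move=> /card_bad/unforbidden[a aN]; case: pickP => [//|/(_ a)].
  by rewrite aN.
have nadj x y : x \in U -> A x y -> odflt (cv x) [pick a | a \notin bad x] != cv y.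
  move=> xU xy; apply: contraNneq (pickU x xU) => ->.
  by rewrite inE imset_f // inE.
split=> // [x y xy _ _|x y xy _].
  case: ifPn => xU; case: ifPn => yU.
  - by have := ind x y xU yU; rewrite xy.
  - exact: nadj.
  - by rewrite eq_sym nadj // As.
  - exact: h1.
case: ifPn => xU; last exact: h4.
have := pickU x xU; apply: contraNT => nf; rewrite inE; apply/orP; right.
by apply/bigcupP; exists y => //; rewrite inE far_sym.
Qed.

End Labellings.

(** * Reducible configurations of a minimal counterexample *)

(** A colour with three near colours is neither the first nor the last one, and
    it is the centre of its interval of near colours. *)
Lemma near_subset_eq M (c c' : 'I_(M + 3)) :
  2 < #|near c| -> near c \subset near c' -> c = c'.
Proof.
move=> three /subsetP sub; apply/val_inj.
have two (a b : nat) : (forall d : 'I_(M + 3), ~~ far c d -> (d == a :> nat) || (d == b :> nat)) -> False.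
  move=> h; have : #|near c| <= size [:: a; b]; last by move=> le; move: (leq_trans three le).
  rewrite cardE -(size_map val); apply: uniq_leq_size.
    by rewrite (map_inj_uniq val_inj) enum_uniq.
  by move=> _ /mapP[d + ->]; rewrite mem_enum !inE => /h.
have lc := ltn_ord c; have lc' := ltn_ord c'.
case: (ltngtP c c') => // cc'.
  have [c0|c0] := posnP c.
    by case: (two 0 1) => d; rewrite /far /=; lia.
  have ltp : c.-1 < M + 3 by lia.
  by have := sub (Ordinal ltp); rewrite !inE /far /=; lia.
have [cM|cM] := leqP (M + 2) c.
  by case: (two c c.-1) => d; rewrite /far /=; have := ltn_ord d; lia.
have ltp : c.+1 < M + 3 by lia.
by have := sub (Ordinal ltp); rewrite !inE /far /=; lia.
Qed.

(** A pair (A, H) without a labelling, minimal under removal of edges from A, or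
    from H alone. *)
Record critical (T : finType) (M : nat) (A H : rel T) : Prop := Critical {
  critical_sym : symmetric A;
  critical_irrefl : irreflexive A;
  critical_symH : symmetric H;
  critical_sub : subrel H A;
  critical_deg : forall x, deg A x <= M;
  critical_unlabellable : ~ labellable M A H;
  critical_minimal : forall A' H' : rel T, symmetric A' -> symmetric H' ->
    subrel A' A -> subrel H' H -> subrel H' A' ->
    (exists x y, (A x y && ~~ A' x y) || (H x y && ~~ H' x y)) ->
    labellable M A' H'
}.

Section Reducible.
Variables (T : finType) (M : nat) (A H : rel T).
Hypotheses (M12 : 12 <= M) (crit : critical M A H).

Let As : symmetric A := critical_sym crit.
Let Ai : irreflexive A := critical_irrefl crit.
Let Hs : symmetric H := critical_symH crit.
Let HA : subrel H A := critical_sub crit.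
Let degM : forall x, deg A x <= M := critical_deg crit.
Let unlabellable : ~ labellable M A H := critical_unlabellable crit.
Let minimal := critical_minimal crit.

Lemma degHA x : deg H x <= deg A x.
Proof. by apply/subset_leq_card/subsetP => y; rewrite !inE => /HA. Qed.

Lemma degHM x : deg H x <= M. Proof. exact: leq_trans (degHA x) (degM x). Qed.

Lemma adj_neq u v : A u v -> u != v.
Proof. by apply: contraTneq => ->; rewrite Ai. Qed.

Lemma labelling_forget (U : {set T}) (A' H' : rel T) cv (ce : T -> T -> 'I_(M + 3)) :
  (forall x y, A x y -> x \notin U -> y \notin U -> A' x y) ->
  labelling set0 A' H' cv ce -> labelling U A H' cv ce.
Proof.
move=> sub [h1 h2 h3 h4]; split=> // [x y xy xU yU|x y xy xU].
  by apply: h1; rewrite ?inE //; apply: sub.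
by apply: h4; rewrite ?inE.
Qed.

(** Call an edge of A outside H loose.  Dropping the loose edge xy from A costs at
    most an equality of the colours of x and y, which recolouring x repairs
    unless x has too many constraints. *)
Lemma loose_edge_heavy x y : A x y -> ~~ H x y -> M + 3 <= deg A x + 3 * deg H x.
Proof.
move=> xy xyN; rewrite leqNgt; apply/negP => lt; apply: unlabellable.
have [||cv [ce lab]] := minimal (del_edge_sym x y As) Hs (@del_edge_sub _ _ _ _) (fun _ _ h => h).
- move=> z w zw; rewrite /del_edge HA //=; apply/andP; split.
    by apply: contraNneq xyN => -[<- <-].
  by apply: contraNneq xyN => -[<- <-]; rewrite Hs.
- by exists x, y; rewrite xy /del_edge eqxx andbF.
apply: (@labelling_recolour _ _ [set x] A H cv ce) => //.
- by move=> u v; rewrite !inE => /eqP-> /eqP->; rewrite Ai.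
- by move=> u; rewrite inE => /eqP->.
apply: labelling_forget lab => u v uv; rewrite !inE => ux vx.
by rewrite /del_edge uv !xpair_eqE (negPf ux) (negPf vx) andbF.
Qed.

Lemma degA_heavy x : deg A x <= 3 -> H x =1 A x.
Proof.
move=> dx y; have [xy|xyN] := boolP (H x y); first by rewrite HA.
have [xy|//] := boolP (A x y); have := loose_edge_heavy xy xyN; have := degHA x; lia.
Qed.

Lemma minimal_edge u v : H u v -> labellable M A (del_edge H u v).
Proof.
move=> uv; apply: minimal => //; first exact: del_edge_sym.
- exact: del_edge_sub.
- by move=> x y /del_edge_sub/HA.
by exists u, v; rewrite uv /del_edge eqxx andbF orbT.
Qed.

(** A vertex u of degree at most 3 can be coloured last, since its neighbours and
    its edges exclude at most 3 + 9 colours; so its colour does not constrain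
    the edge uv. *)
Lemma low_edge u v : H u v -> deg A u <= 3 -> M + 2 <= deg H u + deg H v.
Proof.
move=> uv du; rewrite leqNgt; apply/negP => lt; apply: unlabellable.
have uv' := adj_neq (HA uv).
have [cv [ce lab]] := minimal_edge uv.
have {}lab : labelling [set u] A (del_edge H u v) cv ce by apply: labelling_forget lab.
have [a] := @unforbidden M (forbidden [set u] (del_edge H u v) cv ce u :|:
                    forbidden [set u] (del_edge H u v) cv ce v)
  ltac:(rewrite (leq_ltn_trans (leq_card_setU _ _)) //;
    have := card_forbidden [set u] (del_edge H u v) cv ce u;
    have := card_forbidden [set u] (del_edge H u v) cv ce v;
    have := deg_del_edge uv; have := deg_del_edger Hs uv;
    rewrite !inE eqxx (eq_sym v) (negPf uv'); lia).
rewrite inE negb_or => /andP[au av].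
apply: (labelling_recolour (U := [set u]) As HA _ _ (labelling_add_edge Hs uv' lab au av)).
- by move=> x y; rewrite !inE => /eqP-> /eqP->; rewrite Ai.
- by move=> x; rewrite inE => /eqP->; have := degHA u; lia.
Qed.

Section DeletedEdge.
Variables (u v : T) (cv : T -> 'I_(M + 3)) (ce : T -> T -> 'I_(M + 3)).
Hypothesis uv : H u v.
Hypothesis lab : labelling set0 A (del_edge H u v) cv ce.

Let F w := forbidden set0 (del_edge H u v) cv ce w.

Lemma all_forbidden : F u :|: F v = setT.
Proof.
apply/setP => a; rewrite in_setT; apply: contraT; rewrite inE negb_or => /andP[au av]; exfalso.
apply: unlabellable; exists cv; eexists.
exact: (labelling_add_edge Hs (adj_neq (HA uv)) lab au av).
Qed.

Lemma card_forbiddenu : #|F u| <= deg H u + 2.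
Proof.
have := card_forbidden set0 (del_edge H u v) cv ce u.
by have := deg_del_edge uv; rewrite in_set0 /F; lia.
Qed.

Lemma card_forbiddenv : #|F v| <= deg H v + 2.
Proof.
have := card_forbidden set0 (del_edge H u v) cv ce v.
by have := deg_del_edger Hs uv; rewrite in_set0 /F; lia.
Qed.

(** Every colour is forbidden at u or at v.  When the degree sum is as small as
    possible the two forbidden sets are therefore disjoint, and each colour is
    excluded for exactly one reason. *)
Lemma card_forbiddenD : M + 3 + #|F u :&: F v| = #|F u| + #|F v|.
Proof.
have := cardsUI (F u) (F v); rewrite all_forbidden cardsT card_ord; lia.
Qed.

End DeletedEdge.

Lemma edge_sum u v : H u v -> M - 1 <= deg H u + deg H v.
Proof.
move=> uv; have [cv [ce lab]] := minimal_edge uv.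
have := card_forbiddenD uv lab; have := card_forbiddenu cv ce uv.
by have := card_forbiddenv cv ce uv; lia.
Qed.

(** There is a second colour for u, as at most 4 + 9 + 1 of the 15 or more colours
    are excluded.  In the tight case the colours near to the old and to the new
    colour of u would coincide, so the change frees a colour for uv. *)
Lemma four_edge u v : H u v -> deg A u <= 4 -> M <= deg H u + deg H v.
Proof.
move=> uv du; rewrite leqNgt; apply/negP => lt.
have [cv [ce lab]] := minimal_edge uv.
pose H' := del_edge H u v.
have dH' : deg H' u <= 3 by have := deg_del_edge uv; have := degHA u; rewrite /H'; lia.
pose bad := [set cv y | y in [set y | A u y]] :|:
  \bigcup_(y | H' u y) near (ce u y) :|: [set cv u].
have [c'] : exists c', c' \notin bad.
  apply: unforbidden; rewrite (leq_ltn_trans (leq_card_setU _ _)) // cards1.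
  apply: leq_ltn_trans (_ : 4 + 9 + 1 < _); last by lia.
  rewrite leq_add2r (leq_trans (leq_card_setU _ _)) // leq_add //.
    exact: leq_trans (leq_imset_card _ _) du.
  apply: leq_trans (_ : \sum_(y in [set y | H' u y]) 3 <= 9).
    rewrite big_set /=; elim/big_rec2: _ => [|y n S _ IH]; first by rewrite cards0.
    by rewrite (leq_trans (leq_card_setU _ _)) // leq_add ?card_near.
  by rewrite sum_nat_const -[9]/(3 * 3) leq_mul2r.
rewrite !inE !negb_or -andbA => /and3P[c'A c'H c'u].
pose cv' x := if x == u then c' else cv x.
have cu x : A u x -> cv x != c'.
  by move=> ux; apply: contraNneq c'A => <-; rewrite imset_f // inE.
have lab' : labelling set0 A H' cv' ce.
  case: (lab) => h1 h2 h3 h4; split=> // [x y xy xU yU|x y xy xU]; rewrite /cv'.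
    case: (x =P u) => xu; case: (y =P u) => yu.
    - by move: xy; rewrite xu yu Ai.
    - by rewrite eq_sym cu // -xu.
    - by rewrite cu // As -yu.
    - exact: h1.
  case: (x =P u) => xu; last exact: h4.
  subst x; apply: contraNT c'H => nf; apply/bigcupP; exists y => //.
  by rewrite inE far_sym.
have vu : (v == u) = false by rewrite eq_sym; apply: negPf (adj_neq (HA uv)).
have Fv : forbidden set0 H' cv' ce v = forbidden set0 H' cv ce v.
  by rewrite /forbidden /cv' vu.
have FuE : forbidden set0 H' cv ce u = edge_colours H' ce u :|: near (cv u).
  by rewrite /forbidden in_set0.
have FuE' : forbidden set0 H' cv' ce u = edge_colours H' ce u :|: near c'.
  by rewrite /forbidden in_set0 /cv' eqxx.
have all1 := all_forbidden uv lab; have all2 := all_forbidden uv lab'.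
rewrite -/H' Fv in all1 all2.
have cD1 := card_forbiddenD uv lab; have cD2 := card_forbiddenD uv lab'.
have cu1 := card_forbiddenu cv ce uv; have cv1 := card_forbiddenv cv ce uv.
have cu2 := card_forbiddenu cv' ce uv.
rewrite -/H' Fv in cD1 cD2 cu1 cv1 cu2.
have I1 : forbidden set0 H' cv ce u :&: forbidden set0 H' cv ce v = set0.
  by apply: cards0_eq; lia.
have near3 : 2 < #|near (cv u)|.
  have [+ _] := leq_card_setU (edge_colours H' ce u) (near (cv u)).
  rewrite -FuE; have := card_edge_colours H' ce u; have := deg_del_edge uv.
  by rewrite -/H'; lia.
have : near (cv u) \subset near c'.
  apply/subsetP => a aN.
  have aF : a \in forbidden set0 H' cv ce u by rewrite FuE inE aN orbT.
  have aNv : a \notin forbidden set0 H' cv ce v.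
    by apply/negP => aV; have := in_set0 a; rewrite -I1 inE aF aV.
  have : a \in [set: 'I_(M + 3)] by rewrite inE.
  rewrite -all2 inE (negPf aNv) orbF FuE' inE => /orP[|//].
  case/imsetP => y; rewrite inE => uy aE.
  have := lab_far lab uy; rewrite in_set0 => /(_ isT).
  by move: aN; rewrite inE aE => /negPf ->.
by move=> /(near_subset_eq near3) cE; rewrite cE eqxx in c'u.
Qed.

(** If the edge vw can take a new colour s, then its old colour becomes available
    for uv: it is not forbidden at u, being forbidden at v. *)
Lemma swap_triangle u v w cv (ce : T -> T -> 'I_(M + 3)) s :
  H u v -> H u w -> H v w -> labelling set0 A (del_edge H u v) cv ce ->
  let F x := forbidden set0 (del_edge H u v) cv ce x in
  F u :&: F v = set0 -> s \notin F v -> s \notin F w -> False.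
Proof.
move=> uv uw vw lab F disj sv sw; apply: unlabellable.
have uvN := adj_neq (HA uv); have uwN := adj_neq (HA uw); have vwN := adj_neq (HA vw).
pose H' := del_edge H u v; rewrite -/H' in lab.
have H's : symmetric H' := del_edge_sym u v Hs.
have vw' : H' v w.
  by rewrite /H' /del_edge vw !xpair_eqE eqxx (eq_sym v u) (negPf uvN) (eq_sym w u) (negPf uwN).
have sub x : forbidden set0 (del_edge H' v w) cv ce x \subset F x.
  by rewrite setSU // imsetS //; apply/subsetP => y; rewrite !inE => /del_edge_sub.
have lab1 : labelling set0 A (del_edge H' v w) cv ce.
  by apply: labelling_sub lab => //; apply: del_edge_sub.
have lab2 := labelling_add_edge H's vwN lab1 (contraNN (subsetP (sub v) s) sv)
  (contraNN (subsetP (sub w) s) sw).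
set ce1 := upd_edge ce v w s in lab2.
have bv : ce v w \in F v by rewrite inE imset_f // inE.
exists cv, (upd_edge ce1 u v (ce v w)).
apply: (labelling_add_edge Hs uvN lab2).
- have : ce v w \notin F u.
    by apply/negP => bu; have := in_set0 (ce v w); rewrite -disj inE bu bv.
  congr (_ \notin _ :|: _); apply: eq_imset => y.
  by rewrite /ce1 /upd_edge !xpair_eqE (negPf uvN) (negPf uwN).
- rewrite inE in_set0 negb_or; apply/andP; split.
    apply/negP => /imsetP[y]; rewrite inE => vy.
    rewrite /ce1 /upd_edge !xpair_eqE eqxx (negPf vwN) /= orbF.
    case: eqP => [_ sE|/eqP yw e]; first by rewrite -sE bv in sv.
    by have := lab_edge lab vw' vy; rewrite eq_sym yw e eqxx => /(_ isT).
  by have := lab_far lab vw'; rewrite !inE => /(_ isT); rewrite negbK.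
Qed.

(** If w has degree less than M, some colour s is not forbidden at w.  It is not
    forbidden at v or not forbidden at u, and the edge vw or the edge uw can be
    moved to it. *)
Lemma triangle_edge u v w : H u v -> H u w -> H v w ->
  deg H u + deg H v <= M - 1 -> M <= deg H w.
Proof.
move=> uv uw vw duv; rewrite leqNgt; apply/negP => dw.
have [cv [ce lab]] := minimal_edge uv.
set F := forbidden set0 (del_edge H u v) cv ce.
have disj : F u :&: F v = set0.
  apply: cards0_eq; have := card_forbiddenD uv lab.
  have := card_forbiddenu cv ce uv; have := card_forbiddenv cv ce uv.
  by rewrite -/F; lia.
have [s sw] : exists s, s \notin F w.
  apply: unforbidden; have := card_forbidden set0 (del_edge H u v) cv ce w.
  have : deg (del_edge H u v) w <= deg H w.
    by apply/subset_leq_card/subsetP => y; rewrite !inE => /del_edge_sub.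
  by rewrite in_set0 -/F; lia.
have [sv|sv] := boolP (s \in F v); last exact: (swap_triangle uv uw vw lab disj sv sw).
have su : s \notin F u.
  by apply/negP => su; have := in_set0 s; rewrite -disj inE su sv.
have vu : H v u by rewrite Hs.
have lab' : labelling set0 A (del_edge H v u) cv ce.
  by apply: labelling_sub lab => // x y; rewrite del_edgeC.
have FE x : forbidden set0 (del_edge H v u) cv ce x = F x.
  rewrite /F /forbidden /edge_colours.
  suff -> : [set y | del_edge H v u x y] = [set y | del_edge H u v x y] by [].
  by apply/setP => y; rewrite !inE del_edgeC.
apply: (swap_triangle vu vw uw lab' (s := s)); rewrite !FE //. by rewrite setIC.
Qed.

(** Erase all edges at [U] and recolour them by [kernel_colouring].  An edge xy
    has as many colours as y has edges to [U], plus M - d(y).  Let x rank the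
    edge to [B x] first, and let y rank the edges assigned to it last: then an
    assigned edge is beaten only at y, while any other edge is beaten at y by
    none of the assigned edges, which makes room for the edges that beat it
    at x. *)
Lemma alternator (U : {set T}) (B : T -> T) :
  U != set0 -> {in U, forall x, deg A x <= 3} -> assigns H B U ->
  {in U, forall x y, H x y -> deg H x <= (load B U y + (M - deg H y)).+1} -> False.
Proof.
move=> U0 low asg cond; apply: unlabellable.
have ind : {in U &, forall x y, ~~ A x y}.
  move=> x y xU yU; apply/negP => xy.
  have Hxy : H x y by rewrite degA_heavy // low.
  have := low_edge Hxy (low _ xU); have := degHA x; have := degHA y.
  by have := low _ xU; have := low _ yU; lia.
pose A' : rel T := fun x y => [&& A x y, x \notin U & y \notin U].
pose H' : rel T := fun x y => [&& H x y, x \notin U & y \notin U].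
have [||||||cv [ce lab]] := minimal (A' := A') (H' := H').
- by move=> x y; rewrite /A' As; congr andb; rewrite andbC.
- by move=> x y; rewrite /H' Hs; congr andb; rewrite andbC.
- by move=> x y /and3P[].
- by move=> x y /and3P[].
- by move=> x y /and3P[/HA xy xU yU]; rewrite /A' xy xU.
- have [x xU] := set0Pn _ U0; exists x, (B x).
  by rewrite /A' HA ?asg // xU.
(* Ranks are at most N, so adding N moves an edge behind all edges without it. *)
pose N := #|{: T * T}|.
pose asd (p : T * T) := B p.1 == p.2.
pose rank (p : T * T) : nat := enum_rank p.
have rk p : rank p < N by apply: ltn_ord.
have rank_inj : injective rank by move=> p q /ord_inj/enum_rank_inj.
pose rx p := rank p + (if asd p then 0 else N).
pose ry p := rank p + (if asd p then N else 0).
have rx_inj : injective rx.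
  move=> p q; rewrite /rx => e; apply: rank_inj.
  by move: e (rk p) (rk q); case: (asd p); case: (asd q); lia.
have ry_inj : injective ry.
  move=> p q; rewrite /ry => e; apply: rank_inj.
  by move: e (rk p) (rk q); case: (asd p); case: (asd q); lia.
pose S := [set p : T * T | (p.1 \in U) && H p.1 p.2].
pose L (p : T * T) := ~: (edge_colours H' ce p.2 :|: near (cv p.2)).
pose dU y := #|[set x in U | H x y]|.
have cardL x y : x \in U -> H x y -> M - deg H y + dU y <= #|L (x, y)|.
  move=> xU xy; have yU : y \notin U.
    by apply/negP => yU; have := ind x y xU yU; rewrite HA.
  have dH' : deg H' y + dU y <= deg H y.
    rewrite /deg -(cardsID U [set z | H y z]) addnC leq_add //.
      by apply/subset_leq_card/subsetP => z; rewrite !inE Hs andbC.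
    by apply/subset_leq_card/subsetP => z; rewrite !inE => /and3P[-> _ ->].
  pose E := edge_colours H' ce y :|: near (cv y).
  have c1 : #|E| + #|L (x, y)| = M + 3 by rewrite cardsC card_ord.
  have c2 : #|E| <= deg H' y + 3.
    rewrite (leq_trans (leq_card_setU _ _)) // leq_add ?card_near //.
    exact: card_edge_colours.
  by have := degHM y; move: c1 c2 dH'; lia.
have cardX x y : H x y -> #|[set q : T * T | [&& q.1 == x, H x q.2 & q.2 != y]]| <= deg H x - 1.
  move=> xy; have -> : deg H x - 1 = #|[set z | H x z] :\ y|.
    by rewrite /deg (cardsD1 y [set z | H x z]) inE xy; lia.
  rewrite -(card_imset (mem ([set z | H x z] :\ y)) (f := pair x)); last by move=> ? ? [].
  apply/subset_leq_card/subsetP => -[a b]; rewrite !inE /= => /and3P[/eqP-> xb by_].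
  by apply: imset_f; rewrite !inE by_.
have cardY (P : pred T) y :
    #|[set q : T * T | [&& q.2 == y, q.1 \in U, H q.1 y & P q.1]]| <=
    #|[set z in U | H z y & P z]|.
  rewrite -(card_imset (mem [set z in U | H z y & P z]) (f := pair^~ y)); last by move=> ? ? [].
  apply/subset_leq_card/subsetP => -[a b]; rewrite !inE /= => /and4P[/eqP-> aU ab Pa].
  by apply: imset_f; rewrite !inE aU ab.
have out p : p \in S -> #|[set j in S | beats fst snd rx ry j p]| < #|L p|.
  case: p => x y; rewrite inE /= => /andP[xU xy].
  apply: leq_trans (cardL _ _ xU xy).
  have xin : x \in [set z in U | H z y] by rewrite inE xU.
  have [/eqP Bxy|Bxy] := boolP (B x == y).
    apply: leq_ltn_trans (_ : #|[set z in U | H z y & z != x]| < _).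
      apply: leq_trans (cardY _ y); apply/subset_leq_card/subsetP => -[a b].
      rewrite !inE /beats /= => /andP[/andP[aU ab]].
      rewrite /rx /ry /asd /= Bxy eqxx => /orP[/andP[/eqP ax]|/andP[/eqP bE lt]].
        subst a; rewrite Bxy; case: eqP => [<-|_]; first by rewrite ltnn.
        by move: (rk (x, y)) (rk (x, b)); lia.
      subst b; rewrite eqxx aU ab /=; apply: contraTneq lt => ->.
      by rewrite Bxy eqxx ltnn.
    have -> : [set z in U | H z y & z != x] = [set z in U | H z y] :\ x.
      by apply/setP => z; rewrite !inE; case: (z == x); rewrite ?andbF ?andbT.
    by have := cardsD1 x [set z in U | H z y]; rewrite xin /dU; lia.
  apply: leq_ltn_trans (_ : #|[set q : T * T | [&& q.1 == x, H x q.2 & q.2 != y]] :|: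
     [set q : T * T | [&& q.2 == y, q.1 \in U, H q.1 y & (B q.1 != y) && (q.1 != x)]]| < _).
    apply/subset_leq_card/subsetP => -[a b].
    rewrite !inE /beats /= => /andP[/andP[aU ab]].
    rewrite /rx /ry /asd /= (negPf Bxy) => /orP[/andP[/eqP ax]|/andP[/eqP bE]].
      subst a; rewrite eqxx ab /= => lt; apply/orP; left.
      by apply: contraTneq lt => ->; rewrite (negPf Bxy) ltnn.
    subst b; rewrite eqxx aU ab /= => lt; apply/orP; right; apply/andP; split.
      by apply: contraTneq lt => ->; rewrite eqxx; move: (rk (x, y)); lia.
    by apply: contraTneq lt => ->; rewrite (negPf Bxy) ltnn.
  apply: leq_ltn_trans (leq_card_setU _ _) _.
  have h1 := cardX _ _ xy; have h2 := cardY (fun z => (B z != y) && (z != x)) y.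
  have h3 : #|[set z in U | H z y & (B z != y) && (z != x)]| + load B U y + 1 <= dU y.
    rewrite /dU (cardsD1 x [set z in U | H z y]) xin addnC leq_add2l.
    rewrite -(cardsID [set z | B z == y] ([set z in U | H z y] :\ x)) addnC leq_add //.
      apply/subset_leq_card/subsetP => z; rewrite !inE => /andP[zU /eqP Bz].
      rewrite Bz eqxx zU andbT /= -[X in H z X]Bz asg // andbT.
      by apply: contraNneq Bxy => <-; apply/eqP.
    apply/subset_leq_card/subsetP => z; rewrite !inE => /and3P[-> -> /andP[-> ->]].
    by [].
  by have := cond _ xU _ xy; move: h1 h2 h3; lia.
have c0 : 'I_(M + 3) by exists 0; lia.
have [c [cL cP]] := kernel_colouring rx_inj ry_inj c0 out.
pose ce' x y := if (x \in U) && H x y then c (x, y)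
  else if (y \in U) && H y x then c (y, x) else ce x y.
have cLU x y : x \in U -> H x y ->
    c (x, y) \notin edge_colours H' ce y /\ far (cv y) (c (x, y)).
  move=> xU xy; have := cL (x, y); rewrite !inE /= xU xy negb_or => /(_ isT) /andP[-> h].
  by split=> //; move: h; rewrite negbK.
apply: (labelling_recolour As HA ind _ (cv := cv) (ce := ce')).
  by move=> x xU; have := low _ xU; have := degHA x; lia.
have HU x y : x \in U -> H x y -> y \notin U.
  by move=> xU xy; apply/negP => yU; have := ind _ _ xU yU; rewrite HA.
split.
- by move=> x y xy xU yU; apply: (lab_vertex lab); rewrite ?inE // /A' xy xU.
- move=> x y; rewrite /ce'; case: ifP => [/andP[xU xy]|h1].
    by rewrite (negPf (HU _ _ xU xy)).
  by case: ifP => // _; apply: lab_sym lab _ _.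
- move=> x y z xy xz yz; rewrite /ce' xy xz !andbT ![H _ x]Hs xy xz !andbT.
  have [xU|xU] := boolP (x \in U).
    by apply: cP; rewrite ?inE /= ?xU ?xy // ?xpair_eqE ?eqxx //= /touch /= eqxx.
  case: ifPn => yU; case: ifPn => zU.
  + by apply: cP; rewrite ?inE /= ?yU ?zU ?(Hs _ x) // ?xpair_eqE ?eqxx ?andbT //= /touch /= eqxx orbT.
  + have [|h _] := cLU y x yU; first by rewrite Hs.
    by apply: contraNneq h => ->; apply: imset_f; rewrite inE /H' xz xU.
  + have [|h _] := cLU z x zU; first by rewrite Hs.
    by apply: contraNneq h => <-; apply: imset_f; rewrite inE /H' xy xU.
  + by apply: (lab_edge lab) => //; rewrite /H' ?xy ?xz xU.
- move=> x y xy xU; rewrite /ce' (negPf xU) /= Hs xy andbT.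
  case: ifPn => yU; first by have [] := cLU y x yU; rewrite // Hs.
  by apply: (lab_far lab); rewrite ?inE // /H' xy xU.
Qed.

End Reducible.

(** * Charge given to a triangle by its corners *)

Section Charges.
Variables (T : finType) (M : nat) (A H : rel T).
Hypotheses (M12 : 12 <= M) (crit : critical M A H).

Let As : symmetric A := critical_sym crit.
Let Ai : irreflexive A := critical_irrefl crit.
Let Hs : symmetric H := critical_symH crit.
Let HA : subrel H A := critical_sub crit.

Let degHA x := degHA crit x.

Lemma deg_lt x y : A x y -> ~~ H x y -> deg H x < deg A x.
Proof.
move=> xy xyN; apply/proper_card; rewrite properE; apply/andP; split.
  by apply/subsetP => z; rewrite !inE => /HA.
by apply/subsetPn; exists y; rewrite inE.
Qed.

Lemma degA4 x : deg A x <= 4 -> H x =1 A x.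
Proof.
move=> dx y; have [xy|xyN] := boolP (H x y); first by rewrite HA.
have [xy|//] := boolP (A x y).
have := loose_edge_heavy crit xy xyN; have := deg_lt xy xyN; lia.
Qed.

Lemma degHA4 x : deg A x <= 4 -> deg H x = deg A x.
Proof. by move=> dx; apply: eq_card => y; rewrite !inE degA4. Qed.

(** A vertex of degree 5 in A loses at most one edge in H, for otherwise it could
    be recoloured. *)
Lemma degA5 x y : deg A x = 5 -> A x y -> ~~ H x y ->
  deg H x = 4 /\ (forall z, A x z -> z != y -> H x z).
Proof.
move=> dx xy xyN; have := loose_edge_heavy crit xy xyN; have lt := deg_lt xy xyN => h.
have dH : deg H x = 4 by lia.
split=> // z xz zy; apply: contraT => xzN.
suff : deg H x <= 3 by lia.
have -> : 3 = #|[set w | A x w] :\ y :\ z|.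
  have := cardsD1 y [set w | A x w]; have := cardsD1 z ([set w | A x w] :\ y).
  by rewrite !inE xy xz zy; move: dx; rewrite /deg; lia.
apply/subset_leq_card/subsetP => w; rewrite !inE => xw.
rewrite (HA xw) andbT; apply/andP; split.
  by apply: contraNneq xzN => <-.
by apply: contraNneq xyN => <-.
Qed.

Lemma degA_gt1 x : 0 < deg A x -> 1 < deg A x.
Proof.
move=> d0; rewrite ltn_neqAle d0 andbT; apply/negP => /eqP d1.
have /card_gt0P[y] := d0; rewrite inE => xy.
have Hxy : H x y by rewrite degA4 // -d1.
have := low_edge M12 crit Hxy; have := degHM crit y; have := degHA x; lia.
Qed.

Lemma low_neighbour x y : deg A x <= 3 -> A x y ->
  H x y /\ M + 2 - deg A x <= deg H y.
Proof.
move=> dx xy; have Hxy : H x y by rewrite degA4 //; lia.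
split=> //; have := low_edge M12 crit Hxy dx; have := degHA x; lia.
Qed.

(** The charge, in units of 1/84, which a vertex gives to each triangle at it;
    [b] says whether the triangle contains a loose edge (one of A outside H)
    at this vertex.  A vertex of degree 5 with such an edge has at
    most two triangles on it and can pay 24 for these. *)
Definition weight x (b : bool) : nat :=
  if deg A x <= 4 then 0
  else if deg A x == 5 then if deg H x == 5 then 14 else if b then 24 else 12
  else if deg A x == 6 then 28 else if deg A x == 7 then 36 else 42.

Let weight8 x b : 8 <= deg A x -> weight x b = 42.
Proof. by rewrite /weight => ?; do 4 (case: ifP; first by lia). Qed.

Let weight7 x b : 7 <= deg A x -> 36 <= weight x b.
Proof. by rewrite /weight => ?; do 3 (case: ifP; first by lia); case: ifP. Qed.

Let weight6 x b : 6 <= deg A x -> 28 <= weight x b.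
Proof. by rewrite /weight => ?; do 2 (case: ifP; first by lia); case: ifP => // _; case: ifP. Qed.

Let weight5 x b : deg A x = 5 -> weight x b = if deg H x == 5 then 14 else if b then 24 else 12.
Proof. by rewrite /weight => ->. Qed.

(** The corner a of smallest degree determines the case: degree at most 4 forces
    the other corners to degree at least 8, degree at least 6 pays by itself,
    and for degree 5 the bounds on edges and triangles are just sufficient. *)
Let triangle_min a b c : A a b -> A a c -> A b c ->
  deg A a <= deg A b -> deg A a <= deg A c ->
  84 <= weight a (~~ H a b || ~~ H a c) + weight b (~~ H b a || ~~ H b c)
      + weight c (~~ H c a || ~~ H c b).
Proof.
move=> ab ac bc dab dac.
have [d3|d3] := leqP (deg A a) 3.
  have [_ hb] := low_neighbour d3 ab; have [_ hc] := low_neighbour d3 ac.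
  have := degHA b; have := degHA c => *.
  by rewrite (@weight8 b) ?(@weight8 c); lia.
have [d4|d4] := leqP (deg A a) 4.
  have hb := four_edge M12 crit (etrans (degA4 d4 b) ab) d4.
  have hc := four_edge M12 crit (etrans (degA4 d4 c) ac) d4.
  have := degHA a; have := degHA b; have := degHA c => *.
  by rewrite (@weight8 b) ?(@weight8 c); lia.
have [d6|d6] := leqP 6 (deg A a).
  have := weight6 (~~ H a b || ~~ H a c) d6.
  have := @weight6 b (~~ H b a || ~~ H b c) (leq_trans d6 dab).
  have := @weight6 c (~~ H c a || ~~ H c b) (leq_trans d6 dac); lia.
have d5 : deg A a = 5 by lia.
(* If ab' is loose then a pays 24, b' has degree at least 5 and c' at least 7. *)
have loose_case b' c' : A a b' -> A a c' -> A b' c' -> 5 <= deg A b' -> ~~ H a b' ->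
    84 <= 24 + weight b' (~~ H b' a || ~~ H b' c') + weight c' (~~ H c' a || ~~ H c' b').
  move=> ab' ac' bc' db' abN; have [dH aH] := degA5 d5 ab' abN.
  have ac'H : H a c' by apply: aH => //; apply: contraTneq bc' => ->; rewrite Ai.
  have := edge_sum M12 crit ac'H; have := degHA c' => *.
  have h36 : 36 <= weight c' (~~ H c' a || ~~ H c' b') by apply: weight7; lia.
  have [b6|b6] := leqP 6 (deg A b').
    have h28 := weight6 (~~ H b' a || ~~ H b' c') b6.
    by apply: leq_trans (leq_add (leq_add (leqnn 24) h28) h36).
  have b5 : deg A b' = 5 by move: db' b6; clear; lia.
  have ba' : A b' a by rewrite As.
  have baN : ~~ H b' a by rewrite Hs.
  have [dHb _] := degA5 b5 ba' baN.
  by rewrite [weight b' _]weight5 // dHb baN /= -[84]/(24 + 24 + 36) leq_add2l.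
have [abH|abN] := boolP (H a b); last first.
  by have [dH _] := degA5 d5 ab abN; rewrite weight5 // dH /= loose_case ?d5 -?d5.
have [acH|acN] := boolP (H a c); last first.
  have [dH _] := degA5 d5 ac acN; rewrite weight5 // dH /=.
  have := loose_case c b ac ab; rewrite As => /(_ bc).
  by rewrite -d5 => /(_ dac acN); rewrite orbC [X in weight c X]orbC; lia.
have sb := edge_sum M12 crit abH; have sc := edge_sum M12 crit acH.
have db := degHA b; have dc := degHA c.
rewrite weight5 //=; case: eqP => [dH5|dH5].
  (* A neighbour b' of degree 6 has no loose edge, so [triangle_edge] applies. *)
  have six b' c' : H a b' -> H a c' -> A b' c' -> M - 1 <= deg H a + deg H b' ->
      deg A b' <= 6 -> M <= deg H c'.
    move=> ab' ac' bc' sb' d6'; have db' := degHA b'.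
    have [bcH|bcN] := boolP (H b' c'); last first.
      by have lt := deg_lt bc' bcN; exfalso; move: M12 dH5 lt sb' d6'; clear; lia.
    by apply: (triangle_edge M12 crit ab'); rewrite // dH5; move: M12 db' d6'; clear; lia.
  have [b7|b7] := leqP 7 (deg A b).
    have [c7|c7] := leqP 7 (deg A c).
      have := weight7 (~~ H b a || ~~ H b c) b7.
      by have := weight7 (~~ H c a || ~~ H c b) c7; lia.
    have := six c b acH abH; rewrite As => /(_ bc sc c7) => h.
    rewrite (@weight8 b); last by lia.
    have : 28 <= weight c (~~ H c a || ~~ H c b) by apply: weight6; lia.
    lia.
  have h := six b c abH acH bc sb b7.
  rewrite (@weight8 c); last by lia.
  have : 28 <= weight b (~~ H b a || ~~ H b c) by apply: weight6; lia.
  lia.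
have dHa := degHA a.
have : 36 <= weight b (~~ H b a || ~~ H b c) by apply: weight7; lia.
have : 36 <= weight c (~~ H c a || ~~ H c b) by apply: weight7; lia.
lia.
Qed.

Lemma triangle_weight a b c : A a b -> A a c -> A b c ->
  84 <= weight a (~~ H a b || ~~ H a c) + weight b (~~ H b a || ~~ H b c)
      + weight c (~~ H c a || ~~ H c b).
Proof.
move=> ab ac bc.
have [d1|/ltnW d1] := leqP (deg A a) (deg A b).
  have [d2|/ltnW d2] := leqP (deg A a) (deg A c); first exact: triangle_min.
  have := @triangle_min c a b; rewrite ![A c _]As => /(_ ac bc ab d2 (leq_trans d2 d1)).
  by move=> h; rewrite [X in weight a X]orbC [X in weight b X]orbC; lia.
have [d2|/ltnW d2] := leqP (deg A b) (deg A c).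
  by have := @triangle_min b a c; rewrite As => /(_ ab bc ac d1 d2); move=> h; rewrite [X in weight c X]orbC; lia.
have := @triangle_min c a b; rewrite ![A c _]As => /(_ ac bc ab (leq_trans d2 d1) d2).
by move=> h; rewrite [X in weight a X]orbC [X in weight b X]orbC; lia.
Qed.

End Charges.

(** * Face structures of a graph *)

(** Subgraphs are represented by symmetric sets of darts, that is of ordered
    pairs of adjacent vertices. *)
Definition dart_deg (T : finType) (D : {set T * T}) (x : T) : nat :=
  #|[set y | (x, y) \in D]|.

Definition cover_count (T : finType) (F : {set {set T * T}}) (p : T * T) : nat :=
  #|[set D in F | p \in D]|.

(** What discharging needs from the faces of a plane graph.  Two faces may have
    the same boundary, as for a graph that is a cycle; as [F] is a set, they
    are counted once, and [face_once] then says that no further face meets this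
    boundary.  The inequality [face_euler], stated with darts and without the
    isolated vertices, reads m + 1 <= n + |F|. *)
Record faces (T : finType) (A : rel T) (F : {set {set T * T}}) : Prop := Faces {
  face_sub : forall D x y, D \in F -> (x, y) \in D -> A x y;
  face_sym : forall D x y, D \in F -> (x, y) \in D -> (y, x) \in D;
  face_neq0 : forall D, D \in F -> D != set0;
  face_even : forall D x, D \in F -> ~~ odd (dart_deg D x);
  face_two : forall p, cover_count F p <= 2;
  face_once : forall D p q, D \in F -> p \in D -> q \in D ->
    cover_count F p <= 1 -> cover_count F q <= 1;
  face_euler :
    #|[set p | A p.1 p.2]| + 2 <= 2 * (#|[set x | 0 < deg A x]| + #|F|)
}.

Section Counting.
Variable T : finType.
Implicit Types (D : {set T * T}).

Lemma card_sum_deg (A : rel T) : #|[set p | A p.1 p.2]| = \sum_x deg A x.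
Proof.
rewrite -sum1dep_card (eq_bigl (fun p : T * T => predT p.1 && A p.1 p.2)) //.
rewrite -(pair_big_dep predT A (fun _ _ => 1)) /=.
by apply: eq_bigr => x _; rewrite sum1dep_card.
Qed.

Lemma card_darts D : #|D| = \sum_x dart_deg D x.
Proof.
rewrite -[RHS](card_sum_deg (fun x y => (x, y) \in D)).
by apply: eq_card => -[x y]; rewrite !inE.
Qed.

Lemma dart_deg_sum D x : dart_deg D x = \sum_y ((x, y) \in D).
Proof. by rewrite /dart_deg -sum1dep_card big_mkcond; apply: eq_bigr => y _; case: ifP. Qed.

End Counting.

Section Faces.
Variables (T : finType) (A : rel T) (F : {set {set T * T}}).
Hypotheses (Ai : irreflexive A) (As : symmetric A) (FA : faces A F).

Lemma dart_deg_gt1 D x y : D \in F -> (x, y) \in D -> 1 < dart_deg D x.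
Proof.
move=> DF xy; have := face_even FA x DF.
have : 0 < dart_deg D x by apply/card_gt0P; exists y; rewrite inE.
by case: (dart_deg D x) => [|[]].
Qed.

Lemma dart_next D x y z : D \in F -> (x, y) \in D ->
  exists2 w, w != z & (x, w) \in D.
Proof.
move=> DF xy; have := dart_deg_gt1 DF xy; rewrite /dart_deg (cardsD1 z) => h.
have /card_gt0P[w] : 0 < #|[set y | (x, y) \in D] :\ z| by have := leq_b1 (z \in [set y | (x, y) \in D]); lia.
by rewrite !inE => /andP[wz xw]; exists w.
Qed.

Lemma dart_neq D x y : D \in F -> (x, y) \in D -> x != y.
Proof. by move=> DF /(face_sub FA DF); apply: contraTneq => ->; rewrite Ai. Qed.

Lemma even_face D : D \in F -> ~~ odd #|D|.
Proof.
move=> DF; rewrite card_darts.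
elim/big_rec: _ => // x n _ nE; rewrite oddD negb_add.
by rewrite (negPf (face_even FA x DF)) (negPf nE).
Qed.

Definition trilist (x y z : T) : seq (T * T) :=
  [:: (x, y); (y, x); (x, z); (z, x); (y, z); (z, y)].

(** The even degrees at the two ends of a dart (x, y) are at least 2 and provide a
    path z, x, y, w. *)
Let six_darts D x y z w : D \in F -> (x, y) \in D -> (x, z) \in D -> (y, w) \in D ->
  z != y -> w != x ->
  let s := [:: (x, y); (y, x); (x, z); (z, x); (y, w); (w, y)] in
  6 <= #|D| /\ (#|D| = 6 -> D = [set p in s]).
Proof.
move=> DF xy xz yw zy wx s.
have yx := face_sym FA DF xy; have zx := face_sym FA DF xz; have wy := face_sym FA DF yw.
have nxy := dart_neq DF xy; have nxz := dart_neq DF xz; have nyw := dart_neq DF yw.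
have us : uniq s.
  rewrite /= !inE !xpair_eqE !eqxx /= ![y == x]eq_sym ![z == x]eq_sym ![y == z]eq_sym
     ![w == y]eq_sym ![x == w]eq_sym.
  by rewrite (negPf nxy) (negPf nxz) (negPf nyw) (negPf zy) (negPf wx) /= ?andbF.
have sD : [set p in s] \subset D.
  apply/subsetP => p; rewrite inE /s !inE.
  by do 5 (case/orP; first by move/eqP->); move/eqP->.
have cs : #|[set p in s]| = 6 by rewrite cardsE; apply/card_uniqP.
split=> [|D6]; first by rewrite -cs subset_leq_card.
by apply/esym/eqP; rewrite eqEcard sD cs D6.
Qed.

Lemma card_face_ge6 D : D \in F -> 6 <= #|D|.
Proof.
move=> DF; have [[x y] xy] := set0Pn _ (face_neq0 FA DF).
have [z zy xz] := dart_next y DF xy.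
have [w wx yw] := dart_next x DF (face_sym FA DF xy).
by have [] := six_darts DF xy xz yw zy wx.
Qed.

(** If the path z, x, y, w given by the even degrees does not close up to a
    triangle, its six darts leave degree 1 at z. *)
Lemma triangle_face D x y : D \in F -> #|D| = 6 -> (x, y) \in D ->
  exists z, [/\ z != x, z != y & D = [set p in trilist x y z]].
Proof.
move=> DF D6 xy.
have [z zy xz] := dart_next y DF xy.
have [w wx yw] := dart_next x DF (face_sym FA DF xy).
have [_ /(_ D6) DE] := six_darts DF xy xz yw zy wx.
have nxz := dart_neq DF xz; have nyw := dart_neq DF yw.
exists z; split=> //; first by rewrite eq_sym.
have [zw|zw] := eqVneq w z; first by rewrite DE zw.
have [t tx zt] := dart_next x DF (face_sym FA DF xz).
move: zt; rewrite DE inE !inE !xpair_eqE.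
by rewrite [z == x]eq_sym (negPf nxz) (negPf zy) (negPf tx) [z == w]eq_sym (negPf zw) !andbF.
Qed.

Lemma dart_deg_triangle D x y : D \in F -> #|D| = 6 -> (x, y) \in D -> dart_deg D x = 2.
Proof.
move=> DF D6 xy; have [z [zx zy DE]] := triangle_face DF D6 xy.
have xyN := dart_neq DF xy.
rewrite /dart_deg; have -> : [set t | (x, t) \in D] = [set y; z].
  apply/setP => t; rewrite DE !inE !xpair_eqE eqxx (negPf xyN) eq_sym.
  by rewrite [x == z]eq_sym (negPf zx) !orbF /= eq_sym.
by rewrite cards2 eq_sym zy.
Qed.

End Faces.

(** * Discharging *)

Section Discharging.
Variables (T : finType) (M : nat) (A H : rel T) (F : {set {set T * T}}).
Implicit Types (D : {set T * T}) (v x y u : T) (p : T * T).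
Hypotheses (M12 : 12 <= M) (crit : critical M A H) (FA : faces A F).

Let As : symmetric A := critical_sym crit.
Let Ai : irreflexive A := critical_irrefl crit.
Let HA : subrel H A := critical_sub crit.
Let degHA x := degHA crit x.
Let degM x : deg A x <= M := critical_deg crit x.

Definition triangles_at v : nat := \sum_(D in F | #|D| == 6) (0 < dart_deg D v).

Definition triangles_on v y : nat := \sum_(D in F | #|D| == 6) ((v, y) \in D).

Lemma cover_countE p : cover_count F p = \sum_(D in F) (p \in D).
Proof.
rewrite /cover_count -sum1dep_card big_mkcondr.
by apply: eq_bigr => D _; case: (p \in D).
Qed.

Lemma dart_deg_adj D v : D \in F -> dart_deg D v = \sum_(y | A v y) ((v, y) \in D).
Proof.
move=> DF; rewrite dart_deg_sum [RHS]big_mkcond; apply: eq_bigr => y _.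
by case: ifPn => // vy; case: (boolP (_ \in D)) => // /(face_sub FA DF); rewrite (negPf vy).
Qed.

Lemma dart_deg_gt0 D v : reflect (exists y, (v, y) \in D) (0 < dart_deg D v).
Proof.
apply: (iffP card_gt0P) => -[y]; first by rewrite inE; exists y.
by exists y; rewrite inE.
Qed.

Lemma sum_triangles_on v : \sum_(y | A v y) triangles_on v y = 2 * triangles_at v.
Proof.
rewrite /triangles_on exchange_big /triangles_at big_distrr /=.
apply: eq_bigr => D /andP[DF /eqP D6]; rewrite -dart_deg_adj //.
case: dart_deg_gt0 => [[y vy]|no]; first exact: dart_deg_triangle Ai FA _ _ _ DF D6 vy.
apply/eqP; rewrite muln0 -leqn0 leqNgt; apply/negP => /card_gt0P[y].
by rewrite inE => vy; apply: no; exists y.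
Qed.

Lemma triangles_on_le v y : triangles_on v y <= cover_count F (v, y).
Proof.
rewrite cover_countE /triangles_on big_mkcondr; apply: leq_sum => D _.
by case: ifP.
Qed.

Lemma triangles_at_le v : triangles_at v <= deg A v.
Proof.
rewrite -(leq_pmul2l (isT : 0 < 2)) -sum_triangles_on mulnC /deg -sum_nat_const.
rewrite [leqRHS](eq_bigl (A v)); last by move=> y; rewrite inE.
apply: leq_sum => y _; apply: leq_trans (triangles_on_le _ _) _.
exact: face_two FA _.
Qed.

Definition meets_loose v D : bool := [exists y, ((v, y) \in D) && ~~ H v y].

Definition vertex_gift v : nat :=
  \sum_(D in F | #|D| == 6) (0 < dart_deg D v) * weight A H v (meets_loose v D).

Lemma vertex_gift_const v : (deg A v == 5) && (deg H v != 5) = false ->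
  vertex_gift v = weight A H v false * triangles_at v.
Proof.
move=> h; rewrite /vertex_gift /triangles_at big_distrr /=.
apply: eq_bigr => D _; rewrite mulnC; congr (_ * _).
rewrite /weight; case: ifP => // _; move: h.
by case: (deg A v == 5) => //=; case: (deg H v == 5).
Qed.

Lemma vertex_gift5 v : deg A v = 5 -> deg H v != 5 -> vertex_gift v <= 84.
Proof.
move=> d5 h5.
have [/existsP[y /andP[vy vyN]]|noy] := boolP [exists y, A v y && ~~ H v y]; last first.
  suff e : deg H v = deg A v by rewrite e d5 in h5.
  apply: eq_card => y; rewrite !inE; apply/idP/idP => [/HA //|vy].
  by apply: contraNT noy => vyN; apply/existsP; exists y; rewrite vy.
have [dH only] := degA5 M12 crit d5 vy vyN.
apply: (@leq_trans (12 * triangles_at v + 12 * triangles_on v y)); last first.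
  have := triangles_at_le v; have := triangles_on_le v y; have := face_two FA (v, y).
  by rewrite d5; lia.
rewrite /triangles_at /triangles_on !big_distrr /= -big_split /=.
apply: leq_sum => D /andP[DF _]; rewrite /weight d5 dH /=.
case: dart_deg_gt0 => [[z vz]|_] //=; rewrite mul1n.
case: ifP => // /existsP[w /andP[vw vwN]].
have [wy|wy] := eqVneq w y; first by rewrite -wy vw.
by move: vwN; rewrite (only w) // (face_sub FA DF vw).
Qed.

(** The charge 84 (d - 4) of a vertex covers its gifts to triangles.  Vertices of
    degree 2 and 3 lack 168 and 84 units, a vertex of degree M - 1 has 84 units
    to spare, and one of degree M has 168, plus 21 for each side of an edge
    there without a triangle. *)
Lemma vertex_charge v :
  336 * (0 < deg A v) + vertex_gift v + 84 * (deg H v == M - 1)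
    + (deg H v == M) * (168 + 21 * (2 * deg A v - 2 * triangles_at v))
  <= 84 * deg A v + 168 * (deg A v == 2) + 84 * (deg A v == 3).
Proof.
have tle := triangles_at_le v; have dle := degHA v; have dM := degM v.
have [d4|d4] := leqP (deg A v) 4.
  rewrite vertex_gift_const; last by case: eqP => // e; lia.
  have -> : weight A H v false = 0 by rewrite /weight d4.
  have -> : (deg H v == M - 1) = false by apply/eqP; lia.
  have -> : (deg H v == M) = false by apply/eqP; lia.
  have := @degA_gt1 _ _ _ _ M12 crit v; move: d4.
  by case: (deg A v) => [|[|[|[|[|n]]]]] //= _ h; try lia; have := h isT.
have -> : (deg A v == 2) = false by apply/eqP; lia.
have -> : (deg A v == 3) = false by apply/eqP; lia.
have -> : (0 < deg A v) by lia.
have [/andP[/eqP d5 h5]|/negbTE h5] := boolP ((deg A v == 5) && (deg H v != 5)).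
  have := vertex_gift5 d5 h5.
  have -> : (deg H v == M - 1) = false by apply/eqP; lia.
  have -> : (deg H v == M) = false by apply/eqP; lia.
  by rewrite d5; lia.
have d4' : (deg A v <= 4) = false by lia.
rewrite vertex_gift_const // /weight d4' /=.
case: (deg A v =P 5) h5 => [d5 /negbFE/eqP h5|d5 _].
  have -> : (deg H v == M - 1) = false by apply/eqP; lia.
  have -> : (deg H v == M) = false by apply/eqP; lia.
  by rewrite h5 d5 /=; lia.
case: (deg A v =P 6) => [d6|d6].
  have -> : (deg H v == M - 1) = false by apply/eqP; lia.
  have -> : (deg H v == M) = false by apply/eqP; lia.
  by rewrite d6; lia.
case: (deg A v =P 7) => [d7|d7].
  have -> : (deg H v == M - 1) = false by apply/eqP; lia.
  have -> : (deg H v == M) = false by apply/eqP; lia.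
  by rewrite d7; lia.
case: (deg H v =P M) => hM; first by have -> : (deg H v == M - 1) = false by [apply/eqP; lia]; lia.
case: (deg H v =P M - 1) => hM1; lia.
Qed.

Lemma triangle_gift D : D \in F -> #|D| = 6 ->
  84 <= \sum_v (0 < dart_deg D v) * weight A H v (meets_loose v D).
Proof.
move=> DF D6; have [[a b] ab] := set0Pn _ (face_neq0 FA DF).
have [c [ca cb DE]] := triangle_face Ai FA DF D6 ab.
have ac : (a, c) \in D by rewrite DE inE !inE eqxx !orbT.
have bc : (b, c) \in D by rewrite DE inE !inE eqxx !orbT.
have aN := dart_neq Ai FA DF ab.
have := triangle_weight M12 crit (face_sub FA DF ab) (face_sub FA DF ac) (face_sub FA DF bc).
have mis x y z : (x, y) \in D -> (x, z) \in D ->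
    (forall w, (x, w) \in D -> w = y \/ w = z) -> meets_loose x D = ~~ H x y || ~~ H x z.
  move=> xy xz only; apply/existsP/orP => [[w /andP[/only[]-> ?]]|]; [by left|by right|].
  by case=> h; [exists y|exists z]; apply/andP.
have onlyab x y z : (x, y) \in D -> (x, z) \in D -> y != z ->
    (forall w, (x, w) \in D -> w = y \/ w = z).
  move=> xy xz yz w xw; have := dart_deg_triangle Ai FA DF D6 xy.
  have [->|wy] := eqVneq w y; first by left.
  have [->|wz] := eqVneq w z; first by right.
  rewrite /dart_deg (cardsD1 y) (cardsD1 z) (cardsD1 w) !inE xy xz xw.
  by rewrite wy wz eq_sym yz.
have ba := face_sym FA DF ab; have ca' := face_sym FA DF ac; have cb' := face_sym FA DF bc.
have d x y : (x, y) \in D -> 0 < dart_deg D x by move=> xy; apply/dart_deg_gt0; exists y.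
rewrite (bigD1 a) //= (bigD1 b) 1?eq_sym //= (bigD1 c) ?ca //=.
rewrite (d _ _ ab) (d _ _ ba) (d _ _ ca') !mul1n.
rewrite (mis a b c) ?(mis b a c) ?(mis c a b) //; last first.
- by apply: onlyab; rewrite // eq_sym.
- by apply: onlyab; rewrite // eq_sym.
- by apply: onlyab; rewrite // eq_sym.
by rewrite !addnA => le; apply: leq_trans le (leq_addr _ _).
Qed.

(** A saturated set in [assignment_dichotomy] would be an alternator: two vertices
    assigned to y of degree M, or one and the slack M - d(y) = 1, are what
    [alternator] requires for vertices of degree at most 3. *)
Lemma masters :
  \sum_x (deg A x == 2) + \sum_x (deg A x == 3) <=
  \sum_y (2 * (deg H y == M) + (deg H y == M - 1)).
Proof.
pose X := [set x | (deg A x == 2) || (deg A x == 3)].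
have X3 x : x \in X -> 0 < deg A x <= 3.
  by rewrite inE => /orP[] /eqP->.
have -> : \sum_x (deg A x == 2) + \sum_x (deg A x == 3) = #|X|.
  rewrite -sum1dep_card [RHS]big_mkcond -big_split /=; apply: eq_bigr => x _.
  by case: eqP => [->|_] //=; case: eqP.
pose cap y := 2 * (deg H y == M) + (deg H y == M - 1).
case: (@assignment_dichotomy T H cap X).
- move=> x /X3 /andP[/card_gt0P[y]]; rewrite inE => xy x3.
  by exists y; have [] := low_neighbour M12 crit x3 xy.
- case=> B _ le; apply: (@leq_trans (\sum_y load B X y)); last by apply: leq_sum => y _; apply: le.
  rewrite /load; under eq_bigr => y _ do rewrite -sum1dep_card big_mkcondr /=.
  rewrite exchange_big /= -sum1_card; apply: leq_sum => x _.
  by rewrite (bigD1 (B x)) //= eqxx.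
case=> U [B [UX U0 asg full]]; exfalso.
apply: (alternator M12 crit U0 _ asg).
  by move=> x /(subsetP UX)/X3/andP[].
move=> x xU y xy; have := full x xU y xy; have /andP[_ x3] := X3 _ (subsetP UX _ xU).
have [_] := low_neighbour M12 crit x3 (HA xy); have := degHM crit y; have := degHA x.
rewrite /cap; move: x3; have := X3 _ (subsetP UX _ xU).
have [->|yM] := eqVneq (deg H y) M; first by lia.
by have [->|yM1] := eqVneq (deg H y) (M - 1); lia.
Qed.

Lemma two_neighbours u : deg A u = 2 ->
  exists a b, [/\ a != b, forall y, A u y = (y == a) || (y == b), deg H a = M & deg H b = M].
Proof.
move=> d2; have /eqP/cards2P[a [b [ab E]]] : #|[set y | A u y]| = 2 by [].
have adj y : A u y = (y == a) || (y == b) by move/setP/(_ y): E; rewrite !inE.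
have nb y : A u y -> deg H y = M.
  move=> uy; have [|_] := low_neighbour M12 crit _ uy; rewrite d2 //.
  by have := degHM crit y; lia.
by exists a, b; split=> //; apply: nb; rewrite adj eqxx ?orbT.
Qed.

Lemma two_face D u y z : deg A u = 2 -> D \in F -> (u, y) \in D -> A u z -> (u, z) \in D.
Proof.
move=> d2 DF uy uz; have := dart_deg_gt1 FA DF uy; rewrite /dart_deg => d.
have sub : [set w | (u, w) \in D] \subset [set w | A u w].
  by apply/subsetP => w; rewrite !inE => /(face_sub FA DF).
have : [set w | (u, w) \in D] == [set w | A u w].
  by rewrite eqEcard sub; rewrite /deg in d2; rewrite d2.
by move/eqP/setP/(_ z); rewrite !inE uz.
Qed.

(** Two vertices of degree 2 with the same neighbours a, b form an alternator, one
    of them being assigned to a and the other to b. *)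
Lemma no_twin_twos u w a b : deg A u = 2 -> deg A w = 2 -> u != w -> a != b ->
  A u a -> A u b -> A w a -> A w b -> False.
Proof.
move=> du dw uw ab ua ub wa wb.
have onlyab x y : x = u \/ x = w -> A x y -> y = a \/ y = b.
  have gen x' : deg A x' = 2 -> A x' a -> A x' b -> A x' y -> y = a \/ y = b.
    move=> d2 xa xb xy.
    have [->|ya] := eqVneq y a; first by left.
    have [->|yb] := eqVneq y b; first by right.
    move: d2; rewrite /deg (cardsD1 a) (cardsD1 b) (cardsD1 y) !inE xa xb xy.
    by rewrite ya yb eq_sym ab.
  by case=> ->; apply: gen.
apply: (@alternator _ _ _ _ M12 crit [set u; w] (fun x => if x == u then a else b)).
- by apply/set0Pn; exists u; rewrite !inE eqxx.
- by move=> x; rewrite !inE => /orP[] /eqP->; rewrite ?du ?dw.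
- move=> x; rewrite !inE => /orP[] /eqP->; first by rewrite eqxx (degA4 M12 crit) // du.
  by rewrite eq_sym (negPf uw) (degA4 M12 crit) // dw.
move=> x xU y xy.
have x2 : deg H x = 2.
  by move: xU; rewrite !inE => /orP[] /eqP->; rewrite (degHA4 M12 crit) ?du ?dw.
rewrite x2; suff : 0 < load (fun x => if x == u then a else b) [set u; w] y by lia.
apply/card_gt0P.
have [|->|->] := onlyab x y _ (HA xy).
- by move: xU; rewrite !inE => /orP[] /eqP->; [left|right].
- by exists u; rewrite !inE !eqxx.
- by exists w; rewrite !inE eqxx orbT /= (eq_sym w u) (negPf uw) eqxx.
Qed.


(** The faces whose darts at vertices of degree M can give charge to the vertices
    of degree 2.  A triangle is among them when its darts lie on no other face,
    since a second side of each dart is then free. *)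
Definition charitable D : bool := (#|D| != 6) || [forall p in D, cover_count F p <= 1].

(** Each dart has two sides.  They are shared among the triangles, the charitable
    faces, and the case that no face contains the dart. *)
Lemma dart_budget v y :
  triangles_on v y + \sum_(D in F | charitable D) ((v, y) \in D)
    + 2 * (cover_count F (v, y) == 0) <= 2.
Proof.
have two := face_two FA (v, y); have tri := triangles_on_le v y.
have goodle : \sum_(D in F | charitable D) ((v, y) \in D) <= cover_count F (v, y).
  by rewrite cover_countE big_mkcondr; apply: leq_sum => D _; case: ifP.
have [/existsP[D /and4P[DF vy D6 gD]]|no] :=
    boolP [exists D, [&& D \in F, (v, y) \in D, #|D| == 6 & charitable D]].
  move: gD; rewrite /charitable D6 /= => /forall_inP/(_ _ vy) c1.
  have : cover_count F (v, y) != 0.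
    by rewrite -lt0n; apply/card_gt0P; exists D; rewrite inE DF.
  move: c1 goodle tri; set g := \sum_(D in F | charitable D) _.
  by case: (cover_count F (v, y)) => [|[|]] //= *; lia.
have : triangles_on v y + \sum_(D in F | charitable D) ((v, y) \in D) <= cover_count F (v, y).
  rewrite cover_countE /triangles_on !big_mkcondr -big_split /=.
  apply: leq_sum => D DF; case: ifP => D6; case: ifP => gD; rewrite ?addn0 //.
  case: (boolP (_ \in _)) => // vy; case/existsP: no; exists D.
  by rewrite DF vy D6.
set g := \sum_(D in F | charitable D) _.
by case: (cover_count F (v, y)) two => [|c] /= *; lia.
Qed.

Definition two_vertices_of D : nat := \sum_(u | deg A u == 2) (0 < dart_deg D u).

Definition full_darts D : nat := \sum_(v | deg H v == M) dart_deg D v.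

Lemma dart_deg_two D u : D \in F -> deg A u = 2 ->
  dart_deg D u = 2 * (0 < dart_deg D u).
Proof.
move=> DF d2; case: dart_deg_gt0 => [[y uy]|no].
  apply/eqP; rewrite eqn_leq (dart_deg_gt1 FA DF uy) andbT -[leqRHS]d2.
  by apply/subset_leq_card/subsetP => w; rewrite !inE => /(face_sub FA DF).
apply/eqP; rewrite muln0 -leqn0 leqNgt; apply/negP => /card_gt0P[y].
by rewrite inE => uy; apply: no; exists y.
Qed.

Lemma two_vertices_full_darts D : D \in F -> 2 * two_vertices_of D <= full_darts D.
Proof.
move=> DF; rewrite /two_vertices_of big_distrr /=.
rewrite (eq_bigr (fun u => \sum_v ((v, u) \in D) * (deg H v == M))); last first.
  move=> u /eqP d2; rewrite -dart_deg_two // dart_deg_sum; apply: eq_bigr => v _.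
  have -> : ((u, v) \in D) = ((v, u) \in D) by apply/idP/idP; apply: (face_sym FA DF).
  case: (boolP (_ \in D)) => // /(face_sub FA DF); rewrite As => uv.
  have [a [b [_ adj ha hb]]] := two_neighbours d2.
  by move: uv; rewrite adj => /orP[] /eqP->; rewrite ?ha ?hb eqxx.
rewrite exchange_big /= /full_darts [leqRHS]big_mkcond /=; apply: leq_sum => v _.
case: ifP => hv; last by rewrite big1 // => u _; rewrite muln0.
rewrite dart_deg_sum [leqRHS](bigID (fun u => deg A u == 2)) /=.
by apply: leq_trans (leq_addr _ _); apply: leq_sum => u _; rewrite muln1.
Qed.

Lemma card_face_split D : D \in F -> 2 * two_vertices_of D + full_darts D <= #|D|.
Proof.
move=> DF; rewrite card_darts /two_vertices_of /full_darts big_distrr /=.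
rewrite [X in X + _]big_mkcond [X in _ + X]big_mkcond -big_split /=.
apply: leq_sum => v _; case: eqP => [d2|_]; last by case: ifP.
rewrite -dart_deg_two //; case: eqP => [hM|_]; rewrite ?addn0 //.
by have := degHA v; lia.
Qed.

(** A face with a vertex u of degree 2 contains at least two darts at each of
    the two neighbours of u, four units in all.  Two or more such vertices make the
    face so long that its own charge pays; only a quadrangle with two vertices
    of degree 2 could fail, and this is [no_twin_twos]. *)
Lemma two_vertices_charge D : D \in F -> 4 * two_vertices_of D <= full_darts D + 2 * (#|D| - 8).
Proof.
move=> DF; have le2 := two_vertices_full_darts DF; have lec := card_face_split DF.
have ev := even_face FA DF.
have [j0|j0] := posnP (two_vertices_of D); first by rewrite j0.
have [u /andP[/eqP d2 /dart_deg_gt0[y uy]]] : exists u, (deg A u == 2) && (0 < dart_deg D u).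
  apply/existsP; apply: contraLR j0 => /existsPn no; rewrite -leqNgt leqn0.
  apply/eqP/big1 => u du; have := no u; rewrite du /= -leqNgt leqn0 => /eqP->.
  by [].
have [a [b [ab adj ha hb]]] := two_neighbours d2.
have ua : (u, a) \in D by apply: (two_face d2 DF uy); rewrite adj eqxx.
have ub : (u, b) \in D by apply: (two_face d2 DF uy); rewrite adj eqxx orbT.
have da := dart_deg_gt1 FA DF (face_sym FA DF ua).
have db := dart_deg_gt1 FA DF (face_sym FA DF ub).
have big4 : 4 <= full_darts D.
  rewrite /full_darts (bigD1 a) ?ha //= (bigD1 b) /=; last by rewrite hb eqxx eq_sym.
  by lia.
have [j1|j2] := leqP (two_vertices_of D) 1; first by lia.
have [//|lt] := leqP (4 * two_vertices_of D) (full_darts D + 2 * (#|D| - 8)).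
(* The only remaining case: D is a quadrangle with exactly two vertices of degree 2. *)
have D8 : #|D| = 8.
  have : #|D| != 9 by apply: contraNneq ev => ->.
  by lia.
have j : two_vertices_of D = 2 by lia.
have q : full_darts D = 4 by lia.
have [w /and3P[/eqP dw wu /dart_deg_gt0[z wz]]] :
    exists w, [&& deg A w == 2, w != u & 0 < dart_deg D w].
  apply/existsP; apply: contraLR j2 => /existsPn no; rewrite -leqNgt.
  rewrite /two_vertices_of (bigD1 u) ?d2 //= big1 ?addn0 ?leq_b1 // => w /andP[dw wu].
  by have := no w; rewrite dw wu /= -leqNgt leqn0 => /eqP->.
have [a' [b' [ab' adj' ha' hb']]] := two_neighbours dw.
have wa : (w, a') \in D by apply: (two_face dw DF wz); rewrite adj' eqxx.
have wb : (w, b') \in D by apply: (two_face dw DF wz); rewrite adj' eqxx orbT.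
have only x : deg H x = M -> 0 < dart_deg D x -> x = a \/ x = b.
  move=> hx dx; have [->|xa] := eqVneq x a; first by left.
  have [->|xb] := eqVneq x b; first by right.
  move: q; rewrite /full_darts (bigD1 a) ?ha //= (bigD1 b) /=; last by rewrite hb eqxx eq_sym.
  rewrite (bigD1 x) /= ?hx ?eqxx ?xa // => q; exfalso.
  by move: q da db dx; clear; lia.
have dgt x t : (t, x) \in D -> 0 < dart_deg D x.
  by move/(face_sym FA DF) => xt; apply/dart_deg_gt0; exists t.
exfalso; have [aE bE] : A w a /\ A w b.
  have e1 := only _ ha' (dgt _ _ wa); have e2 := only _ hb' (dgt _ _ wb).
  rewrite !adj'; case: e1 e2 ab' => -> [] ->; rewrite ?eqxx ?orbT //.
by apply: (no_twin_twos d2 dw _ ab) => //; rewrite 1?eq_sym // adj eqxx ?orbT.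
Qed.

Definition faceless u : bool := [forall y, A u y ==> (cover_count F (u, y) == 0)].

(** If all faces at u are triangles, they are the same triangle, because u and its
    two neighbours determine it; so its darts lie on no other face. *)
Lemma two_in_charitable_face u : deg A u = 2 -> ~~ faceless u ->
  exists D, [/\ D \in F, charitable D & 0 < dart_deg D u].
Proof.
move=> d2; rewrite negb_forall => /existsP[y]; rewrite negb_imply -lt0n.
case/andP => uy /card_gt0P[D0]; rewrite inE => /andP[D0F uyD0].
have [/existsP[D /and3P[DF uyD gD]]|no] :=
    boolP [exists D, [&& D \in F, (u, y) \in D & charitable D]].
  by exists D; split=> //; apply/dart_deg_gt0; exists y.
have tri D : D \in F -> (u, y) \in D -> #|D| = 6.
  move=> DF uyD; apply/eqP; apply: contraNT no => D6.
  by apply/existsP; exists D; rewrite DF uyD /charitable D6.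
have [a [b [ab adj _ _]]] := two_neighbours d2.
have third x z z' : A u z -> A u z' -> z != y -> z' != y -> z = z'.
  move: uy; rewrite !adj => /orP[] /eqP-> /orP[] /eqP-> /orP[] /eqP->;
    by rewrite ?eqxx.
have uniq_tri D : D \in F -> (u, y) \in D -> D = D0.
  move=> DF uyD.
  have [z [zu zy E]] := triangle_face Ai FA DF (tri D DF uyD) uyD.
  have [z0 [z0u z0y E0]] := triangle_face Ai FA D0F (tri D0 D0F uyD0) uyD0.
  suff zz : z = z0 by rewrite E E0 zz.
  apply: (third u) => //; [apply: (face_sub FA DF)|apply: (face_sub FA D0F)].
    by rewrite E !inE eqxx !orbT.
  by rewrite E0 !inE eqxx !orbT.
have c1 : cover_count F (u, y) <= 1.
  rewrite -(cards1 D0); apply/subset_leq_card/subsetP => D.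
  by rewrite !inE => /andP[DF uyD]; rewrite (uniq_tri D).
case/existsP: no; exists D0; rewrite D0F uyD0 /charitable tri //=.
by apply/forall_inP => p pD; apply: (face_once FA D0F uyD0 pD c1).
Qed.

(** In quarters of a unit: four of them go to each vertex of degree 2, besides the
    unit that comes from [masters]. *)
Lemma two_supply :
  4 * \sum_x (deg A x == 2) <=
  \sum_v (deg H v == M) * (2 * deg A v - 2 * triangles_at v)
    + 2 * \sum_(D in F) (#|D| - 8).
Proof.
pose Z := \sum_v \sum_y ((deg H v == M) && A v y) * (2 * (cover_count F (v, y) == 0)).
pose G := \sum_(D in F | charitable D) full_darts D.
have supply : Z + G <= \sum_v (deg H v == M) * (2 * deg A v - 2 * triangles_at v).
  have -> : G = \sum_v \sum_y ((deg H v == M) && A v y) *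
                  \sum_(D in F | charitable D) ((v, y) \in D).
    rewrite /G /full_darts (eq_bigr (fun D => \sum_v (deg H v == M) * dart_deg D v)).
      rewrite exchange_big /=; apply: eq_bigr => v _.
      under [RHS]eq_bigr => y _ do rewrite big_distrr /=.
      rewrite exchange_big /=; apply: eq_bigr => D /andP[DF _].
      rewrite (dart_deg_adj _ DF) big_distrr big_mkcond /=; apply: eq_bigr => y _.
      by case: (deg H v == M); case: (A v y); rewrite ?mul0n ?muln0.
    by move=> D _; rewrite [LHS]big_mkcond; apply: eq_bigr => v _; case: ifP; rewrite ?mul1n.
  rewrite /Z -big_split; apply: leq_sum => v _ /=; rewrite -big_split /=.
  case: (deg H v == M); last by rewrite big1.
  rewrite mul1n -sum_triangles_on /deg -sum1dep_card big_distrr /=.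
  rewrite leq_subRL; last first.
    apply: leq_sum => y _; apply: leq_trans (triangles_on_le _ _) _.
    exact: face_two FA _.
  rewrite [X in _ + X <= _](bigID (A v)) /= [X in _ + (_ + X)]big1 ?addn0 => [|y /negPf-> //].
  rewrite -big_split; apply: leq_sum => y vy /=; rewrite vy !mul1n muln1.
  by rewrite addnA addnAC dart_budget.
have needZ : 4 * \sum_(u | deg A u == 2) faceless u <= Z.
  rewrite /Z exchange_big big_distrr [leqLHS]big_mkcond /=; apply: leq_sum => u _.
  case: ifP => // /eqP d2; case: (boolP (faceless u)) => // /forallP fu.
  have [a [b [ab adj ha hb]]] := two_neighbours d2.
  have part x : deg H x = M -> A u x ->
      ((deg H x == M) && A x u) * (2 * (cover_count F (x, u) == 0)) = 2.
    move=> hx ux; rewrite hx eqxx As ux.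
    have -> : cover_count F (x, u) = cover_count F (u, x).
      apply: eq_card => D; rewrite !inE; case: (boolP (D \in F)) => //= DF.
      by apply/idP/idP; apply: (face_sym FA DF).
    by have := fu x; rewrite ux /= => ->.
  rewrite (bigD1 a) //= (bigD1 b) /=; last by rewrite eq_sym.
  rewrite !part // ?adj ?eqxx ?orbT //.
have needG : 4 * \sum_(D in F | charitable D) two_vertices_of D <= G + 2 * \sum_(D in F) (#|D| - 8).
  apply: (@leq_trans (\sum_(D in F | charitable D) (full_darts D + 2 * (#|D| - 8)))).
    by rewrite big_distrr; apply: leq_sum => D /andP[DF _]; apply: two_vertices_charge.
  rewrite big_split leq_add2l big_distrr /= [leqRHS](bigID charitable) /=.
  exact: leq_addr.
have cover : \sum_x (deg A x == 2) <=
    \sum_(u | deg A u == 2) faceless u + \sum_(D in F | charitable D) two_vertices_of D.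
  rewrite /two_vertices_of exchange_big /= -big_split [leqRHS]big_mkcond /=; apply: leq_sum => u _.
  case: eqP => // d2; case: (boolP (faceless u)) => [//|/(two_in_charitable_face d2)[D [DF gD Du]]].
  by rewrite (bigD1 D) ?DF //= Du.
by lia.
Qed.

(** Summing the charges: the gifts make every triangle nonnegative, the spare
    charge of the vertices of large degree covers those of degree 2 and 3, and
    the total contradicts [face_euler]. *)
Theorem discharging : False.
Proof.
have vc : 336 * \sum_v (0 < deg A v) + \sum_v vertex_gift v
      + 84 * \sum_v (deg H v == M - 1)
      + \sum_v (deg H v == M) * (168 + 21 * (2 * deg A v - 2 * triangles_at v)) <=
    84 * \sum_v deg A v + 168 * \sum_v (deg A v == 2) + 84 * \sum_v (deg A v == 3).
  by rewrite !big_distrr -!big_split /=; apply: leq_sum => v _; apply: vertex_charge.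
(* With 84 units, d - 4 on the vertices and half the number of darts - 4 on the
   faces; everything is linear in the sums below. *)
have gifts : 84 * #|[set D in F | #|D| == 6]| <= \sum_v vertex_gift v.
  rewrite exchange_big /= mulnC -sum_nat_const.
  rewrite [leqLHS](eq_bigl (fun D => (D \in F) && (#|D| == 6))); last by move=> D; rewrite inE.
  by apply: leq_sum => D /andP[DF /eqP]; apply: triangle_gift.
have sizes : \sum_(D in F) #|D| + 2 * #|[set D in F | #|D| == 6]| =
    8 * #|F| + \sum_(D in F) (#|D| - 8).
  have -> : #|[set D in F | #|D| == 6]| = \sum_(D in F) (#|D| == 6).
    by rewrite -sum1dep_card big_mkcondr; apply: eq_bigr => D _; case: (_ == _).
  rewrite -sum1_card !big_distrr -!big_split /=; apply: eq_bigr => D DF.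
  have := card_face_ge6 Ai FA DF; have := even_face FA DF.
  case: eqP => [->//|D6] ev ge.
  have : #|D| != 7 by apply: contraNneq ev => ->.
  by rewrite muln0 muln1; move: D6 ge; move: #|D| => n; lia.
have twice : \sum_(D in F) #|D| <= 2 * \sum_v deg A v.
  rewrite -card_sum_deg mulnC -sum_nat_const.
  rewrite (eq_bigr (fun D => \sum_p (p \in D))); last first.
    by move=> D _; rewrite -sum1_card big_mkcond; apply: eq_bigr => p _; case: ifP.
  rewrite exchange_big [leqRHS]big_mkcond /=; apply: leq_sum => -[x y] _.
  rewrite inE /= -cover_countE; case: ifP => xy; first exact: face_two FA _.
  rewrite leqn0; apply/eqP/eq_card0 => D; rewrite !inE; apply/negP => /andP[DF].
  by move/(face_sub FA DF); rewrite xy.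
have eu : \sum_v deg A v + 2 <= 2 * (\sum_v (0 < deg A v) + #|F|).
  have -> : \sum_v (0 < deg A v) = #|[set x | 0 < deg A x]|.
    by rewrite -sum1dep_card [RHS]big_mkcond; apply: eq_bigr => v _; case: (0 < _).
  by rewrite -card_sum_deg; apply: face_euler FA.
have ms := masters; rewrite big_split /= -[X in _ <= X + _](@big_distrr _ 0 muln addn) /= in ms.
have ts := two_supply.
have split_big : \sum_v (deg H v == M) * (168 + 21 * (2 * deg A v - 2 * triangles_at v)) =
    168 * \sum_v (deg H v == M) +
    21 * \sum_v (deg H v == M) * (2 * deg A v - 2 * triangles_at v).
  rewrite !big_distrr -big_split /=; apply: eq_bigr => v _.
  by rewrite mulnDr mulnC; congr (_ + _); rewrite mulnCA.
rewrite split_big in vc.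
lia.
Qed.

End Discharging.

(** * Faces from winding numbers *)

Lemma natr_F2_odd n : (n%:R == 0 :> 'F_2)%R = ~~ odd n.
Proof. by rewrite -dvdn2 (dvdn_pcharf (pchar_Fp (isT : prime 2))). Qed.

Lemma addF2 (a : 'F_2) : (a + a = 0)%R.
Proof. by apply: addrr_pchar2; apply: pchar_Fp. Qed.

Lemma F2_neq0 (a : 'F_2) : (a != 0)%R -> a = 1%R.
Proof. by case: a => [[|[|n]] lt] // _; apply/val_inj. Qed.

Lemma two_values (X : eqType) (a b c c' k : X) : c != c' ->
  c = a \/ c = b -> c' = a \/ c' = b -> k = a \/ k = b -> k = c \/ k = c'.
Proof.
move=> /eqP ne [] ? [] ? [] ?; subst; try (by left); try (by right); by case: ne.
Qed.

Section CycleSpace.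
Variables (T : finType) (A : rel T).
Hypotheses (As : symmetric A) (Ai : irreflexive A).

(** Each edge is oriented once and for all, so that subgraphs become row vectors
    over the field with two elements. *)
Definition oriented_edges : {set T * T} :=
  [set p | A p.1 p.2 && (enum_rank p.1 < enum_rank p.2)].

Local Notation m := #|oriented_edges|.

Definition edge_ends (i : 'I_m) : T * T := enum_val i.

Definition on_edge (i : 'I_m) (p : T * T) : bool :=
  (p == edge_ends i) || (p == ((edge_ends i).2, (edge_ends i).1)).

Lemma edge_endsP i : A (edge_ends i).1 (edge_ends i).2 /\
  enum_rank (edge_ends i).1 < enum_rank (edge_ends i).2.
Proof. by have := enum_valP i; rewrite inE => /andP[]. Qed.

Lemma edge_ends_neq i : (edge_ends i).1 != (edge_ends i).2.
Proof. by have [h _] := edge_endsP i; apply: contraTneq h => ->; rewrite Ai. Qed.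

Lemma on_edge_adj i p : on_edge i p -> A p.1 p.2.
Proof. by have [h _] := edge_endsP i; case/orP => /eqP-> //=; rewrite As. Qed.

Lemma on_edge_sym i x y : on_edge i (x, y) = on_edge i (y, x).
Proof. by rewrite /on_edge orbC !xpair_eqE /= andbC [X in _ || X]andbC -xpair_eqE -surjective_pairing. Qed.

Lemma on_edge_ex x y : A x y -> exists i, on_edge i (x, y).
Proof.
move=> xy; have xyN : x != y by apply: contraTneq xy => ->; rewrite Ai.
wlog lt : x y xy xyN / enum_rank x < enum_rank y.
  move=> IH; case: (ltngtP (enum_rank x) (enum_rank y)) => h; first exact: IH.
    by have [||i] := IH y x _ _ h; [rewrite As|rewrite eq_sym|rewrite on_edge_sym; exists i].
  by move/ord_inj/enum_rank_inj: h xyN => ->; rewrite eqxx.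
have xyE : (x, y) \in oriented_edges by rewrite inE xy lt.
by exists (enum_rank_in xyE (x, y)); rewrite /on_edge /edge_ends enum_rankK_in // eqxx.
Qed.

Lemma on_edge_inj i j p : on_edge i p -> on_edge j p -> i = j.
Proof.
have [_ li] := edge_endsP i; have [_ lj] := edge_endsP j.
have inj : edge_ends i = edge_ends j -> i = j by apply: enum_val_inj.
case: p => x y; rewrite /on_edge; move: inj li lj.
case: (edge_ends i) (edge_ends j) => a b [c d] /= inj li lj.
by do 2 (case/orP => /eqP[? ?]); subst; apply: inj => //; lia.
Qed.

Lemma card_darts_edges : #|[set p | A p.1 p.2]| = 2 * m.
Proof.
have -> : [set p | A p.1 p.2] = oriented_edges :|: [set (p.2, p.1) | p in oriented_edges].
  apply/setP => -[x y]; rewrite !inE /=; apply/idP/idP => [xy|].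
    case: (ltngtP (enum_rank x) (enum_rank y)) => h; first by rewrite xy.
      by apply/orP; right; apply/imsetP; exists (y, x); rewrite ?inE //= As xy.
    by move/ord_inj/enum_rank_inj: h xy => ->; rewrite Ai.
  by case/orP => [/andP[]//|/imsetP[[a b]]]; rewrite inE /= => /andP[ab _] [-> ->]; rewrite As.
have I : oriented_edges :&: [set (p.2, p.1) | p in oriented_edges] = set0.
  apply/setP => -[x y]; rewrite !inE /=; apply/negP => /andP[/andP[_ lt]].
  by case/imsetP => -[a b]; rewrite inE /= => /andP[_ lt'] [? ?]; subst; lia.
rewrite cardsU I cards0 subn0 card_imset ?mul2n ?addnn //.
by move=> [a b] [c d] [-> ->].
Qed.

Definition inc (x : T) (i : 'I_m) : 'F_2 :=
  ((x == (edge_ends i).1)%:R + (x == (edge_ends i).2)%:R)%R.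

Definition incidence : 'M['F_2]_(m, #|T|) := (\matrix_(i, v) inc (enum_val v) i)%R.

Definition even_vec (z : 'rV['F_2]_m) : bool := (z *m incidence == 0)%R.

Lemma even_vecP (z : 'rV['F_2]_m) :
  reflect (forall x, \sum_i z ord0 i * inc x i = 0)%R (even_vec z).
Proof.
apply: (iffP eqP) => [e x|h].
  transitivity ((z *m incidence) ord0 (enum_rank x))%R; last by rewrite e mxE.
  by rewrite mxE; apply: eq_bigr => i _; rewrite mxE enum_rankK.
apply/rowP => v; rewrite [RHS]mxE -(h (enum_val v)) mxE.
by apply: eq_bigr => j _; rewrite mxE.
Qed.

Lemma mxrank_sum_rows n k (I : finType) (P : {set I}) (R : I -> 'rV['F_2]_n) (B : 'M_(k, n)) :
  (B <= \sum_(i in P) <<R i>>)%MS -> \rank B <= #|P|.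
Proof.
move=> /mxrankS/leq_trans; apply.
apply: leq_trans (mxrank_sum_leqif _) _.
rewrite /= -sum1_card; apply: leq_sum => i _.
by rewrite genmxE rank_leq_row.
Qed.

(** The columns of the incidence matrix sum to zero, so one of the nonzero columns
    is redundant. *)
Lemma rank_incidence (x0 : T) : 0 < deg A x0 ->
  \rank incidence < #|[set x | 0 < deg A x]|.
Proof.
move=> d0; set V := [set x | 0 < deg A x].
have x0V : x0 \in V by rewrite inE.
rewrite (cardsD1 x0) x0V add1n ltnS -mxrank_tr.
apply: (@mxrank_sum_rows _ _ _ _ (fun x => row (enum_rank x) incidence^T)%R).
have sub x : x != x0 -> (row (enum_rank x) incidence^T <=
    \sum_(i in V :\ x0) <<row (enum_rank i) incidence^T>>)%MS.
  move=> xx0; have [xV|xV] := boolP (x \in V).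
    by apply: (sumsmx_sup x); rewrite ?inE ?xx0 ?genmxE //; rewrite inE in xV.
  suff -> : row (enum_rank x) incidence^T = 0%R by apply: sub0mx.
  apply/rowP => i; rewrite !mxE enum_rankK /inc.
  have N y : A x y -> False.
    by move=> xy; move: xV; rewrite inE => /negP; apply; apply/card_gt0P; exists y; rewrite inE.
  have [h _] := edge_endsP i.
  case: eqP => [e|_]; first by case: (N (edge_ends i).2); rewrite e.
  by case: eqP => [e|_]; [case: (N (edge_ends i).1); rewrite e As | rewrite addr0].
apply/row_subP => v; have [vx|vx] := eqVneq (enum_val v) x0; last first.
  by have := sub _ vx; rewrite enum_valK.
have -> : row v incidence^T = (\sum_(x | x != x0) row (enum_rank x) incidence^T)%R.
  apply/rowP => i; rewrite summxE !mxE vx.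
  under eq_bigr => x _ do rewrite !mxE enum_rankK.
  have tot : (\sum_x inc x i = 0)%R.
    have one y : (\sum_x (x == y)%:R = 1 :> 'F_2)%R.
      by rewrite (bigD1 y) //= eqxx big1 ?addr0 // => x /negPf->.
    by rewrite /inc big_split /= !one addF2.
  have := tot; rewrite (bigD1 x0) //= => /eqP; rewrite addr_eq0 => /eqP->.
  by rewrite -[LHS]addr0 -{2}(addF2 (\sum_(j | j != x0) inc j i)%R) addrA addNr add0r.
by apply: summx_sub => x xx0; apply: sub.
Qed.

(** [S] stands for the unit squares of the plane, [side1 i] and [side2 i] for
    squares on the two sides of the edge [i], and [w z s] for the winding number
    of [z] around [s]; a set of squares which is a union of classes is bounded by
    an even number of edges at each vertex ([side_parity]). *)
Variables (S : Type) (side1 side2 : 'I_m -> S) (w : 'rV['F_2]_m -> S -> 'F_2).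

Hypothesis winding_jump : forall z, even_vec z ->
  forall i, (w z (side1 i) + w z (side2 i) = z ord0 i)%R.

Hypothesis side_parity : forall chi : S -> 'F_2,
  (forall s s', (forall z, even_vec z -> w z s = w z s') -> chi s = chi s') ->
  even_vec (\row_i (chi (side1 i) + chi (side2 i)))%R.

(** Squares with the same winding numbers with respect to all even subgraphs lie
    in the same class; a class plays the role of a face. *)
Definition winding_class s : {ffun 'rV['F_2]_m -> 'F_2} :=
  [ffun z => if even_vec z then w z s else 0%R].

Definition boundary (phi : {ffun 'rV['F_2]_m -> 'F_2}) : 'rV['F_2]_m :=
  (\row_i ((winding_class (side1 i) == phi)%:R + (winding_class (side2 i) == phi)%:R))%R.

Lemma boundary_even phi : even_vec (boundary phi).
Proof.
apply: (side_parity (chi := fun s => (winding_class s == phi)%:R%R)) => s s' h.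
suff -> : winding_class s = winding_class s' by [].
by apply/ffunP => z; rewrite !ffunE; case: ifP => // ez; rewrite h.
Qed.

Lemma boundary_neq0 phi i : (boundary phi ord0 i != 0)%R ->
  winding_class (side1 i) != winding_class (side2 i) /\
  (phi = winding_class (side1 i) \/ phi = winding_class (side2 i)).
Proof.
rewrite mxE; have [<-|n1] := eqVneq (winding_class (side1 i)) phi.
  have [->|n2] := eqVneq (winding_class (side2 i)) (winding_class (side1 i)).
    by rewrite addF2 eqxx.
  by move=> _; split; [|left].
have [e|n2] := eqVneq (winding_class (side2 i)) phi; last by rewrite addr0 eqxx.
by move=> _; rewrite e; split; [|right].
Qed.

Lemma boundary_sides i : winding_class (side1 i) != winding_class (side2 i) ->
  (boundary (winding_class (side1 i)) ord0 i != 0)%R /\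
  (boundary (winding_class (side2 i)) ord0 i != 0)%R.
Proof.
move=> n; have n' := n; rewrite eq_sym in n'.
by rewrite !mxE !eqxx (negPf n) (negPf n') addr0 add0r.
Qed.

(** On the edge i the right-hand side adds up the winding numbers on the two sides
    of the edge, whose difference is the coefficient of z there. *)
Lemma boundary_span z : even_vec z -> 
  (z = \sum_(phi : {ffun 'rV['F_2]_m -> 'F_2}) phi z *: boundary phi)%R.
Proof.
move=> ez; apply/rowP => i; rewrite summxE.
under eq_bigr => phi _ do rewrite !mxE mulrDr.
rewrite big_split /=.
have pick s : (\sum_(phi : {ffun 'rV['F_2]_m -> 'F_2}) phi z * (winding_class s == phi)%:R = w z s)%R.
  rewrite (bigD1 (winding_class s)) //= eqxx mulr1 big1 ?addr0; first by rewrite ffunE ez.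
  by move=> phi; rewrite eq_sym => /negPf->; rewrite mulr0.
by rewrite !pick winding_jump.
Qed.

Definition boundaries : {set 'rV['F_2]_m} :=
  [set boundary phi | phi in predT & (boundary phi != 0)%R].

Lemma card_boundaries : (exists x y, A x y) ->
  m + 1 <= #|[set x | 0 < deg A x]| + #|boundaries|.
Proof.
case=> x [y xy]; have dx : 0 < deg A x by apply/card_gt0P; exists y; rewrite inE.
have rk := rank_incidence dx.
suff : \rank (kermx incidence) <= #|boundaries| by rewrite mxrank_ker; lia.
apply: (@mxrank_sum_rows _ _ _ _ id).
apply/row_subP => v; rewrite {1}(boundary_span (z := row v (kermx incidence))); last first.
  by rewrite /even_vec -row_mul mulmx_ker row0.
apply: summx_sub => phi _; apply: scalemx_sub.
have [->|n0] := eqVneq (boundary phi) 0%R; first exact: sub0mx.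
by apply: (sumsmx_sup (boundary phi)); rewrite ?genmxE //; apply: imset_f; rewrite inE.
Qed.

Definition darts_of (z : 'rV['F_2]_m) : {set T * T} :=
  [set p | [exists i, (z ord0 i != 0)%R && on_edge i p]].

Lemma mem_darts_of z i p : on_edge i p -> (p \in darts_of z) = (z ord0 i != 0)%R.
Proof.
move=> ip; rewrite inE; apply/existsP/idP => [[j /andP[zj jp]]|zi]; last by exists i; rewrite zi.
by rewrite (on_edge_inj ip jp).
Qed.

Lemma on_edge_ends i : on_edge i (edge_ends i).
Proof. by rewrite /on_edge eqxx. Qed.

Lemma darts_of_inj : injective darts_of.
Proof.
move=> z z' e; apply/rowP => i.
have := mem_darts_of z (on_edge_ends i); rewrite e (mem_darts_of z' (on_edge_ends i)).
have [->|n] := eqVneq (z ord0 i) 0%R; first by move/negbFE/eqP->.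
by move=> n'; rewrite (F2_neq0 n) (F2_neq0 n').
Qed.

Lemma even_darts_of z x : even_vec z -> ~~ odd (dart_deg (darts_of z) x).
Proof.
move=> /even_vecP/(_ x) e; rewrite -natr_F2_odd -e; apply/eqP.
rewrite dart_deg_sum natr_sum.
transitivity (\sum_y \sum_i z ord0 i * (on_edge i (x, y))%:R)%R.
  apply: eq_bigr => y _; have [/existsP[i iy]|no] := boolP [exists i, on_edge i (x, y)].
    rewrite (mem_darts_of z iy) (bigD1 i) //= iy mulr1 big1 ?addr0.
      by have [->//|n] := eqVneq (z ord0 i) 0%R; rewrite (F2_neq0 n).
    move=> j ji; case: (boolP (on_edge j _)) => [jy|_]; last by rewrite mulr0.
    by rewrite (on_edge_inj jy iy) eqxx in ji.
  rewrite big1 => [|i _].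
    case: (boolP (_ \in _)) => // ; rewrite inE => /existsP[i /andP[_ iy]].
    by case/existsP: no; exists i.
  by case: (boolP (on_edge i _)) => [iy|]; [case/existsP: no; exists i|rewrite mulr0].
rewrite exchange_big /=; apply: eq_bigr => i _; rewrite -big_distrr /=; congr (_ * _)%R.
have N := edge_ends_neq i; rewrite /inc.
have one (y : T) : (\sum_x (x == y)%:R = 1 :> 'F_2)%R.
  by rewrite (bigD1 y) //= eqxx big1 ?addr0 // => x' /negPf->.
rewrite /on_edge; case: (edge_ends i) N => a b /= ab.
under eq_bigr => y _ do rewrite !xpair_eqE.
have [->|xa] := eqVneq x a; last first.
  have [_|xb] := eqVneq x b; last by rewrite big1 ?addr0 // => y _.
  by rewrite /= add0r one.
by rewrite (negPf ab) /= addr0 -[RHS](one b); apply: eq_bigr => y _; rewrite orbF.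
Qed.

(** The two sides of an edge belong to at most two classes.  If their boundaries
    coincide, every edge of the common boundary separates just these two classes,
    which is [face_once]. *)
Theorem faces_of_winding : (exists x y, A x y) ->
  faces A [set darts_of z | z in boundaries].
Proof.
move=> Ane; set F := [set darts_of z | z in boundaries].
have FP D : D \in F -> exists phi, D = darts_of (boundary phi) /\ (boundary phi != 0)%R.
  by case/imsetP => z /imsetP[phi]; rewrite !inE => n0 -> ->; exists phi.
have bF phi i : (boundary phi ord0 i != 0)%R -> darts_of (boundary phi) \in F.
  move=> n0; apply/imset_f/imset_f; rewrite !inE /=.
  by apply: contraNneq n0 => ->; rewrite mxE.
have memF i p D : on_edge i p -> D \in F -> p \in D ->
    exists phi, D = darts_of (boundary phi) /\ (boundary phi ord0 i != 0)%R.
  move=> ip /FP[phi [-> _]]; rewrite (mem_darts_of _ ip) => n0; by exists phi.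
have Dsub D x y : D \in F -> (x, y) \in D -> A x y.
  by case/FP => phi [-> _]; rewrite inE => /existsP[i /andP[_ /on_edge_adj]].
have two i p D : on_edge i p -> D \in F -> p \in D ->
    D = darts_of (boundary (winding_class (side1 i))) \/
    D = darts_of (boundary (winding_class (side2 i))).
  move=> ip DF pD; have [phi [-> /boundary_neq0[_]]] := memF _ _ _ ip DF pD.
  by case=> ->; [left|right].
split.
- exact: Dsub.
- move=> D x y DF xy; have [i ixy] := on_edge_ex (Dsub _ _ _ DF xy).
  have iyx : on_edge i (y, x) by rewrite on_edge_sym.
  have [phi [DE n0]] := memF _ _ _ ixy DF xy.
  by rewrite DE (mem_darts_of _ iyx).
- move=> D /FP[phi [-> n0]]; have [i ni] : exists i, (boundary phi ord0 i != 0)%R.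
    apply/existsP; rewrite -negb_forall; apply: contra n0 => /forallP h.
    by apply/eqP/rowP => i; rewrite (eqP (h i)) mxE.
  by apply/set0Pn; exists (edge_ends i); rewrite (mem_darts_of _ (on_edge_ends i)).
- by move=> D x /FP[phi [-> _]]; apply: even_darts_of; apply: boundary_even.
- move=> [x y]; have [xy|xyN] := boolP (A x y); last first.
    rewrite (_ : cover_count F _ = 0) //; apply: eq_card0 => D; rewrite !inE.
    by apply/negP => /andP[DF /(Dsub _ _ _ DF)]; apply/negP.
  have [i ixy] := on_edge_ex xy.
  apply: leq_trans (_ : #|[set darts_of (boundary (winding_class (side1 i)));
                               darts_of (boundary (winding_class (side2 i)))]| <= 2).
    apply/subset_leq_card/subsetP => D; rewrite !inE => /andP[DF xyD].
    by case: (two _ _ _ ixy DF xyD) => ->; rewrite eqxx ?orbT.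
  by rewrite cards2; case: (_ != _).
- move=> D [x y] [x' y'] DF pD qD le1.
  have [i ip] := on_edge_ex (Dsub _ _ _ DF pD); have [j jq] := on_edge_ex (Dsub _ _ _ DF qD).
  have [phi [DE /boundary_neq0[nsi phiE]]] := memF _ _ _ ip DF pD.
  have [b1 b2] := boundary_sides nsi.
  have same D1 D2 : D1 \in F -> D2 \in F -> (x, y) \in D1 -> (x, y) \in D2 -> D1 = D2.
    move=> h1 h2 h3 h4; apply/eqP; apply: contraLR le1 => n12; rewrite -ltnNge.
    apply: leq_trans (_ : #|[set D1; D2]| <= _); first by rewrite cards2 n12.
    apply/subset_leq_card/subsetP => D'.
    by rewrite !inE => /orP[] /eqP->; rewrite ?h1 ?h2 ?h3 ?h4.
  have eD k : (boundary k ord0 i != 0)%R -> darts_of (boundary k) = D.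
    move=> n0; apply: same => //; first exact: bF n0.
    by rewrite (mem_darts_of _ ip).
  have e1 := eD _ b1; have e2 := eD _ b2.
  have j1 : (boundary (winding_class (side1 i)) ord0 j != 0)%R.
    by rewrite -(mem_darts_of _ jq) e1.
  have j2 : (boundary (winding_class (side2 i)) ord0 j != 0)%R.
    by rewrite -(mem_darts_of _ jq) e2.
  rewrite -(cards1 D); apply/subset_leq_card/subsetP => D'.
  rewrite !inE => /andP[D'F qD'].
  have [k [-> /boundary_neq0[nsj kE]]] := memF _ _ _ jq D'F qD'.
  have [_ h1] := boundary_neq0 j1; have [_ h2] := boundary_neq0 j2.
  by have [->|->] := two_values nsi h1 h2 kE; apply/eqP.
- rewrite card_darts_edges (card_imset _ darts_of_inj) -[X in _ + X <= _]muln1.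
  by rewrite -mulnDr leq_mul2l /=; apply: card_boundaries.
Qed.

End CycleSpace.

(** * Winding numbers in the square grid *)

Definition pixel : Type := (nat * nat)%type.
(** The edge with lower left end (i, j) goes up when the flag is true and to the
    right otherwise. *)
Definition gedge : Type := (pixel * bool)%type.

Definition gtail (g : gedge) : pixel := g.1.
Definition ghead (g : gedge) : pixel :=
  if g.2 then (g.1.1, g.1.2.+1) else (g.1.1.+1, g.1.2).

(** A square is named by its upper right corner; [gside1 g] and [gside2 g] are the
    two squares along [g]. *)
Definition gside1 (g : gedge) : pixel := ghead g.
Definition gside2 (g : gedge) : pixel := (g.1.1.+1, g.1.2.+1).

Definition gadj (p q : pixel) : bool :=
  ((p.1 == q.1) && ((p.2.+1 == q.2) || (q.2.+1 == p.2))) ||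
  ((p.2 == q.2) && ((p.1.+1 == q.1) || (q.1.+1 == p.1))).

Definition in_box N (p : pixel) : bool := (0 < p.1 < N) && (0 < p.2 < N).

Lemma gadjP p q : gadj p q ->
  exists g, (gtail g = p /\ ghead g = q) \/ (gtail g = q /\ ghead g = p).
Proof.
case: p q => a b [c d]; rewrite /gadj /=.
case/orP => /andP[/eqP-> /orP[] /eqP<-].
- by exists ((c, b), true); left.
- by exists ((c, d), true); right.
- by exists ((a, d), false); left.
- by exists ((c, d), false); right.
Qed.

Local Notation chain := (gedge -> 'F_2).

Definition bd (z : chain) (p : pixel) : 'F_2 :=
  (z (p, false) + z (p, true) + z ((p.1.-1, p.2), false) + z ((p.1, p.2.-1), true))%R.

Definition coboundary (chi : pixel -> 'F_2) : chain :=
  fun g => (chi (gside1 g) + chi (gside2 g))%R.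

(** The parity of the horizontal edges of [z] above the square, that is the number
    of crossings with a vertical ray. *)
Definition potential N (z : chain) (s : pixel) : 'F_2 :=
  (\sum_(s.2 <= j < N) z ((s.1.-1, j), false))%R.

Lemma bd_coboundary chi p : 0 < p.1 -> 0 < p.2 -> (bd (coboundary chi) p = 0)%R.
Proof.
case: p => [[|a] [|b]] // _ _; rewrite /bd /coboundary /gside1 /gside2 /ghead /=.
set x := chi (a.+2, b.+1); set y := chi (a.+2, b.+2); set u := chi (a.+1, b.+2).
set v := chi (a.+1, b.+1).
transitivity ((x + x) + (y + y) + (u + u) + (v + v))%R; first by ring.
by rewrite !addF2 ?addr0.
Qed.

Lemma telescope_F2 (v : nat -> 'F_2) j N : j <= N ->
  (\sum_(j.+1 <= k < N.+1) (v k + v k.-1) = v N + v j)%R.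
Proof.
elim: N => [|N IHN]; first by rewrite leqn0 => /eqP->; rewrite big_geq // addF2.
rewrite leq_eqVlt => /orP[/eqP->|jN]; first by rewrite big_geq // addF2.
rewrite big_nat_recr //= IHN // -[RHS]addr0 -(addF2 (v N)); ring.
Qed.

(** Across a horizontal edge the two rays differ in this edge.  Across a vertical
    edge the rays run on both sides of a column of pixels; the cycle condition at
    the pixels above makes the sum telescope to the edge itself. *)
Lemma potential_jump N (z : chain) :
  (forall g, (z g != 0)%R -> in_box N (gtail g) && in_box N (ghead g)) ->
  (forall p, in_box N p -> (bd z p = 0)%R) ->
  forall g, (potential N z (gside1 g) + potential N z (gside2 g) = z g)%R.
Proof.
move=> supp cyc; have z0 g : ~~ (in_box N (gtail g) && in_box N (ghead g)) -> z g = 0%R.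
  by move=> nb; apply/eqP; apply: contraR nb => /supp.
case=> [[i j] []]; rewrite /potential /gside1 /gside2 /ghead /=; last first.
  have [jN|jN] := ltnP j N; last first.
    rewrite !big_geq ?addr0 ?z0 //; last by lia.
    by rewrite /in_box /=; lia.
  by rewrite big_ltn // -addrA addF2 addr0.
case: i => [|i] /=.
  by rewrite addF2 z0 // /in_box /=; lia.
have [jN|jN] := ltnP j.+1 N; last first.
  by rewrite !big_geq // addr0 z0 // /in_box /=; lia.
rewrite -big_split /=.
case: N jN supp cyc z0 => // N jN supp cyc z0.
transitivity (\sum_(j.+1 <= k < N.+1) (z ((i.+1, k), true) + z ((i.+1, k.-1), true)))%R.
  apply: eq_big_nat => k /andP[jk kN].
  have : (bd z (i.+1, k) = 0)%R.
    have [iN|iN] := ltnP i.+1 N.+1; first by apply: cyc; rewrite /in_box /=; lia.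
    by rewrite /bd /= !z0 ?addr0 // /in_box /=; lia.
  rewrite /bd /= => e.
  set a := z (i, k, false) in e *; set b := z (i.+1, k, false) in e *.
  set c := z (i.+1, k, true) in e *; set d := z (i.+1, k.-1, true) in e *.
  have : (a + b + (b + c + a + d) = a + b)%R by rewrite e addr0.
  move<-; rewrite -[RHS]addr0 -(addF2 a) -[RHS]addr0 -(addF2 b); ring.
rewrite (telescope_F2 (fun k => z ((i.+1, k), true))); last by lia.
by rewrite z0 ?add0r // /in_box /=; lia.
Qed.

Lemma shift_sum N (u d : nat -> 'F_2) : u 0 = 0%R -> u N = 0%R ->
  (\sum_(a < N) u a * d a.-1 = \sum_(a < N) u a.+1 * d a)%R.
Proof.
case: N => [|N] u0 uN; first by rewrite !big_ord0.
rewrite big_ord_recl u0 mul0r add0r [RHS]big_ord_recr /= uN mul0r addr0.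
by apply: eq_bigr => a _; rewrite /bump leq0n.
Qed.

(** Discrete Stokes formula; [u] will be the indicator of the pixels of a vertex. *)
Lemma sum_by_parts N (u : pixel -> 'F_2) (d : chain) :
  (forall p, ~~ in_box N p -> u p = 0%R) ->
  (\sum_(a < N) \sum_(b < N) u (val a, val b) * bd d (val a, val b) =
   \sum_(a < N) \sum_(b < N) \sum_(c : bool)
     (u (gtail (val a, val b, c)) + u (ghead (val a, val b, c))) * d (val a, val b, c))%R.
Proof.
move=> u0.
have h1 : (\sum_(a < N) \sum_(b < N) u (val a, val b) * d ((val a).-1, val b, false) =
    \sum_(a < N) \sum_(b < N) u ((val a).+1, val b) * d (val a, val b, false))%R.
  rewrite exchange_big [RHS]exchange_big /=; apply: eq_bigr => b _.
  by apply: (shift_sum (u := fun a => u (a, val b)) (fun a => d (a, val b, false)));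
    apply: u0; rewrite /in_box /=; lia.
have h2 : (\sum_(a < N) \sum_(b < N) u (val a, val b) * d (val a, (val b).-1, true) =
    \sum_(a < N) \sum_(b < N) u (val a, (val b).+1) * d (val a, val b, true))%R.
  apply: eq_bigr => a _.
  by apply: (shift_sum (u := fun b => u (val a, b)) (fun b => d (val a, b, true)));
    apply: u0; rewrite /in_box /=; lia.
transitivity (\sum_(a < N) \sum_(b < N) (u (val a, val b) * d (val a, val b, false) +
   u (val a, val b) * d (val a, val b, true)) +
   \sum_(a < N) \sum_(b < N) u (val a, val b) * d ((val a).-1, val b, false) +
   \sum_(a < N) \sum_(b < N) u (val a, val b) * d (val a, (val b).-1, true))%R.
  rewrite -!big_split /=; apply: eq_bigr => a _; rewrite -!big_split /=.
  by apply: eq_bigr => b _; rewrite /bd /=; ring.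
rewrite h1 h2 -!big_split /=; apply: eq_bigr => a _; rewrite -!big_split /=.
apply: eq_bigr => b _; rewrite big_bool /gtail /ghead /=; ring.
Qed.

Definition unit_chain (g : gedge) : chain := fun g' => (g' == g)%:R%R.

Lemma bd_unit g p : 0 < p.1 -> 0 < p.2 ->
  (bd (unit_chain g) p = (p == gtail g)%:R + (p == ghead g)%:R)%R.
Proof.
case: g p => [[i j] c] [[|a] [|b]] // _ _; rewrite /bd /unit_chain /gtail /ghead /=.
by case: c; rewrite /= !xpair_eqE /= ?andbF ?andbT ?addr0 ?add0r ?eqSS.
Qed.

Lemma bd_add z1 z2 p : (bd (fun g => z1 g + z2 g) p = bd z1 p + bd z2 p)%R.
Proof. by rewrite /bd; ring. Qed.

Section GridModel.
Variables (T : finType) (A : rel T).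
Hypotheses (As : symmetric A) (Ai : irreflexive A).

(** A model of the graph as a minor of the grid: the pixels of colour [x] form a
    connected set, and adjacent vertices own neighbouring pixels. *)
Record grid_model N (col : pixel -> option T) : Prop := GridModel {
  gm_box : forall p, col p != None -> in_box N p;
  gm_seed : forall x, exists p, col p = Some x;
  gm_conn : forall x p q, col p = Some x -> col q = Some x ->
    exists s, [/\ path gadj p s, last p s = q & all (fun r => col r == Some x) s];
  gm_adj : forall x y, A x y -> exists p q, [/\ gadj p q, col p = Some x & col q = Some y]
}.

Variables (N : nat) (col : pixel -> option T).
Hypothesis gm : grid_model N col.

(** A path of pixels of one colour is a chain with the two ends as its boundary. *)
Lemma path_chain x p s : path gadj p s -> col p = Some x ->
  all (fun r => col r == Some x) s ->
  exists c : chain,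
    (forall r, in_box N r -> (bd c r = (r == p)%:R + (r == last p s)%:R)%R) /\
    (forall g, (c g != 0)%R -> col (gtail g) = Some x /\ col (ghead g) = Some x).
Proof.
elim: s p => [|q s IHs] p /=.
  move=> _ px _; exists (fun=> 0%R); split=> [r _|g]; last by rewrite eqxx.
  by rewrite /bd !addr0 addF2.
case/andP => pq qs px /andP[/eqP qx sx].
have [c [c1 c2]] := IHs _ qs qx sx; have [g gE] := gadjP pq.
exists (fun h => unit_chain g h + c h)%R; split=> [r rb|h].
  have /andP[/andP[r1 _] /andP[r2 _]] := rb.
  rewrite bd_add c1 // bd_unit //.
  have -> : ((r == gtail g)%:R + (r == ghead g)%:R = (r == p)%:R + (r == q)%:R :> 'F_2)%R.
    by case: gE => -[-> ->]; rewrite // addrC.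
  by rewrite -addrA (addrA (_ == q)%:R)%R addF2 add0r.
have [->|hg] := eqVneq h g; first by case: gE => -[-> ->].
by rewrite /unit_chain (negPf hg) add0r; apply: c2.
Qed.

(** Lift an edge xy to a path from a base pixel of x to one of y which leaves the
    pixels of x and y only through one chosen grid edge.  Lifts of even subgraphs
    are cycles, so they have winding numbers.  These are constant across grid
    edges which are not chosen and do not join pixels of the same colour; hence
    in the sum over the pixels of x of the coboundary of a union of classes only
    the chosen edges at x survive, and the boundary of a class is even. *)
Lemma grid_faces : (exists x y, A x y) -> exists F, faces A F.
Proof.
move=> Ane.
have [r rP] := fin_all_exists (gm_seed gm).
pose joins (i : 'I_#|oriented_edges A|) (g : gedge) :=
  (col (gtail g) = Some (edge_ends i).1 /\ col (ghead g) = Some (edge_ends i).2) \/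
  (col (gtail g) = Some (edge_ends i).2 /\ col (ghead g) = Some (edge_ends i).1).
have [ge gP] : exists ge, forall i : 'I_#|oriented_edges A|, joins i (ge i).
  apply: (fin_all_exists (U := fun _ => gedge)) => i; have [h _] := edge_endsP i.
  have [p [q [pq px qy]]] := gm_adj gm h; have [g gE] := gadjP pq.
  by exists g; rewrite /joins; case: gE => -[-> ->]; [left|right].
have ge_inj : injective ge.
  move=> i j e; have [_ li] := edge_endsP i; have [_ lj] := edge_endsP j.
  apply: enum_val_inj; rewrite -/(edge_ends i) -/(edge_ends j).
  have hi := gP i; have hj := gP j; rewrite /joins e in hi; rewrite /joins in hj.
  move: li lj hi hj; case: (edge_ends i) (edge_ends j) => a b [c d] /= li lj.
  by case=> -[-> ->] [] -[[ac] [bd]]; subst => //; lia.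
have ge_ext i : col (gtail (ge i)) != col (ghead (ge i)).
  have := edge_ends_neq Ai i; have := gP i.
  by case=> -[-> ->] ne; apply: contra_neq ne => -[].
pose lifts (i : 'I_#|oriented_edges A|) (c : chain) := [/\
    forall p, in_box N p ->
      (bd c p = (p == r (edge_ends i).1)%:R + (p == r (edge_ends i).2)%:R)%R,
    forall g, (c g != 0)%R -> g = ge i \/
      (col (gtail g) != None /\ col (gtail g) = col (ghead g)) &
    c (ge i) = 1%R].
have [pi piP] : exists pi, forall i, lifts i (pi i).
  apply: (fin_all_exists (U := fun _ => chain)) => i.
  have [p [q [px qy pqE]]] : exists p q, [/\ col p = Some (edge_ends i).1,
      col q = Some (edge_ends i).2 &
      (gtail (ge i) = p /\ ghead (ge i) = q) \/ (gtail (ge i) = q /\ ghead (ge i) = p)].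
    case: (gP i) => -[h1 h2].
      by exists (gtail (ge i)), (ghead (ge i)); split=> //; left.
    by exists (ghead (ge i)), (gtail (ge i)); split=> //; right.
  have [s1 [ps1 l1 a1]] := gm_conn gm (rP _) px.
  have [s2 [ps2 l2 a2]] := gm_conn gm qy (rP _).
  have [c1 [b1 sp1]] := path_chain ps1 (rP _) a1.
  have [c2 [b2 sp2]] := path_chain ps2 qy a2.
  have zero (c : chain) x : (forall g, (c g != 0)%R -> col (gtail g) = Some x /\ col (ghead g) = Some x) ->
      c (ge i) = 0%R.
    move=> sp; apply/eqP; apply: contraNT (ge_ext i) => /sp[-> ->]; exact: eqxx.
  exists (fun g => c1 g + (unit_chain (ge i) g + c2 g))%R; split.
  - move=> t tb; have /andP[/andP[t1 _] /andP[t2 _]] := tb.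
    rewrite !bd_add b1 // b2 // l1 l2 bd_unit //.
    have -> : ((t == gtail (ge i))%:R + (t == ghead (ge i))%:R = (t == p)%:R + (t == q)%:R :> 'F_2)%R.
      by case: pqE => -[-> ->]; rewrite // addrC.
    set a := (t == r _)%:R%R; set b := (t == p)%:R%R; set c := (t == q)%:R%R; set d := (t == r _)%:R%R.
    transitivity (a + d + (b + b) + (c + c))%R; first by ring.
    by rewrite !addF2 ?addr0.
  - move=> g; have [->|gi] := eqVneq g (ge i); first by left.
    rewrite /unit_chain (negPf gi) add0r => n0; right.
    have [e1|/sp1[-> ->]//] := eqVneq (c1 g) 0%R.
    by move: n0; rewrite e1 add0r => /sp2[-> ->].
  - by rewrite (zero _ _ sp1) (zero _ _ sp2) /unit_chain eqxx add0r addr0.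
pose lift (z : 'rV['F_2]_#|oriented_edges A|) : chain :=
  fun g => (\sum_i z ord0 i * pi i g)%R.
have lift_ge z i : lift z (ge i) = z ord0 i.
  rewrite /lift (bigD1 i) //= big1 ?addr0; first by have [_ _ ->] := piP i; rewrite mulr1.
  move=> j ji; have [_ sp _] := piP j.
  have [->|/sp[/ge_inj e|[_ e]]] := eqVneq (pi j (ge i)) 0%R; first by rewrite mulr0.
    by rewrite e eqxx in ji.
  by have := ge_ext i; rewrite e eqxx.
have lift0 z g : (forall i, g != ge i) -> ~~ ((col (gtail g) != None) && (col (gtail g) == col (ghead g))) ->
    lift z g = 0%R.
  move=> nge nint; rewrite /lift big1 // => i _; have [_ sp _] := piP i.
  have [->|/sp[e|[e1 e2]]] := eqVneq (pi i g) 0%R; first by rewrite mulr0.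
    by have := nge i; rewrite e eqxx.
  by move: nint; rewrite e1 e2 eqxx.
have lift_supp z g : (lift z g != 0)%R -> in_box N (gtail g) && in_box N (ghead g).
  move=> n0; have [/existsP[i /eqP->]|noi] := boolP [exists i, g == ge i].
    by case: (gP i) => -[h1 h2]; rewrite !(gm_box gm) ?h1 ?h2.
  have [/andP[h1 /eqP h2]|h] := boolP ((col (gtail g) != None) && (col (gtail g) == col (ghead g))).
    by rewrite !(gm_box gm) // -h2.
  move: n0; rewrite lift0 ?eqxx // => i; apply: contra noi => e.
  by apply/existsP; exists i.
have lift_cycle z : even_vec z -> forall p, in_box N p -> (bd (lift z) p = 0)%R.
  move=> /even_vecP ez p pb.
  transitivity (\sum_i z ord0 i * bd (pi i) p)%R.
    by rewrite /bd /lift -!big_split /=; apply: eq_bigr => i _; rewrite !mulrDr.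
  transitivity (\sum_x (p == r x)%:R * \sum_i z ord0 i * inc x i)%R; last first.
    by rewrite big1 // => x _; rewrite ez mulr0.
  under [RHS]eq_bigr => x _ do rewrite big_distrr /=.
  rewrite exchange_big /=; apply: eq_bigr => i _; have [-> // _ _] := piP i.
  have one y : (\sum_x (p == r x)%:R * (x == y)%:R = (p == r y)%:R :> 'F_2)%R.
    rewrite (bigD1 y) //= eqxx mulr1 big1 ?addr0 // => x /negPf->.
    by rewrite mulr0.
  rewrite -!one -big_split big_distrr /=; apply: eq_bigr => x _.
  by rewrite /inc; ring.
exists [set darts_of z | z in boundaries (fun i => gside1 (ge i)) (fun i => gside2 (ge i))
  (fun z => potential N (lift z))].
apply: faces_of_winding => //.
  by move=> z ez i; rewrite (potential_jump (lift_supp z) (lift_cycle z ez)) lift_ge.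
move=> chi chiP; apply/even_vecP => x.
pose u p : 'F_2 := (col p == Some x)%:R%R.
have ubox p : ~~ in_box N p -> u p = 0%R.
  by move=> pN; rewrite /u; case: eqP => // e; move: pN; rewrite (gm_box gm) // e.
have := sum_by_parts (coboundary chi) ubox.
rewrite [LHS]big1 => [|a _]; last first.
  rewrite big1 // => b _; have [pb|pb] := boolP (in_box N (val a, val b)); last first.
    by rewrite ubox // mul0r.
  have /andP[/andP[a0 _] /andP[b0 _]] := pb.
  by rewrite bd_coboundary // mulr0.
move=> /esym e0; rewrite -[RHS]e0.
have term g : ((u (gtail g) + u (ghead g)) * coboundary chi g =
    \sum_i if g == ge i then inc x i * coboundary chi (ge i) else 0)%R.
  have [/existsP[i /eqP gi]|noi] := boolP [exists i, g == ge i].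
    rewrite gi (bigD1 i) //= eqxx big1 ?addr0; last first.
      by move=> j ji; case: eqP => // /ge_inj ij; rewrite ij eqxx in ji.
    congr (_ * _)%R; rewrite /u /inc.
    by case: (gP i) => -[-> ->]; rewrite !(inj_eq Some_inj) ![_ == x]eq_sym // addrC.
  rewrite big1 => [|i _]; last first.
    by case: eqP => // gi; case/existsP: noi; exists i; apply/eqP.
  have [h|h] := boolP ((col (gtail g) != None) && (col (gtail g) == col (ghead g))).
    by case/andP: h => _ /eqP h; rewrite /u h addF2 mul0r.
  rewrite /coboundary (chiP (gside1 g) (gside2 g)) ?addF2 ?mulr0 // => z ez.
  have := potential_jump (lift_supp z) (lift_cycle z ez) g.
  rewrite lift0 // => [/eqP|i]; last first.
    by apply: contra noi => /eqP->; apply/existsP; exists i.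
  by rewrite addr_eq0 => /eqP->; rewrite oppr_pchar2 // pchar_Fp.
transitivity (\sum_(a < N) \sum_(b < N) \sum_(c : bool) \sum_i
   if (val a, val b, c) == ge i then inc x i * coboundary chi (ge i) else 0)%R; last first.
  by apply: eq_bigr => a _; apply: eq_bigr => b _; apply: eq_bigr => c _; rewrite term.
under [RHS]eq_bigr => a _ do (under eq_bigr => b _ do rewrite exchange_big; rewrite exchange_big).
rewrite [RHS]exchange_big /=; apply: eq_bigr => i _.
have [ib1 ib2] : (ge i).1.1 < N /\ (ge i).1.2 < N.
  have : in_box N (gtail (ge i)) by apply: (gm_box gm); case: (gP i) => -[-> _].
  by case/andP => /andP[_ ?] /andP[_ ?].
rewrite mxE mulrC -/(coboundary chi (ge i)); case: (ge i) ib1 ib2 => [[a0 b0] c0] /= a0N b0N.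
rewrite (bigD1 (Ordinal a0N)) //= (bigD1 (Ordinal b0N)) //= (bigD1 c0) //= eqxx.
rewrite !big1 ?addr0 //.
- by move=> a an; rewrite big1 // => b _; rewrite big1 // => c _; rewrite !xpair_eqE -[_ == a0]/(a == Ordinal a0N) (negPf an).
- by move=> b bn; rewrite big1 // => c _; rewrite !xpair_eqE -[_ == b0]/(b == Ordinal b0N) (negPf bn) andbF.
- by move=> c cn; rewrite xpair_eqE (negPf cn) andbF.
Qed.

End GridModel.

(** * From pixel walks to models in the grid *)

(** The square of side 2 r + 1 around [c]. *)
Definition near_pixel r (c p : pixel) : bool :=
  [&& c.1 <= p.1 + r, p.1 <= c.1 + r, c.2 <= p.2 + r & p.2 <= c.2 + r].

Definition stays_or_steps (p q : pixel) : bool := (p == q) || gadj p q.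

Lemma gadjC : symmetric gadj.
Proof. by move=> [a b] [c d]; rewrite /gadj /= ![_ == a]eq_sym ![_ == b]eq_sym; lia. Qed.

Definition linked (B : pred pixel) (p q : pixel) : Prop :=
  exists s, [/\ path gadj p s, last p s = q & all B s].

Lemma linked_refl (B : pred pixel) p : linked B p p. Proof. by exists [::]. Qed.

Lemma linked_trans (B : pred pixel) p q r : linked B p q -> linked B q r -> linked B p r.
Proof.
case=> s [ps ls as_] [t [pt lt at_]]; exists (s ++ t).
by rewrite cat_path ps ls last_cat ls all_cat as_ at_; split.
Qed.

Lemma linked_step (B : pred pixel) p q : stays_or_steps p q -> B q -> linked B p q.
Proof.
case/orP => [/eqP-> _|pq Bq]; first exact: linked_refl.
by exists [:: q]; rewrite /= pq Bq.
Qed.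

Lemma linked_sym (B : pred pixel) p q : B p -> linked B p q -> linked B q p.
Proof.
move=> Bp [s [ps <- as_]]; elim: s p Bp ps as_ => [|t s IHs] p Bp /=.
  by move=> _ _; apply: linked_refl.
case/andP => pt ps /andP[Bt as_]; apply: linked_trans (IHs t Bt ps as_) _.
by apply: linked_step => //; rewrite /stays_or_steps gadjC pt orbT.
Qed.

Lemma linked_mono (B C : pred pixel) p q : (forall t, B t -> C t) -> linked B p q -> linked C p q.
Proof. by move=> BC [s [ps ls as_]]; exists s; split=> //; apply: sub_all as_. Qed.

Lemma linked_square r c p : near_pixel r c p -> linked (near_pixel r c) p c.
Proof.
case: p c => a b [x y]; rewrite /near_pixel /=.
have [n] := ubnP ((a - x) + (x - a) + ((b - y) + (y - b))).
elim: n a b => // n IHn a b ltn /and4P[h1 h2 h3 h4].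
have step a' b' : near_pixel r (x, y) (a', b') -> gadj (a, b) (a', b') ->
    (a' - x) + (x - a') + ((b' - y) + (y - b')) < n ->
    linked (near_pixel r (x, y)) (a, b) (x, y).
  move=> nb st lt; apply: linked_trans (IHn a' b' lt nb).
  by apply: linked_step => //; rewrite /stays_or_steps st orbT.
case: (ltngtP a x) => ax; last first.
- case: (ltngtP b y) => yb; last by rewrite ax yb; apply: linked_refl.
    by apply: (step a b.+1); rewrite /near_pixel /gadj /=; lia.
  by apply: (step a b.-1); rewrite /near_pixel /gadj /=; lia.
- by apply: (step a.-1 b); rewrite /near_pixel /gadj /=; lia.
- by apply: (step a.+1 b); rewrite /near_pixel /gadj /=; lia.
Qed.

Section DiscreteDrawing.
Variables (T E : finType) (A : rel T) (fst_end snd_end : E -> T).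
Variables (r : nat) (c : T -> pixel) (walk_start : E -> pixel) (walk : E -> seq pixel).

Let route e := walk_start e :: walk e.

Hypothesis ends_edge : forall x y, A x y -> exists e,
  (fst_end e = x /\ snd_end e = y) \/ (fst_end e = y /\ snd_end e = x).
Hypothesis ends_neq : forall e, fst_end e != snd_end e.
Hypothesis centre_far : forall x, r < (c x).1 /\ r < (c x).2.
Hypothesis squares_disjoint : forall x y (p : pixel), near_pixel r (c x) p -> near_pixel r (c y) p -> x = y.
Hypothesis walk_path : forall e, path stays_or_steps (walk_start e) (walk e).
Hypothesis walk_first : forall e, near_pixel r (c (fst_end e)) (walk_start e).
Hypothesis walk_last : forall e, near_pixel r (c (snd_end e)) (last (walk_start e) (walk e)).
Hypothesis walk_pos : forall e (p : pixel), p \in route e -> 0 < p.1 /\ 0 < p.2.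
Hypothesis walks_disjoint : forall e e' (p : pixel), p \in route e -> p \in route e' -> e = e'.
Hypothesis walk_avoids : forall e x (p : pixel), p \in route e -> near_pixel r (c x) p ->
  x = fst_end e \/ x = snd_end e.

Let arrival e := find (near_pixel r (c (snd_end e))) (route e).

Let prefix e := take (arrival e) (route e).

Let blob x (p : pixel) := near_pixel r (c x) p || [exists e, (fst_end e == x) && (p \in prefix e)].

Let prefix_route e (p : pixel) : p \in prefix e -> p \in route e.
Proof. by move=> h; apply: mem_take h. Qed.

Let prefix_before e (p : pixel) : p \in prefix e -> ~~ near_pixel r (c (snd_end e)) p.
Proof.
move=> pe; apply/negP => np; have := pe; rewrite /prefix => /(nthP (0, 0))[i].
rewrite size_take_min leq_min => /andP[ilt _]; rewrite nth_take // => pE.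
by have := before_find (0, 0) ilt; rewrite pE np.
Qed.

Let blob_uniq x y (p : pixel) : blob x p -> blob y p -> x = y.
Proof.
have mixed x' y' : near_pixel r (c x') p -> forall e, fst_end e == y' -> p \in prefix e -> x' = y'.
  move=> nx e /eqP<- pe; case: (walk_avoids (prefix_route pe) nx) => // xE.
  by have := prefix_before pe; rewrite -xE nx.
case/orP => [nx|/existsP[e /andP[ex pe]]]; case/orP => [ny|/existsP[e' /andP[ey pe']]].
- exact: squares_disjoint nx ny.
- exact: mixed nx _ ey pe'.
- exact/esym/(mixed _ _ ny _ ex pe).
- by rewrite -(eqP ex) -(eqP ey) (walks_disjoint (prefix_route pe) (prefix_route pe')).
Qed.

Let arrival_lt e : arrival e < size (route e).
Proof. by rewrite -has_find; apply/hasP; exists (last (walk_start e) (walk e)); rewrite ?mem_last. Qed.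

Let arrival_gt0 e : 0 < arrival e.
Proof.
rewrite /arrival /route /=; case: ifP => // h.
by have := squares_disjoint (walk_first e) h; move/eqP; rewrite (negPf (ends_neq e)).
Qed.

Let route_step e i : i.+1 < size (route e) ->
  stays_or_steps (nth (0, 0) (route e) i) (nth (0, 0) (route e) i.+1).
Proof. by rewrite ltnS => lt; have /(pathP (0, 0)) := walk_path e; apply. Qed.

Let prefix_linked e i : i < arrival e -> linked (blob (fst_end e)) (c (fst_end e)) (nth (0, 0) (route e) i).
Proof.
have inB j : j < arrival e -> blob (fst_end e) (nth (0, 0) (route e) j).
  move=> lt; apply/orP; right; apply/existsP; exists e; rewrite eqxx /=.
  rewrite /prefix -(nth_take _ lt) mem_nth // size_take_min leq_min lt.
  exact: ltn_trans lt (arrival_lt e).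
elim: i => [|i IHi] lt.
  apply: linked_sym; first by apply/orP; left; apply: walk_first.
  apply: linked_mono (linked_square (walk_first e)) => t nt.
  by apply/orP; left.
apply: linked_trans (IHi (ltnW lt)) (linked_step _ (inB _ lt)).
by apply: route_step; apply: ltn_trans lt (arrival_lt e).
Qed.

Let near_centre x : near_pixel r (c x) (c x).
Proof. by rewrite /near_pixel !leq_addr. Qed.

Let blob_linked x p : blob x p -> linked (blob x) (c x) p.
Proof.
case/orP => [np|/existsP[e /andP[/eqP<- pe]]].
  apply: linked_sym; first by apply/orP; left.
  by apply: linked_mono (linked_square np) => t nt; apply/orP; left.
have /(nthP (0, 0))[i] := pe; rewrite size_take_min leq_min => /andP[lt _].
by rewrite nth_take // => <-; apply: prefix_linked.
Qed.

Let bound := (\sum_x ((c x).1 + (c x).2 + r) + \sum_e \sum_(p <- route e) (p.1 + p.2)).+1.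

Let blob_box x (p : pixel) : blob x p -> in_box bound p.
Proof.
case/orP => [|/existsP[e /andP[_ pe]]].
  have [c1 c2] := centre_far x.
  have : (c x).1 + (c x).2 + r < bound.
    by rewrite /bound ltnS (bigD1 x) //=; apply: leq_trans (leq_addr _ _) (leq_addr _ _).
  by rewrite /near_pixel /in_box => ? /and4P[*]; lia.
have pr := prefix_route pe; have [p1 p2] := walk_pos pr.
have : p.1 + p.2 < bound.
  rewrite /bound ltnS [X in _ <= _ + X](bigD1 e) //= (big_rem p) //=.
  by apply: leq_trans (leq_addl _ _); apply: leq_trans (leq_addr _ _) (leq_addr _ _).
rewrite /in_box => lt; rewrite p1 p2 !(leq_ltn_trans _ lt) ?leq_addr ?leq_addl //.
Qed.

(** A vertex x owns its square and, for the edges oriented away from x, the part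
    of the walk before it first meets the square of the other end. *)
Lemma discrete_drawing : exists N col, @grid_model T A N col.
Proof.
exists bound, (fun p => [pick x | blob x p]).
have colP x p : ([pick x | blob x p] = Some x) <-> blob x p.
  case: pickP => [y By|no]; last by split=> //; rewrite no.
  by split=> [[<-]//|Bx]; rewrite (blob_uniq Bx By).
split.
- by move=> p; case: pickP => // x /blob_box.
- by move=> x; exists (c x); apply/colP/orP; left; apply: near_centre.
- move=> x p q /colP Bp /colP Bq.
  have [s [ps ls as_]] : linked (blob x) p q.
    apply: linked_trans (linked_sym _ (blob_linked Bp)) (blob_linked Bq).
    by apply/orP; left; apply: near_centre.
  exists s; split=> //; apply: sub_all as_ => t Bt; apply/eqP; exact/colP.
move=> x y /ends_edge[e ends].
have gt0 := arrival_gt0 e; have lt := arrival_lt e.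
pose p := nth (0, 0) (route e) (arrival e).-1; pose q := nth (0, 0) (route e) (arrival e).
have pin : p \in prefix e.
  have lt1 : (arrival e).-1 < arrival e by lia.
  rewrite /p -(nth_take _ lt1) mem_nth // size_take_min leq_min lt1.
  exact: ltn_trans lt1 lt.
have Bp : blob (fst_end e) p by apply/orP; right; apply/existsP; exists e; rewrite eqxx.
have nq : near_pixel r (c (snd_end e)) q by apply: nth_find; rewrite has_find.
have Bq : blob (snd_end e) q by apply/orP; left.
have pq : gadj p q.
  have : stays_or_steps p q by rewrite /p /q -{2}(prednK gt0); apply: route_step; rewrite prednK.
  case/orP => // /eqP pqE; have := prefix_before pin; by rewrite pqE nq.
case: ends => -[<- <-]; first by exists p, q; split=> //; apply/colP.
by exists q, p; split; [rewrite gadjC|apply/colP|apply/colP].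
Qed.

End DiscreteDrawing.

Lemma near_pixel_sym r p q : near_pixel r p q = near_pixel r q p.
Proof. by rewrite /near_pixel; lia. Qed.

Lemma near_pixel_trans r r' p q s :
  near_pixel r p q -> near_pixel r' q s -> near_pixel (r + r') p s.
Proof. by rewrite /near_pixel; lia. Qed.

(** A diagonal move between consecutive samples is replaced by two steps. *)
Lemma sample_walk (q : nat -> pixel) K :
  (forall k, k < K -> near_pixel 1 (q k) (q k.+1)) ->
  exists s, [/\ path stays_or_steps (q 0) s, last (q 0) s = q K &
    forall p, p \in q 0 :: s -> exists2 k, k <= K & near_pixel 1 (q k) p].
Proof.
elim: K => [|K IHK] near1.
  exists [::]; split=> // p; rewrite inE => /eqP->; exists 0 => //.
  by rewrite /near_pixel; lia.
have [|s [ps ls ms]] := IHK; first by move=> k lt; apply: near1; apply: leqW.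
have := near1 K (leqnn _); rewrite /near_pixel => nK.
exists (s ++ [:: ((q K.+1).1, (q K).2); q K.+1]); split.
- rewrite cat_path ps ls /= andbT /stays_or_steps /gadj.
  by move: nK; case: (q K) (q K.+1) => a b [c d] /= nK; rewrite !xpair_eqE; lia.
- by rewrite last_cat.
move=> p; rewrite -cat_cons mem_cat => /orP[/ms[k kK nk]|].
  by exists k => //; apply: leqW.
rewrite !inE => /orP[] /eqP->; exists K => //; rewrite /near_pixel /=;
  by move: nK; case: (q K) (q K.+1) => a b [c d] /=; lia.
Qed.

Lemma near_pixel_pos q p : near_pixel 1 q p -> 1 < q.1 -> 1 < q.2 -> 0 < p.1 /\ 0 < p.2.
Proof. by rewrite /near_pixel => h h1 h2; lia. Qed.

Lemma squares_too_far m : 1 < m -> ~ 4 * m <= m.+1 + m.+1.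
Proof. by lia. Qed.

Lemma walk_too_far m : 1 < m -> ~ 4 * m <= m.+1 + 1.
Proof. by lia. Qed.

(** * No minimal counterexample in a grid model *)

Lemma grid_model_sub (T : finType) (A B : rel T) N col :
  subrel B A -> @grid_model T A N col -> grid_model B N col.
Proof. by move=> BA [h1 h2 h3 h4]; split=> // x y /BA; apply: h4. Qed.

(** A smallest pair without a labelling would be critical, and its graph A would
    have faces as a subgraph of the grid model, which [discharging] excludes. *)
Lemma grid_labellable (T : finType) (M : nat) (A0 : rel T) N col :
  12 <= M -> irreflexive A0 -> (forall x, deg A0 x <= M) -> grid_model A0 N col ->
  forall A H : rel T, symmetric A -> symmetric H -> subrel A A0 -> subrel H A ->
  labellable M A H.
Proof.
move=> M12 irr0 deg0 gm A H.
have [n] := ubnP (#|[set p | A p.1 p.2]| + #|[set p | H p.1 p.2]|).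
elim: n A H => // n IHn A H ltn As Hs sA HA.
apply: boolp.contrapT => nolab.
have sub_card (B C : rel T) : subrel B C -> #|[set p | B p.1 p.2]| <= #|[set p | C p.1 p.2]|.
  by move=> BC; apply/subset_leq_card/subsetP => p; rewrite !inE; apply: BC.
have lt_card (B C : rel T) x y : subrel B C -> C x y -> ~~ B x y ->
    #|[set p | B p.1 p.2]| < #|[set p | C p.1 p.2]|.
  move=> BC xy xyN; apply/proper_card; rewrite properE; apply/andP; split.
    by apply/subsetP => p; rewrite !inE; apply: BC.
  by apply/subsetPn; exists (x, y); rewrite inE.
have irr : irreflexive A.
  by move=> x; apply/negP => /sA; rewrite irr0.
have crit : critical M A H.
  split=> // [x|A' H' A's H's sA' sH' HA' [x [y]]].
    by apply: leq_trans (deg0 x); apply/subset_leq_card/subsetP => y; rewrite !inE; apply: sA.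
  have := sub_card _ _ sA'; have := sub_card _ _ sH' => leH leA dropped.
  apply: IHn => //; last by move=> u v /sA'; apply: sA.
  by case/orP: dropped => /andP[h1 h2]; [have := lt_card _ _ _ _ sA' h1 h2|have := lt_card _ _ _ _ sH' h1 h2]; lia.
have [/existsP[x /existsP[y xy]]|noedge] := boolP [exists x, exists y, A x y].
  have [|F faceF] := grid_faces As irr (grid_model_sub sA gm); first by exists x, y.
  exact: discharging M12 crit faceF.
have noA x y : A x y = false.
  by apply/negP => xy; case/existsP: noedge; exists x; apply/existsP; exists y.
have c0 : 'I_(M + 3) by exists 0; rewrite addn3.
apply: nolab; exists (fun=> c0), (fun _ _ => c0).
by split=> // [x y|x y z /HA|x y /HA]; rewrite noA.
Qed.

(** * Compactness of arcs *)

From mathcomp Require Import all_classical all_reals all_analysis.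
Import Order.TTheory Num.Theory.
Import numFieldNormedType.Exports.

Section PlaneDrawings.
Local Open Scope ring_scope.
Local Open Scope classical_set_scope.

Section Compactness.
Variable R : realType.

(** Distances are measured in the maximum norm. *)
Definition close (d : R) (p q : R * R) : Prop := `|p.1 - q.1| < d /\ `|p.2 - q.2| < d.

Definition unit_continuous (f : R -> R * R) : Prop :=
  forall x, 0 <= x <= 1 -> forall eps, 0 < eps ->
  exists2 d : R, 0 < d & forall t, 0 <= t <= 1 -> `|x - t| < d -> close eps (f x) (f t).

Lemma within_unit_continuous (f : R -> R * R) : {within `[0, 1], continuous f} -> unit_continuous f.
Proof.
move=> /subspace_continuousP cf x x01 eps e0.
have /cf : `[0, 1]%classic x by rewrite /= in_itv.
move=> /(_ _ (nbhsx_ballx (f x) eps e0)) /nbhs_ballP[d /= d0 h].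
exists d => // t t01 xt; have := h t xt; rewrite /= in_itv /= t01 => /(_ isT).
by case.
Qed.

(** A property of points and scales which is local and inherited by smaller scales
    holds on the whole unit interval at some scale. *)
Lemma unit_compactness (P : R -> R -> Prop) :
  (forall d d' t : R, 0 < d' -> d' <= d -> P d t -> P d' t) ->
  (forall t : R, 0 <= t <= 1 -> exists2 rho : R, 0 < rho &
     forall t' : R, 0 <= t' <= 1 -> `|t - t'| < rho -> P rho t') ->
  exists2 d : R, 0 < d & forall t, 0 <= t <= 1 -> P d t.
Proof.
move=> mono loc.
have /compact_near_coveringP/near_covering_withinP cover := @segment_compact R 0 1.
have nr : \forall d \near 0^'+, `[0, 1]%classic `<=` P d.
  apply: cover => t; rewrite /= in_itv /= => t01; have [rho rho0 h] := loc t t01.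
  exists (ball t rho, [set d | 0 < d <= rho]) => /=.
    split; first exact: nbhsx_ballx.
    by near=> d; apply/andP; split; near: d; [exact: nbhs_right_gt|exact: nbhs_right_le].
  move=> [t' d] /= [tt' /andP[d0 dr]]; rewrite in_itv /= => t'01.
  exact: mono (h t' t'01 tt').
near (0 : R)^'+ => d; exists d; first by near: d; exact: nbhs_right_gt.
move=> t t01.
have : `[0, 1]%classic `<=` P d by near: d; exact: nr.
by apply; rewrite /= in_itv.
Unshelve. all: by end_near.
Qed.

Lemma fin_positive (I : finType) (P : R -> I -> Prop) :
  (forall (d d' : R) i, 0 < d' -> d' <= d -> P d i -> P d' i) ->
  (forall i, exists2 d, 0 < d & P d i) -> exists2 d : R, 0 < d & forall i, P d i.
Proof.
move=> mono loc; have [f f0 fP] := fin_all_exists2 loc.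
exists (\big[Num.min/1]_i f i).
  by elim/big_ind: _ => // x y x0 y0; rewrite lt_min x0 y0.
move=> i; apply: mono (fP i); last by rewrite (bigD1 i) //= ge_min lexx.
by elim/big_ind: _ => // x y x0 y0; rewrite lt_min x0 y0.
Qed.

Lemma close_le d d' p q : d' <= d -> close d' p q -> close d p q.
Proof. by move=> le [h1 h2]; split; apply: lt_le_trans le. Qed.

Lemma close_sym d p q : close d p q -> close d q p.
Proof. by case=> h1 h2; split; rewrite distrC. Qed.

Lemma close_trans d d' p q r : close d p q -> close d' q r -> close (d + d') p r.
Proof.
move=> [h1 h2] [h3 h4]; split.
  by apply: le_lt_trans (ler_distD q.1 _ _) _; apply: ltrD.
by apply: le_lt_trans (ler_distD q.2 _ _) _; apply: ltrD.
Qed.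

Lemma not_close_ex p q : p <> q -> exists2 d, 0 < d & ~ close d p q.
Proof.
move=> pq; have [e1|n1] := eqVneq p.1 q.1; last first.
  by exists `|p.1 - q.1|; [rewrite normr_gt0 subr_eq0|move=> []; rewrite ltxx].
have [e2|n2] := eqVneq p.2 q.2; last first.
  by exists `|p.2 - q.2|; [rewrite normr_gt0 subr_eq0|move=> [_]; rewrite ltxx].
by case: pq; rewrite (surjective_pairing p) (surjective_pairing q) e1 e2.
Qed.

Lemma point_separated p f : unit_continuous f ->
  (forall t, 0 <= t <= 1 -> p <> f t) ->
  exists2 d : R, 0 < d & forall t, 0 <= t <= 1 -> ~ close d p (f t).
Proof.
move=> cf ne; apply: unit_compactness => [d d' t _ le nc /(close_le le)//|t t01].
have [d d0 nc] := not_close_ex (ne t t01).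
have d20 : 0 < d / 2 by rewrite divr_gt0.
have [rho rho0 h] := cf t t01 _ d20.
exists (Num.min rho (d / 2)); first by rewrite lt_min rho0.
move=> t' t'01; rewrite lt_min => /andP[tt' _] pt'; apply: nc.
rewrite [d]splitr; apply: close_trans (close_sym (h t' t'01 tt')).
by apply: close_le pt'; rewrite ge_min lexx orbT.
Qed.

Lemma arcs_separated f g : unit_continuous f -> unit_continuous g ->
  (forall s t, 0 <= s <= 1 -> 0 <= t <= 1 -> f s <> g t) ->
  exists2 d : R, 0 < d & forall s t, 0 <= s <= 1 -> 0 <= t <= 1 -> ~ close d (f s) (g t).
Proof.
move=> cf cg ne.
have [|s s01|d d0 h] := @unit_compactness (fun d s => forall t, 0 <= t <= 1 -> ~ close d (f s) (g t)).
- by move=> d d' s _ le h t t01 /(close_le le); apply: h.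
- have [d d0 nc] := point_separated cg (fun t => ne s t s01).
  have d20 : 0 < d / 2 by rewrite divr_gt0.
  have [rho rho0 h] := cf s s01 _ d20.
  exists (Num.min rho (d / 2)); first by rewrite lt_min rho0.
  move=> s' s'01; rewrite lt_min => /andP[ss' _] t t01 st; apply: (nc t t01).
  rewrite [d]splitr; apply: close_trans (h s' s'01 ss') _.
  by apply: close_le st; rewrite ge_min lexx orbT.
- by exists d => // s t s01 t01; apply: h.
Qed.

Lemma unit_uniform f eta : unit_continuous f -> 0 < eta ->
  exists2 d : R, 0 < d & forall s t, 0 <= s <= 1 -> 0 <= t <= 1 -> `|s - t| < d ->
    close eta (f s) (f t).
Proof.
move=> cf eta0.
have [|s s01|d d0 h] := @unit_compactness (fun d s => forall t, 0 <= t <= 1 -> `|s - t| < d ->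
    close eta (f s) (f t)).
- by move=> d d' s _ le h t t01 st; apply: h => //; apply: lt_le_trans le.
- have e20 : 0 < eta / 2 by rewrite divr_gt0.
  have [rho rho0 h] := cf s s01 _ e20; exists (rho / 2); first by rewrite divr_gt0.
  move=> s' s'01 ss' t t01 st; rewrite [eta]splitr.
  apply: close_trans (close_sym (h s' s'01 _)) (h t t01 _).
    by apply: lt_le_trans ss' _; rewrite ler_pdivrMr // ler_peMr ?ler1n // ltW.
  by apply: le_lt_trans (ler_distD s' _ _) _; rewrite [rho]splitr; apply: ltrD.
- by exists d => // s t s01 t01; apply: h.
Qed.

Lemma unit_bounded f : unit_continuous f ->
  exists2 d : R, 0 < d & forall t, 0 <= t <= 1 -> `|(f t).1| <= d^-1 /\ `|(f t).2| <= d^-1.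
Proof.
move=> cf; apply: unit_compactness => [d d' t d'0 le [h1 h2]|t t01].
  have inv : d^-1 <= d'^-1 by rewrite lef_pV2 // posrE // (lt_le_trans d'0).
  by split; [apply: le_trans h1 _|apply: le_trans h2 _].
have [rho rho0 h] := cf t t01 _ ltr01.
pose B := `|(f t).1| + `|(f t).2| + 1.
have B0 : 0 < B by rewrite ltr_wpDl // addr_ge0.
exists (Num.min rho B^-1); first by rewrite lt_min rho0 invr_gt0.
move=> t' t'01; rewrite lt_min => /andP[tt' _].
have m0 : 0 < Num.min rho B^-1 by rewrite lt_min rho0 invr_gt0.
have BI : B <= (Num.min rho B^-1)^-1.
  by rewrite -[leLHS]invrK lef_pV2 ?posrE ?invr_gt0 // ge_min lexx orbT.
have [h1 h2] := close_sym (h t' t'01 tt').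
have n1 := ler_distD 0 (f t').1 (f t).1; have n2 := ler_distD 0 (f t').2 (f t).2.
have g1 := normr_ge0 (f t).1; have g2 := normr_ge0 (f t).2.
split; apply: le_trans BI; rewrite /B.
  have := ler_normD ((f t').1 - (f t).1) (f t).1; rewrite subrK; lra.
have := ler_normD ((f t').2 - (f t).2) (f t).2; rewrite subrK; lra.
Qed.

End Compactness.

(** * Pixelating a plane drawing *)

Section Pixels.
Variable R : realType.
Variables (C : R) (n : nat).

Definition scale (z : R) : R := (z + C) * n%:R.

(** The offset [C] makes the coordinates positive, and there are [n] pixels per unit
    of length. *)
Definition pix (p : R * R) : pixel := (Num.truncn (scale p.1), Num.truncn (scale p.2)).

Definition visible (p : R * R) : Prop := 0 <= scale p.1 /\ 0 <= scale p.2.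

Lemma scaleB z z' : scale z - scale z' = (z - z') * n%:R.
Proof. by rewrite /scale; ring. Qed.

Lemma truncn_near (a b : R) (k : nat) : 0 <= a -> 0 <= b -> `|a - b| < k%:R ->
  (Num.truncn a <= Num.truncn b + k)%N.
Proof.
move=> a0 b0 ab; have := truncn_itv a0; have := truncn_itv b0.
move=> /andP[b1 b2] /andP[a1 a2]; rewrite -ltnS -(ltr_nat R) -addSn natrD.
apply: le_lt_trans a1 _; have := ler_norm (a - b); lra.
Qed.

Lemma truncn_far (a b : R) (k : nat) : 0 <= a -> 0 <= b -> b + k%:R <= a ->
  (Num.truncn b + k <= Num.truncn a)%N.
Proof.
move=> a0 b0 ab; rewrite truncn_ge_nat // natrD; apply: le_trans ab.
by rewrite lerD2r truncn_le.
Qed.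

Lemma close_pix d p q (k : nat) : (0 < n)%N -> visible p -> visible q ->
  close d p q -> d * n%:R <= k%:R -> near_pixel k (pix p) (pix q).
Proof.
move=> n0 [p1 p2] [q1 q2] [h1 h2] dk; have n0' : 0 < n%:R :> R by rewrite ltr0n.
have b z z' : `|z - z'| < d -> `|scale z - scale z'| < k%:R.
  move=> h; apply: lt_le_trans dk; rewrite scaleB normrM (ger0_norm (ltW n0')).
  by rewrite ltr_pM2r.
have b1 := b _ _ h1; have b2 := b _ _ h2.
by apply/and4P; split; apply: truncn_near => //; rewrite distrC.
Qed.

Lemma far_pix d p q (j k : nat) : visible p -> visible q ->
  ~ close d p q -> k%:R <= d * n%:R -> near_pixel j (pix p) (pix q) -> (k <= j)%N.
Proof.
move=> [p1 p2] [q1 q2] nc kd /and4P[/= h1 h2 h3 h4].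
have far z z' : 0 <= scale z -> 0 <= scale z' -> d <= `|z - z'| ->
    (Num.truncn (scale z) <= Num.truncn (scale z') + j)%N ->
    (Num.truncn (scale z') <= Num.truncn (scale z) + j)%N -> (k <= j)%N.
  move=> z0 z0' dz c1 c2.
  have : k%:R <= `|scale z - scale z'|.
    apply: le_trans kd _; rewrite scaleB normrM (ger0_norm (ler0n _ n)).
    by rewrite ler_wpM2r.
  case/orP: (le_total (scale z') (scale z)) => le.
    rewrite ger0_norm ?subr_ge0 // => le2.
    have := @truncn_far (scale z) (scale z') k z0 z0'.
    rewrite addrC -lerBrDr => /(_ le2) h; rewrite -(leq_add2l (Num.truncn (scale z'))).
    exact: leq_trans h c1.
  rewrite ler0_norm ?subr_le0 // => le2.
  have := @truncn_far (scale z') (scale z) k z0' z0.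
  rewrite addrC -lerBrDr -opprB => /(_ le2) h; rewrite -(leq_add2l (Num.truncn (scale z))).
  exact: leq_trans h c2.
have [d1|d1] := lerP d `|p.1 - q.1|; first exact: far d1 h1 h2.
have [d2|d2] := lerP d `|p.2 - q.2|; first exact: far d2 h3 h4.
by case: nc; split.
Qed.

End Pixels.

Section Drawing.
Variables (R : realType) (G : sgraph).
Variables (pos : G -> R * R) (arc : edge G -> R -> R * R).
Hypothesis drawing : is_plane_drawing pos arc.

Lemma edge_endpoints (f : edge G) : exists x y : G,
  [/\ adj x y, forall z, (z \in val f) = (z == x) || (z == y),
      arc f 0 = pos x & arc f 1 = pos y].
Proof.
have := valP f; rewrite /edge_set inE => /existsP[a /existsP[b /andP[ab /eqP fE]]].
have memf z : (z \in val f) = (z == a) || (z == b) by rewrite fE !inE.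
have ends := arc_ends drawing f.
have end_of t : [set arc f 0; arc f 1] t -> exists2 x, x \in val f & t = pos x.
  by rewrite ends => -[x /= xf <-]; exists x.
have [x xf x0] := end_of (arc f 0) (or_introl erefl).
have [y yf y1] := end_of (arc f 1) (or_intror erefl).
have xy : x <> y.
  move=> xy; have := arc_inj drawing (f := f) (x := 0) (y := 1).
  rewrite x0 y1 xy => /(_ _ _ erefl).
  by rewrite !in_itv /= !lexx !ler01 => /(_ isT isT) /eqP; rewrite eq_sym oner_eq0.
move: xf yf; rewrite !memf => /orP[] /eqP xE /orP[] /eqP yE; subst x y => //.
  by exists a, b.
by exists b, a; split=> // [|z]; [rewrite adj_sym|rewrite memf orbC].
Qed.

(** A part of the arc [f] strictly between its ends, from a point close to one end
    to a point close to the other, reparametrized over the unit interval.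
    Such parts of different arcs are disjoint compact sets. *)
Definition tame (rho : R) (f : edge G) (w : (G * G) * (R -> R * R)) : Prop :=
  [/\ adj w.1.1 w.1.2, forall z, (z \in val f) = (z == w.1.1) || (z == w.1.2),
      unit_continuous w.2,
      close rho (pos w.1.1) (w.2 0) /\ close rho (pos w.1.2) (w.2 1) &
      forall u, 0 <= u <= 1 -> exists2 t, 0 < t < 1 & w.2 u = arc f t].

Lemma tame_exists (rho : R) f : 0 < rho -> exists w, tame rho f w.
Proof.
move=> rho0; have [x [y [xy mem a0 a1]]] := edge_endpoints f.
have cf := within_unit_continuous (@arc_continuous _ _ _ _ drawing f).
have i0 : 0 <= (0 : R) <= 1 by lra.
have i1 : 0 <= (1 : R) <= 1 by lra.
have [d d0 hd] := cf 0 i0 rho rho0.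
have [d' d'0 hd'] := cf 1 i1 rho rho0.
pose a := Num.min (d / 2) 2^-1; pose b := 1 - Num.min (d' / 2) 2^-1.
have a2 : a <= 2^-1 by rewrite ge_min lexx orbT.
have ad : a <= d / 2 by rewrite ge_min lexx.
have a_gt0 : 0 < a by rewrite lt_min divr_gt0 //= invr_gt0.
have b2 : Num.min (d' / 2) 2^-1 <= 2^-1 by rewrite ge_min lexx orbT.
have bd : Num.min (d' / 2) 2^-1 <= d' / 2 by rewrite ge_min lexx.
have b_gt0 : 0 < Num.min (d' / 2) 2^-1 by rewrite lt_min divr_gt0 //= invr_gt0.
have within u : 0 <= u <= 1 -> 0 < a + u * (b - a) < 1.
  move=> /andP[u0 u1]; rewrite /b.
  have : 0 <= u * (1 - Num.min (d' / 2) 2^-1 - a) by apply: mulr_ge0 => //; lra.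
  have : 0 <= (1 - u) * (1 - Num.min (d' / 2) 2^-1 - a) by apply: mulr_ge0 => //; lra.
  by move=> h1 h2; apply/andP; split; nra.
exists ((x, y), fun u => arc f (a + u * (b - a))); split=> //=.
- move=> u u01 eps eps0; have /andP[wu0 wu1] := within u u01.
  have [e e0 he] := cf (a + u * (b - a)) ltac:(by rewrite !ltW) eps eps0.
  exists e => // t t01 ut; have /andP[wt0 wt1] := within t t01.
  apply: he; first by rewrite !ltW.
  have -> : a + u * (b - a) - (a + t * (b - a)) = (u - t) * (b - a) by ring.
  rewrite normrM; apply: le_lt_trans ut; rewrite ler_piMr //.
  by rewrite ger0_norm /b; lra.
- rewrite -a0 -a1; split; rewrite ?mul0r ?addr0 ?mul1r; [apply: hd|apply: hd'].
  + by lra.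
  + by rewrite sub0r normrN ger0_norm; lra.
  + by rewrite /b; lra.
  + by rewrite ger0_norm /b; lra.
- by move=> u u01; exists (a + u * (b - a)); first exact: within.
Qed.

Lemma pos_off_arc x (f : edge G) (t : R) : x \notin val f -> 0 <= t <= 1 ->
  pos x <> arc f t.
Proof.
move=> xf /andP[t0 t1] e; have ends := @arc_ends _ _ _ _ drawing f.
have noend s : [set arc f 0; arc f 1] s -> pos x <> s.
  rewrite ends => -[z /= zf <-] /(pos_inj drawing) xz.
  by rewrite xz zf in xf.
have [t0'|t0'] := eqVneq t 0; first by apply: (noend (arc f t)) => //; left; rewrite t0'.
have [t1'|t1'] := eqVneq t 1; first by apply: (noend (arc f t)) => //; right; rewrite t1'.
apply: (@arc_avoids_vertices _ _ _ _ drawing f x t _ (esym e)).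
by rewrite in_itv /= lt_neqAle eq_sym t0' t0 lt_neqAle t1' t1.
Qed.

Lemma vertices_separated : exists2 d : R, 0 < d &
  (forall x y, x != y -> ~ close d (pos x) (pos y)) /\
  (forall x (f : edge G) (t : R), x \notin val f -> 0 <= t <= 1 ->
     ~ close d (pos x) (arc f t)).
Proof.
have [d1 d10 h1] : exists2 d1 : R, 0 < d1 & forall p : G * G,
    p.1 != p.2 -> ~ close d1 (pos p.1) (pos p.2).
  apply: fin_positive => [d d' p _ le h /h nc /(close_le le)//|[x y] /=].
  have [->|xy] := eqVneq x y; first by exists 1.
  have [|d d0 nc] := @not_close_ex R (pos x) (pos y); last by exists d.
  by move/(pos_inj drawing) => e; rewrite e eqxx in xy.
have [d2 d20 h2] : exists2 d2 : R, 0 < d2 & forall p : G * edge G,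
    p.1 \notin val p.2 -> forall t : R, 0 <= t <= 1 -> ~ close d2 (pos p.1) (arc p.2 t).
  apply: fin_positive => [d d' p _ le h /h nc t t01 /(close_le le)|[x f] /=]; first exact: nc.
  have [xf|xf] := boolP (x \in val f); first by exists 1.
  have cf := within_unit_continuous (@arc_continuous _ _ _ _ drawing f).
  have [|d d0 nc] := @point_separated R (pos x) _ cf; last by exists d.
  by move=> t; apply: pos_off_arc.
exists (Num.min d1 d2); first by rewrite lt_min d10.
have m1 : Num.min d1 d2 <= d1 by rewrite ge_min lexx.
have m2 : Num.min d1 d2 <= d2 by rewrite ge_min lexx orbT.
split=> [x y xy /(close_le m1)|x f t xf t01 /(close_le m2)]; first exact: (h1 (x, y) xy).
exact: (h2 (x, f) xf t t01).
Qed.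

(** Let d1 separate the vertices from each other and from the arcs not ending
    there.  Trim the arcs within rho = d1 / 4 of their ends, so that the trimmed
    arcs are at some distance d2 from each other, and take pixels small
    compared with rho and d2.  A square of radius r, about rho in pixels,
    around a vertex then contains the starting points of its arcs and meets no other walk. *)
Lemma planar_grid_model : exists N col, @grid_model G (@adj G) N col.
Proof.
have [d1 d10 [vsep esep]] := vertices_separated.
pose rho := d1 / 4; have rho0 : 0 < rho by rewrite divr_gt0.
have [w tw] := fin_all_exists (fun f => tame_exists f rho0).
pose g f := (w f).2.
have gc f : unit_continuous (g f) by have [] := tw f.
have garc f u : 0 <= u <= 1 -> exists2 t, 0 < t < 1 & g f u = arc f t.
  by have [_ _ _ _ h] := tw f; apply: h.
have [d2 d20 gsep] : exists2 d : R, 0 < d & forall p : edge G * edge G,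
    p.1 != p.2 -> forall s t : R, 0 <= s <= 1 -> 0 <= t <= 1 -> ~ close d (g p.1 s) (g p.2 t).
  apply: fin_positive => [d d' p _ le h /h nc s t s01 t01 /(close_le le)|[e f] /=].
    exact: nc.
  have [->|ef] := eqVneq e f; first by exists 1.
  have [|d d0 nc] := arcs_separated (gc e) (gc f); last by exists d.
  move=> s t s01 t01; have [s' s'01 ->] := garc e s s01; have [t' /andP[t'0 t'1] ->] := garc f t t01.
  apply: (@arcs_disjoint _ _ _ _ drawing e f s' t' ef); first by rewrite in_itv.
  by rewrite in_itv /= !ltW.
have [b b0 vbound] : exists2 b : R, 0 < b & forall x : G,
    `|(pos x).1| <= b^-1 /\ `|(pos x).2| <= b^-1.
  apply: fin_positive => [d d' x d'0 le [h1 h2]|x].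
    have inv : d^-1 <= d'^-1 by rewrite lef_pV2 // posrE // (lt_le_trans d'0).
    by split; [apply: le_trans h1 _|apply: le_trans h2 _].
  have n1 := normr_ge0 (pos x).1; have n2 := normr_ge0 (pos x).2.
  exists (`|(pos x).1| + `|(pos x).2| + 1)^-1; first by rewrite invr_gt0; lra.
  by rewrite invrK; split; lra.
have [b' b'0 gbound] : exists2 b : R, 0 < b & forall (f : edge G),
    forall t : R, 0 <= t <= 1 -> `|(g f t).1| <= b^-1 /\ `|(g f t).2| <= b^-1.
  apply: fin_positive => [d d' f d'0 le h t t01|f]; last exact: unit_bounded.
  have inv : d^-1 <= d'^-1 by rewrite lef_pV2 // posrE // (lt_le_trans d'0).
  have [h1 h2] := h t t01.
  by split; [apply: le_trans h1 _|apply: le_trans h2 _].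
(* With 2 pixels in rho, squares of radius r stay disjoint; with 3 pixels in d2,
   so do the walks, whose pixels are within 1 of a sample. *)
pose n := (Num.truncn (2 / rho + 3 / d2)).+1.
have n0 : (0 < n)%N by [].
have nbig : 2 / rho + 3 / d2 < n%:R := truncnS_gt _.
have n_rho : 2 <= rho * n%:R.
  rewrite -ler_pdivrMl // mulrC ltW //; apply: le_lt_trans nbig.
  by rewrite lerDl divr_ge0 // ltW.
have n_d2 : 3 <= d2 * n%:R.
  rewrite -ler_pdivrMl // mulrC ltW //; apply: le_lt_trans nbig.
  by rewrite lerDr divr_ge0 // ltW.
have nR : 1 <= n%:R :> R by rewrite ler1n.
pose m := Num.truncn (rho * n%:R); pose r := m.+1.
have rn0 : 0 <= rho * n%:R by apply: le_trans n_rho.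
have /andP[m_le m_gt] := truncn_itv rn0.
have m2 : (2 <= m)%N by rewrite truncn_ge_nat //; apply: le_trans n_rho.
pose C := b^-1 + b'^-1 + rho + 2.
have ib : 0 < b^-1 by rewrite invr_gt0.
have ib' : 0 < b'^-1 by rewrite invr_gt0.
have scale_big z : `|z| <= b^-1 \/ `|z| <= b'^-1 -> r.+1%:R <= scale C n z.
  move=> zb; have zC : rho + 2 <= z + C.
    by rewrite /C; case: zb; rewrite ler_norml => /andP[]; lra.
  apply: le_trans (_ : (rho + 2) * n%:R <= _); last by rewrite ler_wpM2r.
  rewrite mulrDl /r -[m.+2]addn2 natrD; apply: lerD => //.
  by rewrite ler_peMr.
have r0 : 0 <= r.+1%:R :> R by rewrite ler0n.
have vis_pos x : visible C n (pos x).
  by have [h1 h2] := vbound x; split; apply: le_trans r0 (scale_big _ _); left.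
have vis_g f t : 0 <= t <= 1 -> visible C n (g f t).
  by move=> t01; have [h1 h2] := gbound f t t01; split; apply: le_trans r0 (scale_big _ _); right.
pose P := pix C n.
have d1n : (4 * m)%:R <= d1 * n%:R.
  have -> : d1 = 4 * rho by rewrite /rho; field.
  by rewrite natrM -mulrA ler_pM2l.
have [eta eta0 unif] : exists2 d : R, 0 < d & forall f (s t : R), 0 <= s <= 1 -> 0 <= t <= 1 ->
    `|s - t| < d -> close n%:R^-1 (g f s) (g f t).
  apply: fin_positive => [d d' f _ le h s t s01 t01 st|f].
    by apply: h => //; apply: lt_le_trans le.
  by apply: unit_uniform => //; rewrite invr_gt0; lra.
(* Sampling with step 1 / K < eta moves by less than one pixel. *)
pose K := (Num.truncn eta^-1).+1.
have K0 : 0 < K%:R :> R by rewrite ltr0n.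
have Keta : K%:R^-1 < eta.
  rewrite -[ltRHS]invrK ltf_pV2 ?posrE ?invr_gt0 //; exact: truncnS_gt.
pose t k : R := k%:R / K%:R.
have t01 k : (k <= K)%N -> 0 <= t k <= 1.
  by move=> kK; rewrite divr_ge0 ?ler0n //= ler_pdivrMr // mul1r ler_nat.
have samples f k : (k < K)%N -> near_pixel 1 (P (g f (t k))) (P (g f (t k.+1))).
  move=> kK; apply: (@close_pix R C n n%:R^-1) => //.
  - by apply: vis_g; apply: t01; apply: ltnW.
  - by apply: vis_g; apply: t01.
  - apply: unif; [by apply: t01; apply: ltnW|exact: t01|].
    rewrite /t -mulrBl -natr1 opprD addrA subrr sub0r mulNr mul1r normrN.
    by rewrite ger0_norm // invr_ge0 ltW.
  - by rewrite mulVf //; apply: lt0r_neq0; lra.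
have [walk walkP] := fin_all_exists (fun f => sample_walk (q := fun k => P (g f (t k))) (samples f)).
have t0E : t 0%N = 0 by rewrite /t mul0r.
have tKE : t K = 1 by rewrite /t divff // lt0r_neq0.
have ends_in f z : z != (w f).1.1 -> z != (w f).1.2 -> z \notin val f.
  by move=> z1 z2; have [_ mem _ _ _] := tw f; rewrite mem (negPf z1) (negPf z2).
have route f p : p \in P (g f (t 0%N)) :: walk f ->
    exists2 u, 0 <= u <= 1 & near_pixel 1 (P (g f u)) p.
  by have [_ _ h] := walkP f; case/h => k kK nk; exists (t k) => //; apply: t01.
have big_pix p : r.+1%:R <= scale C n p.1 /\ r.+1%:R <= scale C n p.2 ->
    (r < (P p).1)%N /\ (r < (P p).2)%N.
  by move=> [h1 h2]; split; rewrite /P /pix /= truncn_ge_nat //; apply: le_trans r0 _.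
apply: (@discrete_drawing G (edge G) (@adj G) (fun f => (w f).1.1) (fun f => (w f).1.2)
  r (fun x => P (pos x)) (fun f => P (g f (t 0%N))) walk).
- move=> x y xy.
  have fE : [set x; y]%SET \in edge_set G.
    by rewrite inE; apply/existsP; exists x; apply/existsP; exists y; rewrite xy eqxx.
  pose f : edge G := exist (fun h : {set G} => h \in edge_set G) _ fE; exists f.
  have [aw mem _ _ _] := tw f.
  have mf z : (z == x) || (z == y) = (z == (w f).1.1) || (z == (w f).1.2).
    by rewrite -mem /= !inE.
  have xyN : x != y by apply: contraTneq xy => ->; rewrite adj_irrefl.
  have := mf x; have := mf y; rewrite !eqxx orbT /=.
  move=> /esym/orP[] /eqP yE /esym/orP[] /eqP xE.
  + by rewrite xE yE eqxx in xyN.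
  + by right.
  + by left.
  + by rewrite xE yE eqxx in xyN.
- move=> f; have [aw _ _ _ _] := tw f.
  by apply: contraTneq aw => ->; rewrite adj_irrefl.
- move=> x; apply: big_pix; have [h1 h2] := vbound x.
  by split; apply: scale_big; left.
- move=> x y p xp yp; apply: contra_not_eq (squares_too_far m2) => xy.
  apply: (far_pix (vis_pos x) (vis_pos y) (vsep _ _ xy) d1n).
  by apply: near_pixel_trans xp _; rewrite near_pixel_sym.
- by move=> f; have [] := walkP f.
- move=> f; have [_ _ _ [h _] _] := tw f; rewrite t0E.
  apply: (close_pix n0 (vis_pos _) _ h (ltW m_gt)).
  by apply: vis_g; rewrite lexx ler01.
- move=> f; have [_ _ _ [_ h] _] := tw f; have [_ -> _] := walkP f; rewrite tKE.
  apply: (close_pix n0 (vis_pos _) _ h (ltW m_gt)).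
  by apply: vis_g; rewrite lexx ler01.
- move=> f p /route[u u01 nu]; have [h1 h2] := gbound f u u01.
  have [] := big_pix (g f u) (conj (scale_big _ (or_intror h1)) (scale_big _ (or_intror h2))).
  move=> r1 r2; apply: near_pixel_pos nu (leq_ltn_trans _ r1) (leq_ltn_trans _ r2) => //.
- move=> f f' p /route[u u01 nu] /route[u' u'01 nu']; apply/eqP; apply: contraT => ff'.
  have : (3 <= 1 + 1)%N.
    apply: (far_pix (vis_g f u u01) (vis_g f' u' u'01) (gsep (f, f') ff' _ _ u01 u'01) n_d2).
    by apply: near_pixel_trans nu _; rewrite near_pixel_sym.
  by [].
move=> f x p /route[u u01 nu] xp.
have [->|x1] := eqVneq x (w f).1.1; first by left.
have [->|x2] := eqVneq x (w f).1.2; first by right.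
have [s /andP[s0 s1] gs] := garc f u u01.
have nc : ~ close d1 (pos x) (g f u).
  by rewrite gs; apply: esep; [exact: ends_in|rewrite !ltW].
case: (walk_too_far m2).
apply: (far_pix (vis_pos x) (vis_g f u u01) nc d1n).
by apply: near_pixel_trans xp _; rewrite near_pixel_sym.
Qed.

End Drawing.

End PlaneDrawings.

(** * The labelling number of planar graphs *)

(** The label of an edge is read off from either orientation of it. *)
Lemma labelling_total (G : sgraph) (M : nat) :
  labellable M (@adj G) (@adj G) -> has_total_labelling G (M + 2).
Proof.
case=> cv [ce [lv ls le lf]]; rewrite /has_total_labelling addn2 /=.
pose cast (a : 'I_(M + 3)) : 'I_(M.+2).+1 := cast_ord (addn3 M) a.
pose ends (f : edge G) (p : G * G) := adj p.1 p.2 && (val f == [set p.1; p.2]%SET).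
pose ef (f : edge G) := odflt ord0 (omap (fun p => cast (ce p.1 p.2)) [pick p | ends f p]).
have efE f x y : adj x y -> val f = [set x; y]%SET -> ef f = cast (ce x y).
  move=> xy fE; rewrite /ef; case: pickP => [[a b] /andP[/= ab]|/(_ (x, y))]; last first.
    by rewrite /ends /= xy fE eqxx.
  rewrite fE => /eqP/finset.setP E; congr cast.
  have abN : a != b by apply: contraTneq ab => ->; rewrite adj_irrefl.
  have xyN : x != y by apply: contraTneq xy => ->; rewrite adj_irrefl.
  have := E a; have := E b; rewrite !inE !eqxx orbT /=.
  case/orP => /eqP bE /orP[] /eqP aE; rewrite aE bE //.
  - by rewrite aE bE eqxx in abN.
  - by rewrite aE bE eqxx in abN.
have edgeE (f : edge G) : exists x y, adj x y /\ val f = [set x; y]%SET.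
  have := valP f; rewrite /edge_set inE => /existsP[x /existsP[y /andP[xy /eqP fE]]].
  by exists x, y.
have farE a b : far (nat_of_ord a) (nat_of_ord b) ->
    2 <= `|(cast a : nat) - (cast b : nat)|%N.
  by rewrite /far /=; lia.
apply/existsP; exists [ffun z => match z with inl x => cast (cv x) | inr f => ef f end].
apply/and3P; split.
- apply/forallP=> x; apply/forallP=> y; apply/implyP=> xy; rewrite !ffunE.
  by rewrite (inj_eq (@cast_ord_inj _ _ _)); apply: lv; rewrite ?inE.
- apply/forallP=> f; apply/forallP=> g; apply/implyP=> /andP[fg meet]; rewrite !ffunE.
  have [x [xf xg]] : exists x, x \in val f /\ x \in val g.
    by have /set0Pn[x] := meet; rewrite inE => /andP[]; exists x.
  have other (h : edge G) : x \in val h -> exists y, adj x y /\ val h = [set x; y]%SET.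
    have [a [b [ab ->]]] := edgeE h; rewrite !inE => /orP[] /eqP->; first by exists b.
    by exists a; rewrite adj_sym ab; split=> //; apply/finset.setP => z; rewrite !inE orbC.
  have [y [xy fE]] := other f xf; have [z [xz gE]] := other g xg.
  rewrite (efE f x y) // (efE g x z) // (inj_eq (@cast_ord_inj _ _ _)).
  apply: le xy xz _; apply: contra_neq fg => yz.
  by apply: val_inj; rewrite /= fE gE yz.
apply/forallP=> x; apply/forallP=> f; apply/implyP=> xf; rewrite !ffunE.
have [a [b [ab fE]]] := edgeE f; rewrite (efE f a b) //.
apply: farE; move: xf; rewrite fE !inE => /orP[] /eqP->; first by apply: lf; rewrite ?inE.
by rewrite ls; apply: lf; rewrite ?inE // adj_sym.
Qed.

Theorem theorem1p6 (R : realType) (M : nat) (G : sgraph) :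
  12 <= M -> planar R G -> max_degree G <= M ->
  total_labelling_number G <= M + 2 /\
  (M = max_degree G -> total_labelling_number G <= max_degree G + 2).
Proof.
move=> M12 [pos [arc drawing]] degM.
have [N [col gm]] := planar_grid_model drawing.
suff le : total_labelling_number G <= M + 2 by split=> // <-.
have deg_adj x : deg (@adj G) x <= M by apply: leq_trans degM; apply: leq_bigmax.
have lab := grid_labellable M12 (@adj_irrefl G) deg_adj gm (@adj_sym G) (@adj_sym G)
  (fun _ _ h => h) (fun _ _ h => h).
rewrite /total_labelling_number; case: ex_minnP => k _; apply.
exact: labelling_total.
Qed.
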